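(* Let $a\in\mathbb{R}$, let $n\geq 1$ be an integer, $1\leq r\leq\infty$, $\gamma<n$, and $\beta>0$. Let $\alpha>0$ satisfy $$\frac{-\gamma}{\beta}\leq\alpha<\min\Bigl(\frac{2-\gamma}{\beta},\ \frac{n-\gamma}{\beta+1},\ \frac{n}{\beta+1}\Bigr).$$ Then the integral equation $$u(t)=e^{t\Delta}u_0+a\int_0^t e^{(t-\tau)\Delta}\bigl(|\cdot|^{-\gamma}|u(\tau)|^{\beta}u(\tau)\bigr)\,d\tau \qquad (\ast)$$ is locally well posed in $\dot K_\infty^{\alpha,r}$. More precisely, for every $u_0\in\dot K_\infty^{\alpha,r}$ there exists $T>0$ such that $(\ast)$ admits a unique solution $u\in C([0,T],\dot K_\infty^{\alpha,r})$. Moreover, the solution can be extended to a maximal interval of existence $[0,T_{\max})$, where either $T_{\max}=\infty$, or $T_{\max}<\infty$ and $$\lim_{t\to T_{\max}}\|u(t)\|_{\dot K_\infty^{\alpha,r}}=\infty.$$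
   Context: For $k\in\mathbb{Z}$ let $B_k=B(0,2^k)\subset\mathbb{R}^n$, $R_k=B_k\setminus B_{k-1}$, and let $\chi_k$ be the characteristic function of $R_k$. For $\alpha\in\mathbb{R}$ and $1\leq p,q\leq\infty$, the homogeneous Herz space $\dot K_p^{\alpha,q}$ is the set of all $f\in L^p_{\mathrm{loc}}(\mathbb{R}^n\setminus\{0\})$ with $$\|f\|_{\dot K_p^{\alpha,q}}=\Bigl(\sum_{k=-\infty}^{\infty}2^{k\alpha q}\|f\chi_k\|_{L^p(\mathbb{R}^n)}^q\Bigr)^{1/q}<\infty,$$ with the usual modifications when $p=\infty$ and/or $q=\infty$. Here $e^{t\Delta}$ denotes the heat semigroup on $\mathbb{R}^n$ (convolution with the Gaussian heat kernel). Equation $(\ast)$ is the mild formulation of the Hardy--Hénon equation $\partial_t u=\Delta u+a|x|^{-\gamma}|u|^{\beta}u$, $u(0)=u_0$; a solution is a function $u$ satisfying $(\ast)$ on the relevant time interval.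
   Formalization: Norm continuity at t=0 fails for general data (a=0, u_0 a shell indicator); solutions are bounded and continuous on (0,T], u−e^{tΔ}u_0 is continuous on [0,T], u∈C([0,T],K) iff e^{tΔ}u_0 is, and uniqueness holds in this larger class. *)

(* Defs.v *)
From HB Require Import structures.
From mathcomp Require Import all_boot all_order all_algebra.
From mathcomp Require Import all_classical all_reals all_analysis.

Set Implicit Arguments.
Unset Strict Implicit.
Unset Printing Implicit Defensive.

Import Order.TTheory GRing.Theory Num.Theory.
Import numFieldNormedType.Exports.

Local Open Scope classical_set_scope.
Local Open Scope ring_scope.

(* R^n, with the product of the Borel sigma-algebras of the coordinates. *)
Notation space R n := (n.-tuple (measurableTypeR R)).

Section LebesgueMeasure.
Context {R : realType}.
Local Open Scope ereal_scope.

Definition tuple_cons n (p : measurableTypeR R * space R n) : space R n.+1 :=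
  [tuple of p.1 :: p.2].

Lemma measurable_tuple_cons n : measurable_fun setT (@tuple_cons n).
Proof. exact: measurable_cons. Qed.

Definition tuple_uncons n (x : space R n.+1) : measurableTypeR R * space R n :=
  (thead x, [tuple of behead x]).

Lemma measurable_tuple_uncons n : measurable_fun setT (@tuple_uncons n).
Proof.
apply/measurable_fun_pairP; split; first exact: measurable_tnth.
exact: measurable_behead.
Qed.

Lemma tuple_consK n : cancel (@tuple_cons n) (@tuple_uncons n).
Proof. by case=> a b; congr (_, _); exact/val_inj. Qed.

Lemma tnth_uncons n (x : space R n.+1) j :
  tnth (tuple_uncons x).2 j = tnth x (lift ord0 j).
Proof. by rewrite [in RHS](tuple_eta x) tnthS. Qed.

Section step.
Variables (n : nat) (m : {sigma_finite_measure set (space R n) -> \bar R}).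

Definition lebesgue_step : set (space R n.+1) -> \bar R :=
  pushforward (@lebesgue_measure R \x m) (@tuple_cons n).

Let step0 : lebesgue_step set0 = 0.
Proof. by rewrite /lebesgue_step /pushforward preimage_set0 measure0. Qed.

Let step_ge0 A : 0 <= lebesgue_step A.
Proof. by rewrite /lebesgue_step /pushforward measure_ge0. Qed.

Let mcons A : measurable A -> measurable (@tuple_cons n @^-1` A).
Proof. by move=> mA; rewrite -[X in measurable X]setTI; exact: measurable_tuple_cons. Qed.

Let step_sigma_additive : semi_sigma_additive lebesgue_step.
Proof.
move=> F mF tF mUF; rewrite /lebesgue_step /pushforward preimage_bigcup.
apply: measure_semi_sigma_additive => [k||]; first exact: mcons.
- apply/trivIsetP => /= i j _ _ ij; rewrite -preimage_setI.
  by move/trivIsetP : tF => /(_ _ _ _ _ ij) ->//; rewrite preimage_set0.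
- by rewrite -preimage_bigcup; exact: mcons.
Qed.

HB.instance Definition _ := isMeasure.Build _ _ _
  lebesgue_step step0 step_ge0 step_sigma_additive.

Lemma lebesgue_stepX (A : set (measurableTypeR R)) (B : set (space R n)) :
  measurable A -> measurable B ->
  lebesgue_step (@tuple_uncons n @^-1` (A `*` B)) = lebesgue_measure A * m B.
Proof.
move=> mA mB; rewrite /lebesgue_step /pushforward -comp_preimage.
by rewrite (funext (@tuple_consK n) : _ \o _ = id) preimage_id product_measure1E.
Qed.

Let step_sigma_finite : sigma_finite setT lebesgue_step.
Proof.
have /sigma_finiteP[F [TF ndF Foo]] := sigma_finiteT (@lebesgue_measure R).
have /sigma_finiteP[G [TG ndG Goo]] := sigma_finiteT m.
exists (fun k => @tuple_uncons n @^-1` (F k `*` G k)).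
  apply/esym; rewrite -subTset => x _.
  have [i _ Fi] : (\bigcup_i F i) (thead x) by rewrite -TF.
  have [j _ Gj] : (\bigcup_i G i) [tuple of behead x] by rewrite -TG.
  exists (maxn i j) => //; split.
  - by move: Fi; exact/subsetPset/ndF/leq_maxl.
  - by move: Gj; exact/subsetPset/ndG/leq_maxr.
move=> k; have [mF Fk] := Foo k; have [mG Gk] := Goo k; split.
  rewrite -[X in measurable X]setTI.
  by apply: measurable_tuple_uncons => //; exact: measurableX.
by rewrite lebesgue_stepX// lte_mul_pinfty// ge0_fin_numE.
Qed.

HB.instance Definition _ :=
  Measure_isSigmaFinite.Build _ _ _ lebesgue_step step_sigma_finite.
End step.

Fixpoint lebesgue_space n :
    {sigma_finite_measure set (space R n) -> \bar R} :=
  match n with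
  | 0 => (\d_ ([tuple] : space R 0))
  | n'.+1 => lebesgue_step (lebesgue_space n')
  end.

Lemma lebesgue_space_box n (A : 'I_n -> set (measurableTypeR R)) :
  (forall i, measurable (A i)) ->
  lebesgue_space n [set x | forall i, A i (tnth x i)] =
  \prod_(i < n) lebesgue_measure (A i).
Proof.
elim: n A => [|n IH] A mA.
  by rewrite big_ord0 /= diracE mem_set//= => -[].
rewrite big_ord_recl -IH => [|i]; last exact: mA.
rewrite /= -lebesgue_stepX//.
  congr (lebesgue_step _ _); apply/seteqP; split=> x /=.
    move=> Ax; split=> [|i]; first exact: Ax.
    by have := Ax (lift ord0 i); rewrite -tnth_uncons.
  move=> [A0 AS] i; case: (unliftP ord0 i) => [j ->|->//].
  by rewrite -tnth_uncons; exact: AS.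
rewrite (_ : [set _ | _] = \bigcap_(i in [set: 'I_n])
   ((@tnth n (measurableTypeR R) ^~ i) @^-1` A (lift ord0 i))).
  apply: fin_bigcap_measurable => // i _.
  by rewrite -[X in measurable X]setTI; exact: measurable_tnth.
by apply/seteqP; split=> x /= H i => [_|]; exact: H.
Qed.
End LebesgueMeasure.

Section Herz.
Context {R : realType} {n : nat}.
Implicit Types (alpha gamma beta t T : R) (p q : \bar R) (x y : space R n).
Implicit Types (f g : space R n -> R) (u v : R -> space R n -> R).

Local Notation leb := (lebesgue_space n).

Definition enorm x : R := Num.sqrt (\sum_(i < n) tnth x i ^+ 2).

Definition vsub x y : space R n := [tuple tnth x i - tnth y i | i < n].

Definition dyadic_ball (k : int) : set (space R n) :=
  [set x | enorm x < 2 ^ k].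

Definition dyadic_ring (k : int) : set (space R n) :=
  dyadic_ball k `\` dyadic_ball (k - 1).

(* Every compact subset of R^n \ {0} lies in one of these closed shells, and
   the shells are themselves compact subsets of R^n \ {0}. *)
Definition lp_loc p : set (space R n -> R) :=
  [set f : space R n -> R | measurable_fun setT f /\
    forall a b : R, 0 < a ->
      ('N[leb]_p[EFin \o (f \* \1_[set x | a <= enorm x <= b])%R] < +oo)%E].

Definition herz_norm p alpha q f : \bar R :=
  let N k := 'N[leb]_p[EFin \o (f \* \1_(dyadic_ring k))%R]%E in
  match q with
  | q%:E => ((\esum_(k in [set: int])
               ((2 `^ (k%:~R * alpha * q))%:E * N k `^ q)) `^ q^-1)%E
  | _ => ereal_sup [set ((2 `^ (k%:~R * alpha))%:E * N k)%E | k in [set: int]]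
  end.

(* Elements are (Borel) functions; two functions that agree almost everywhere
   represent the same element of the Herz space. *)
Definition herz p alpha q : set (space R n -> R) :=
  [set f | lp_loc p f /\ (herz_norm p alpha q f < +oo)%E].

(* v belongs to C(D, herz p alpha q) for the norm topology. *)
Definition herz_continuous p alpha q (D : set R) v : Prop :=
  forall t, D t -> herz p alpha q (v t) /\
    herz_norm p alpha q (v s \- v t) @[s --> within D (nbhs t)] --> 0%E.

Definition heat_kernel t x : R :=
  (4 * pi * t) `^ (- (n%:R / 2)) * expR (- (enorm x ^+ 2 / (4 * t))).

(* e^{t Delta} f, for t >= 0 *)
Definition heat t f x : R :=
  if t == 0 then f x else \int[leb]_y (heat_kernel t (vsub x y) * f y).

Definition hardy_henon gamma beta f x : R :=
  enorm x `^ (- gamma) * `|f x| `^ beta * f x.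

Definition mild_solution (a gamma beta : R) f T u : Prop :=
  forall t, 0 <= t <= T -> \forall x \ae leb,
    u t x = heat t f x + a *
      \int[lebesgue_measure]_(s in `[0, t])
         heat (t - s) (hardy_henon gamma beta (u s)) x.

(* The solution class on [0, T]: bounded with values in the Herz space and
   norm continuous on ]0, T]. It contains C([0, T], herz p alpha q), but not
   only: when p = oo the heat semigroup is not strongly continuous at t = 0
   (e^{t Delta} f is a continuous function for t > 0, so it cannot converge
   uniformly on a ring to a discontinuous f), so a solution cannot be norm
   continuous at t = 0 for every initial value, even in the linear case. *)
Definition herz_class p alpha q T u : Prop :=
  [/\ forall t, 0 <= t <= T -> herz p alpha q (u t),
      exists M : R, forall t, 0 <= t <= T ->
        (herz_norm p alpha q (u t) <= M%:E)%E &
      herz_continuous p alpha q `]0, T] u].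

Definition herz_solution (a gamma beta : R) p alpha q f T u : Prop :=
  herz_class p alpha q T u /\ mild_solution a gamma beta f T u.

Definition ae_equal_on T u v : Prop :=
  forall t, 0 <= t <= T -> \forall x \ae leb, u t x = v t x.

End Herz.

(* Main.v *)
(* A function of finite Herz norm is dominated almost everywhere by
   [|x|^-alpha w(|x|)], where [w] is a bounded radial weight whose dyadic values are
   in l^q and which varies at most like a small power [eps].  For such weights the
   heat kernel estimate
     [int G_t(x - y) |y|^-d w(|y|) dy <= C t^(-sigma/2) |x|^-(d - sigma) w(|x|)],
   valid for [eps <= d - sigma] and [d + eps < n], reproduces the same weight.  With
   [sigma = alpha beta + gamma] and [d = alpha + sigma], the nonlinearity maps the
   order interval [|u| <= |x|^-alpha w] into [|f| <= C (sup w)^beta |x|^-d w], so the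
   Duhamel term returns to the first order interval with a factor [t^(1 - sigma/2)].
   Picard iteration then converges pointwise, on a time that depends only on the
   norm of the data, without using any completeness of the Herz space.
   The same estimate with constant weights gives uniqueness, on successive short
   intervals.  Continuity for positive times comes from a Hoelder estimate in time for
   the heat kernel.  The solution is restarted at time [T] from [u T] thanks to the
   semigroup law, with a step that depends only on the norm of [u T]: hence the
   blow-up alternative. *)
Require Import Defs.
From HB Require Import structures.
From mathcomp Require Import all_boot all_order all_algebra.
From mathcomp Require Import all_classical all_reals all_analysis.
From mathcomp Require Import measurable_realfun ess_sup_inf.
From mathcomp Require Import ring lra.

Set Implicit Arguments.
Unset Strict Implicit.
Unset Printing Implicit Defensive.

Import Order.TTheory GRing.Theory Num.Theory.
Import numFieldNormedType.Exports.

Local Open Scope classical_set_scope.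
Local Open Scope ring_scope.

(** * Integration on Euclidean space *)

Section LebesgueSpace.
Context {R : realType}.
Local Notation Rn n := (n.-tuple (measurableTypeR R)).
Local Open Scope ereal_scope.

(** The heat kernel mixes all dyadic rings, and bounds with constant weights would retain only the
    supremum over rings, not the l^q summability. A fixed weight keeps it, because it reappears
    unchanged on the right of every estimate; only its supremum enters the constants, hence the
    existence time. With [sigma = alpha * beta + gamma], the condition -gamma/beta <= alpha says
    sigma >= 0, alpha < (2 - gamma)/beta says sigma < 2, which makes (t - s)^(-sigma/2) integrable
    in time, and alpha < (n - gamma)/(beta + 1) says alpha + sigma < n, which makes the source
    locally integrable. The strict inequality in the last one leaves room for a positive [eps]. The
    other obstacle is measurability: a member of the solution class is a family of functions, not
    assumed jointly measurable in time and space, so that its Duhamel integrand is measurable in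
    time only through norm continuity on ]0, T]. Existence and continuation therefore use the
    stronger [exact_solution] (jointly measurable, one weight for all times, equation at every
    point), and uniqueness carries the conclusions over to the whole class. *)

Lemma ge0_integral_spaceS n (f : Rn n.+1 -> \bar R) :
  measurable_fun setT f -> (forall x, 0 <= f x) ->
  \int[lebesgue_space n.+1]_x f x =
  \int[lebesgue_measure]_x \int[lebesgue_space n]_y f (tuple_cons (x, y)).
Proof.
move=> mf f0.
transitivity (\int[lebesgue_measure \x lebesgue_space n]_z f (tuple_cons z)).
  exact: (@ge0_integral_pushforward _ _ _ _ R _
    (@measurable_tuple_cons R n) (lebesgue_measure \x lebesgue_space n)%E setT f).
rewrite fubini_tonelli1//.
by apply: measurableT_comp => //; exact: measurable_tuple_cons.
Qed.

Lemma integral_lebesgue_space_prod n (f : 'I_n -> measurableTypeR R -> R) :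
  (forall i, measurable_fun setT (f i)) -> (forall i x, (0 <= f i x)%R) ->
  \int[lebesgue_space n]_x (\prod_(i < n) f i (tnth x i))%:E =
  \prod_(i < n) \int[lebesgue_measure]_y (f i y)%:E.
Proof.
elim: n f => [|n IH] f mf f0.
  under eq_integral do rewrite big_ord0.
  by rewrite big_ord0 /= integral_dirac// diracT mul1e.
have mprod k (h : 'I_k -> measurableTypeR R -> R) :
    (forall i, measurable_fun setT (h i)) ->
    measurable_fun setT (fun x : Rn k => (\prod_(i < k) h i (tnth x i))%:E).
  move=> mh; apply/measurable_EFinP.
  apply: measurable_prod => i _.
  by apply: (measurableT_comp (mh i)); exact: measurable_tnth.
rewrite ge0_integral_spaceS//; last 2 first.
- exact: mprod.
- by move=> x; rewrite lee_fin prodr_ge0.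
rewrite big_ord_recl -IH//.
have mP := mprod n (fun i => f (lift ord0 i)) (fun i => mf _).
have P0 (y : Rn n) : 0 <= (\prod_(i < n) f (lift ord0 i) (tnth y i))%:E.
  by rewrite lee_fin prodr_ge0.
transitivity (\int[lebesgue_measure]_x ((f ord0 x)%:E *
    \int[lebesgue_space n]_y (\prod_(i < n) f (lift ord0 i) (tnth y i))%:E)).
  apply: eq_integral => x _; rewrite -ge0_integralZl//; last first.
    by rewrite lee_fin.
  apply: eq_integral => y _; rewrite big_ord_recl EFinM.
  by under eq_bigr => i _ do rewrite -tnth_uncons tuple_consK /=.
rewrite ge0_integralZr//.
- exact/measurable_EFinP.
- by move=> y _; rewrite lee_fin f0.
- by apply: integral_ge0 => x _; rewrite lee_fin prodr_ge0.
Qed.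

(** The hyperplane is a box with one side reduced to a point, so its measure is a product with a
    zero factor. *)
Lemma ae_tnth_neq0 n (i : 'I_n) :
  \forall x \ae lebesgue_space n, tnth x i != 0%R :> R.
Proof.
pose A j : set (measurableTypeR R) := if j == i then [set 0%R] else setT.
have AE : [set x : Rn n | forall j, A j (tnth x j)] =
    (@tnth n (measurableTypeR R) ^~ i) @^-1` [set 0%R].
  apply/seteqP; split => x /=; first by move=> /(_ i); rewrite /A eqxx.
  by move=> xi j; rewrite /A; case: eqP => // ->.
exists ((@tnth n (measurableTypeR R) ^~ i) @^-1` [set 0%R]); split.
- by rewrite -[X in measurable X]setTI; apply: measurable_tnth.
- rewrite -AE lebesgue_space_box => [|j]; last by rewrite /A; case: ifP.
  by rewrite (bigD1 i)//= /A eqxx lebesgue_measure_set1 mul0e.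
- by move=> x /= /negP; rewrite negbK => /eqP.
Qed.

End LebesgueSpace.

(** * The singularity |s - c|^-theta in one variable *)

Section PowerIntegral.
Context {R : realType}.
Local Notation mu := (@lebesgue_measure R).
Implicit Types (c L theta : R).

Lemma integral_derivative (f F : R -> R) (a b : R) : a < b ->
  (forall x, a <= x <= b -> is_derive x 1 F (f x)) ->
  (forall x, a <= x <= b -> {for x, continuous f}) ->
  (\int[mu]_(x in `[a, b]) (f x)%:E = (F b)%:E - (F a)%:E)%E.
Proof.
move=> ab dF cf.
have cF x : a <= x <= b -> {for x, continuous F}.
  move=> /dF dx; apply: differentiable_continuous.
  by rewrite -derivable1_diffP; exact: ex_derive.
apply: continuous_FTC2 => //.
- apply: continuous_in_subspaceT => x; rewrite inE/= in_itv/=; exact: cf.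
- split.
  + move=> x /[!in_itv]/= /andP[ax xb]; apply: ex_derive.
    by apply: dF; rewrite !ltW.
  + by apply: cvg_at_right_filter; apply: cF; rewrite lexx ltW.
  + by apply: cvg_at_left_filter; apply: cF; rewrite lexx ltW.
- move=> x /[!in_itv]/= /andP[ax xb]; rewrite derive1E.
  have := dF x; rewrite !ltW//= => /(_ isT) d; exact: derive_val.
Qed.

Let measurable_dist c theta :
  measurable_fun setT (fun s : R => (`|s - c| `^ (- theta))%:E).
Proof.
apply/measurable_EFinP; apply: (measurableT_comp (measurable_powR _)).
by apply: measurableT_comp => //; exact: measurable_funB.
Qed.

Let integral_right (c theta e L : R) : 0 <= theta < 1 -> 0 < e -> e < L ->
  (\int[mu]_(s in `[(c + e)%R, (c + L)%R]) (`|s - c| `^ (- theta))%:E <=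
   (L `^ (1 - theta) / (1 - theta))%:E)%E.
Proof.
move=> /andP[t0 t1] e0 eL.
pose F s := (s - c) `^ (1 - theta) / (1 - theta).
have D (s : R) : c + e <= s -> is_derive s 1 F ((s - c) `^ (- theta)).
  move=> cs; have sc : 0 < s - c by lra.
  rewrite /F.
  have d1 : is_derive s 1 (fun s : R => s - c) 1.
    by rewrite -[X in is_derive _ _ _ X]subr0; apply: is_deriveB.
  have d2 := is_derive1_comp (f := fun y => y `^ (1 - theta))
    (g := fun s => s - c) (is_derive1_powR (1 - theta) sc) d1.
  have -> : (s - c) `^ (- theta) =
     (1 - theta)^-1 *: ((1 - theta) * (s - c) `^ (1 - theta - 1) *: 1).
    rewrite /GRing.scale/= mulr1 mulrA mulVf ?mul1r ?gt_eqF ?subr_gt0//.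
    by congr (_ `^ _); ring.
  rewrite (_ : (fun s => _) = (1 - theta)^-1 \*: (fun s => (s - c) `^ (1 - theta))).
    exact: is_deriveZ.
  by apply/funext => y; rewrite /= mulrC.
rewrite [leLHS](_ : _ =
    (\int[mu]_(s in `[(c + e)%R, (c + L)%R]) ((s - c) `^ (- theta))%:E)%E); last first.
  apply: eq_integral => s; rewrite inE/= in_itv/= => /andP[s1 s2].
  by rewrite ger0_norm//; lra.
have cf (s : R) : c + e <= s -> {for s, continuous (fun s => (s - c) `^ (- theta))}.
  move=> cs; apply: differentiable_continuous; rewrite -derivable1_diffP.
  have sc : 0 < s - c by lra.
  have d1 : is_derive s 1 (fun s : R => s - c) 1.
    by rewrite -[X in is_derive _ _ _ X]subr0; apply: is_deriveB.
  have d2 := is_derive1_comp (f := fun y => y `^ (- theta))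
    (g := fun s => s - c) (is_derive1_powR (- theta) sc) d1.
  exact: ex_derive.
have ceL : c + e < c + L by lra.
rewrite (integral_derivative ceL (fun x h => D x (proj1 (andP h)))
  (fun x h => cf x (proj1 (andP h)))).
rewrite -EFinB lee_fin /F [c + L]addrC addrK gerBl.
by rewrite divr_ge0 ?powR_ge0//; lra.
Qed.

Let integral_left (c theta e L : R) : 0 <= theta < 1 -> 0 < e -> e < L ->
  (\int[mu]_(s in `[(c - L)%R, (c - e)%R]) (`|s - c| `^ (- theta))%:E <=
   (L `^ (1 - theta) / (1 - theta))%:E)%E.
Proof.
move=> t01 e0 eL.
have H := @integral_right (- c) theta e L t01 e0 eL.
rewrite (_ : c - L = - (- c + L)); last by ring.
rewrite (_ : c - e = - (- c + e)); last by ring.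
rewrite integration_by_substitution_oppr; last 2 first.
- lra.
- apply: continuous_in_subspaceT => x; rewrite inE/= in_itv/= => /andP[x1 x2].
  have cx : x - c != 0 by rewrite lt_eqF//; lra.
  have : {for x, continuous ((fun y => y `^ (- theta)) \o (fun s : R => `|s - c|))}.
    apply: continuous_comp.
      apply: (continuous_comp (f := fun s : R => s - c)).
        by apply: cvgB; [exact: cvg_id|exact: cvg_cst].
      exact: norm_continuous.
    apply: differentiable_continuous; rewrite -derivable1_diffP.
    apply: derivable_powR; first by rewrite in_itv/= andbT normr_gt0.
  by [].
rewrite (le_trans _ H)// le_eqVlt; apply/orP; left; apply/eqP.
by apply: eq_integral => s _ /=; rewrite opprK -normrN opprD !opprK.
Qed.

(** The primitive is not differentiable at c, so a neighbourhood of radius e is cut out; the bounds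
    on both sides do not depend on e, and monotone convergence closes the gap. *)
Lemma integral_powR_dist c theta L : 0 <= theta < 1 -> 0 <= L ->
  (\int[mu]_(s in `[(c - L)%R, (c + L)%R]) (`|s - c| `^ (- theta))%:E <=
   (2 * (L `^ (1 - theta) / (1 - theta)))%:E)%E.
Proof.
move=> t01; rewrite le_eqVlt => /predU1P[<-|L0].
  by rewrite subr0 addr0 set_itv1 integral_set1 lee_fin mulr_ge0// divr_ge0 ?powR_ge0//; lra.
(* The denominator k + 2 makes e k < L already at k = 0. *)
pose e k : R := L / k.+2%:R.
have e0 k : 0 < e k by rewrite divr_gt0.
have eL k : e k < L.
  by rewrite ltr_pdivrMr// -[X in X < _]mulr1 ltr_pM2l// ltr1n.
pose D (k : nat) : set (measurableTypeR R) := `[c - L, c - e k] `|` `[c + e k, c + L].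
have mD k : measurable (D k) by apply: measurableU.
(* The union of the [D k] misses exactly the point c, which is null. *)
rewrite -(@integral_setD1 _ _ c); last 2 first.
- exact: measurableD.
- exact: measurable_funTS (measurable_dist c theta).
have -> : `[c - L, c + L] `\ c = \bigcup_k D k.
  apply/seteqP; split=> x /=.
    rewrite in_itv/= => -[/andP[x1 x2] /eqP xc].
    have x0 : 0 < `|x - c| by rewrite normr_gt0 subr_eq0.
    have [k ek] : exists k, e k <= `|x - c|.
      exists (Num.truncn (L / `|x - c|)).
      rewrite /e ler_pdivrMr// mulrC -ler_pdivrMr//.
      rewrite (le_trans (ltW (truncnS_gt _)))// ler_nat.
      by [].
    exists k => //; rewrite /D/= !in_itv/=.
    have [xc0|xc0] := leP c x.
      by right; rewrite ger0_norm ?subr_ge0// in ek; apply/andP; split; lra.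
    by left; rewrite ltr0_norm ?subr_lt0// in ek; apply/andP; split; lra.
  by move=> [k _]; rewrite /D/= !in_itv/= => -[] /andP[x1 x2];
    have := e0 k; have := eL k => ? ?; split; [apply/andP; split; lra|apply/eqP; lra
      |apply/andP; split; lra|apply/eqP; lra].
have ndD : nondecreasing_seq D.
  apply/nondecreasing_seqP => k; rewrite subsetEset => x; rewrite /D/= !in_itv/=.
  have ee : e k.+1 <= e k.
    by rewrite /e ler_pM2l// lef_pV2 ?posrE// ler_nat.
  by move=> [] /andP[x1 x2]; [left|right]; apply/andP; split; lra.
have D0 k (s : measurableTypeR R) : D k s -> (0 <= (`|s - c| `^ (- theta))%:E)%E.
  by rewrite lee_fin powR_ge0.
have /cvg_lim := @ge0_nondecreasing_set_cvg_integral _ (measurableTypeR R) R D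
  (fun s : R => (`|s - c| `^ (- theta))%:E) mu ndD mD
  (fun i => measurable_funTS (measurable_dist c theta)) D0.
move=> <- //; apply: lime_le.
  apply: ereal_nondecreasing_is_cvgn.
  exact: (@ge0_nondecreasing_set_nondecreasing_integral _ (measurableTypeR R) R D
  (fun s : R => (`|s - c| `^ (- theta))%:E) mu ndD mD
  (fun i => measurable_funTS (measurable_dist c theta)) D0).
apply: nearW => k; rewrite ge0_integral_setU//.
- rewrite mulr_natl mulr2n EFinD.
  exact: leeD (integral_left c t01 (e0 k) (eL k)) (integral_right c t01 (e0 k) (eL k)).
- exact: measurable_funTS (measurable_dist c theta).
- apply/disj_setPS => x /=; rewrite !in_itv/= => -[/andP[x1 x2] /andP[x3 x4]].
  by have := e0 k; lra.
Qed.

End PowerIntegral.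

(* [x^-1 = x * (x ^+ 2) `^ (-1)] also holds at [x = 0]. *)
Lemma measurable_invr {R : realType} :
  measurable_fun [set: measurableTypeR R] (fun x : measurableTypeR R => (x : R)^-1).
Proof.
rewrite (_ : (fun _ => _) = fun x : measurableTypeR R => (x : R) * (x ^+ 2) `^ (- 1)).
  apply: measurable_funM => //; apply: (measurableT_comp (measurable_powR _)).
  exact: measurable_funX.
apply/funext => x; rewrite powR_inv1 ?sqr_ge0//.
have [->|x0] := eqVneq (x : R) 0; first by rewrite invr0 mul0r.
by field.
Qed.

(** * The heat kernel *)

Section HeatKernel.
Context {R : realType} {n : nat}.
Local Notation Rn := (n.-tuple (measurableTypeR R)).
Local Notation leb := (@lebesgue_space R n).
Implicit Types (x y z : Rn) (s t d : R).

Lemma enorm_ge0 x : 0 <= enorm x.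
Proof. exact: sqrtr_ge0. Qed.
Hint Resolve enorm_ge0 : core.

Lemma enorm2 x : enorm x ^+ 2 = \sum_(i < n) tnth x i ^+ 2.
Proof. by rewrite sqr_sqrtr// sumr_ge0// => i _; exact: sqr_ge0. Qed.

Lemma enorm_tnth x i : `|tnth x i| <= enorm x.
Proof.
rewrite -sqrtr_sqr ler_wsqrtr// (bigD1 i)//= lerDl sumr_ge0// => j _.
exact: sqr_ge0.
Qed.

Lemma enorm_vsubC x y : enorm (vsub x y) = enorm (vsub y x).
Proof.
congr Num.sqrt; apply: eq_bigr => i _.
by rewrite !tnth_map !tnth_ord_tuple; ring.
Qed.

(** Coordinatewise the difference of both sides is the square (x_i - 2 y_i)^2. It plays the part of
    the triangle inequality. *)
Lemma enorm2_vsub x y :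
  enorm x ^+ 2 <= 2 * enorm (vsub x y) ^+ 2 + 2 * enorm y ^+ 2.
Proof.
rewrite !enorm2 !mulr_sumr -big_split/=; apply: ler_sum => i _.
rewrite !tnth_map !tnth_ord_tuple -subr_ge0.
by have := sqr_ge0 (tnth x i - 2 * tnth y i); nra.
Qed.

Lemma measurable_enorm : measurable_fun setT (@enorm R n).
Proof.
apply: (measurableT_comp (continuous_measurable_fun (@sqrt_continuous R))).
have H (i : 'I_n) : measurable_fun setT (fun x : Rn => tnth x i ^+ 2 : R).
  by apply: measurable_funX; exact: measurable_tnth.
exact: measurable_sum.
Qed.

Lemma measurable_vsub : measurable_fun setT (fun p : Rn * Rn => vsub p.1 p.2).
Proof.
apply/measurable_fun_tnthP => i.
rewrite (_ : _ \o _ = fun p : Rn * Rn => (tnth p.1 i - tnth p.2 i : R)).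
  apply: measurable_funB.
  - by apply: (measurableT_comp (measurable_tnth i)).
  - by apply: (measurableT_comp (measurable_tnth i)).
by apply/funext => p /=; rewrite tnth_map tnth_ord_tuple.
Qed.

Lemma heat_kernel_ge0 t x : 0 <= heat_kernel t x.
Proof. by rewrite mulr_ge0 ?powR_ge0 ?expR_ge0. Qed.

Lemma measurable_heat_kernel :
  measurable_fun setT (fun p : measurableTypeR R * Rn => heat_kernel p.1 p.2).
Proof.
have mt : measurable_fun setT (fun p : measurableTypeR R * Rn => (4 * p.1 : R)).
  by apply: measurable_funM.
apply: measurable_funM.
  apply: (measurableT_comp (measurable_powR _)).
  rewrite (_ : (fun _ => _) = fun p : measurableTypeR R * Rn => (4 * p.1 * pi : R)).
    exact: measurable_funM.
  by apply/funext => p; ring.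
apply: (measurableT_comp (@measurable_expR R)).
apply: measurable_funN.
apply: measurable_funM.
  apply: measurable_funX; apply: (measurableT_comp measurable_enorm).
  exact: measurable_snd.
exact: (measurableT_comp measurable_invr).
Qed.

Lemma measurable_heat_kernel_vsub t x :
  measurable_fun setT (fun y => heat_kernel t (vsub x y)).
Proof.
have mx : measurable_fun setT (fun y => (x, y)) by exact: measurable_fun_pair.
have mv := measurableT_comp measurable_vsub mx.
have mp : measurable_fun setT (fun y => ((t : measurableTypeR R), vsub x y)).
  exact: measurable_fun_pair.
exact: (measurableT_comp measurable_heat_kernel mp).
Qed.

(** In each coordinate the heat kernel at time t is the normal density of variance 2t. *)
Definition sdev t : R := Num.sqrt (2 * t).

Lemma sdev_gt0 t : 0 < t -> 0 < sdev t.
Proof. by move=> t0; rewrite sqrtr_gt0 mulr_gt0. Qed.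

Lemma heat_kernel_prod t x y : 0 < t ->
  heat_kernel t (vsub x y) =
  \prod_(i < n) normal_pdf (tnth x i) (sdev t) (tnth y i).
Proof.
move=> t0; have s0 : sdev t != 0 by rewrite gt_eqF ?sdev_gt0.
have s2 : sdev t ^+ 2 = 2 * t by rewrite sqr_sqrtr// mulr_ge0// ltW.
under eq_bigr do rewrite normal_pdfE//.
rewrite big_split/= prodr_const card_ord /heat_kernel; congr (_ * _).
  rewrite /normal_peak s2 (_ : 2 * t * pi *+ 2 = 4 * pi * t); last by ring.
  have p0 : 0 <= 4 * pi * t by rewrite !mulr_ge0 ?pi_ge0// ltW.
  by rewrite -powR12_sqrt// -powRN -powR_mulrn ?powR_ge0// -powRrM; congr (_ `^ _); field.
rewrite -expR_sum; congr expR.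
rewrite enorm2 s2 mulr_suml -sumrN; apply: eq_bigr => i _.
rewrite tnth_map tnth_ord_tuple.
by rewrite mulNr; congr (- (_ / _)); ring.
Qed.

Lemma heat_kernel_symm t x y : heat_kernel t (vsub x y) = heat_kernel t (vsub y x).
Proof. by rewrite /heat_kernel enorm_vsubC. Qed.

Lemma integral_heat_kernel t x : 0 < t ->
  (\int[leb]_y (heat_kernel t (vsub x y))%:E = 1)%E.
Proof.
move=> t0; under eq_integral do rewrite heat_kernel_prod//.
rewrite (integral_lebesgue_space_prod
  (f := fun i => normal_pdf (tnth x i) (sdev t))).
- by rewrite big1// => i _; exact: integral_normal_pdf.
- by move=> i; exact: measurable_normal_pdf.
- by move=> i z; exact: normal_pdf_ge0.
Qed.

End HeatKernel.

(** * Gaussian integrals in one variable and the semigroup identity of the kernel *)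

Section HeatKernelBounds.
Context {R : realType}.
Local Notation mu := (@lebesgue_measure R).

(** Completing the square in y: the first factor on the right is free of y, and the second is a
    density in y, so integrating in y yields the semigroup identity. *)
Lemma normal_pdfM (x z s t y : R) : 0 < s -> 0 < t ->
  normal_pdf x (sdev s) y * normal_pdf z (sdev t) y =
  normal_pdf x (sdev (s + t)) z *
  normal_pdf ((t * x + s * z) / (s + t)) (sdev (s * t / (s + t))) y.
Proof.
move=> s0 t0; have st0 : 0 < s + t by rewrite addr_gt0.
have v0 : 0 < s * t / (s + t) by rewrite divr_gt0 ?mulr_gt0.
have sd2 (u : R) : 0 < u -> sdev u ^+ 2 = 2 * u.
  by move=> u0; rewrite sqr_sqrtr// mulr_ge0// ltW.
rewrite !normal_pdfE ?gt_eqF ?sdev_gt0//.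
rewrite mulrACA [RHS]mulrACA; congr (_ * _).
  rewrite /normal_peak !sd2// -!invfM; congr (_^-1).
  rewrite -!sqrtrM ?mulrn_wge0 ?mulr_ge0 ?pi_ge0 ?ltW//.
  congr Num.sqrt; field.
  by rewrite gt_eqF.
rewrite /normal_fun !sd2// -!expRD; congr expR; field.
by rewrite !gt_eqF.
Qed.

(** Split at |y| = s. Outside, |y|^-theta <= s^-theta and the density has mass 1. Inside, the
    density is at most its peak, which is below 1/s, and the singularity integrates to 2 s^(1 -
    theta)/(1 - theta). The mean m plays no part in either bound, hence the uniformity. *)
Lemma integral_normal_pdf_power (m s theta : R) : 0 <= theta < 1 -> 0 < s ->
  (\int[mu]_y (normal_pdf m s y * `|y| `^ (- theta))%:E <=
   ((1 + 2 / (1 - theta)) * s `^ (- theta))%:E)%E.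
Proof.
move=> t01 s0; have [t0 t1] := andP t01.
pose D : set (measurableTypeR R) := `[0 - s, 0 + s]%classic.
have mD : measurable D by exact: measurable_itv.
have mp : measurable_fun setT (fun y : measurableTypeR R => (`|y| `^ (- theta) : R)).
  exact: (measurableT_comp (measurable_powR _)).
have m1 : measurable_fun setT
    (fun y : measurableTypeR R => (normal_pdf m s y * s `^ (- theta))%:E).
  apply/measurable_EFinP; apply: measurable_funM => //.
  exact: measurable_normal_pdf.
have m2 : measurable_fun setT
    (fun y : measurableTypeR R => (s^-1 * `|y - 0| `^ (- theta) * \1_D y)%:E).
  apply/measurable_EFinP; apply: measurable_funM => //.
  apply: measurable_funM => //.
  by under eq_fun do rewrite subr0.
apply: (@le_trans _ _ (\int[mu]_y ((normal_pdf m s y * s `^ (- theta))%:E +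
   (s^-1 * `|y - 0| `^ (- theta) * \1_D y)%:E))%E).
  apply: ge0_le_integral => //.
  - by move=> y _; rewrite lee_fin mulr_ge0 ?powR_ge0 ?normal_pdf_ge0.
  - apply/measurable_EFinP; apply: measurable_funM => //.
    exact: measurable_normal_pdf.
  - exact: emeasurable_funD.
  - move=> y _; rewrite -EFinD lee_fin subr0.
    have [ys|ys] := leP `|y| s.
      rewrite indicE mem_set/=; last by rewrite /D/= in_itv/= sub0r add0r -ler_norml.
      rewrite mulr1 ler_wpDl ?mulr_ge0 ?powR_ge0 ?normal_pdf_ge0//.
      rewrite ler_wpM2r ?powR_ge0// (le_trans (normal_pdf_ub _ _ _)) ?gt_eqF//.
      rewrite lef_pV2 ?posrE// ?sqrtr_gt0 ?mulrn_wgt0 ?mulr_gt0 ?exprn_gt0 ?pi_gt0//.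
      rewrite -{1}(ger0_norm (ltW s0)) -sqrtr_sqr ler_wsqrtr//.
      have := pi_ge2 R; have := sqr_ge0 s; nra.
    rewrite ler_wpDr ?mulr_ge0 ?powR_ge0 ?invr_ge0 ?(ltW s0)//.
    have y0 : 0 < `|y| by exact: lt_trans ys.
    rewrite ler_wpM2l ?normal_pdf_ge0// !powRN lef_pV2 ?posrE ?powR_gt0//.
    by rewrite ge0_ler_powR ?nnegrE ?(ltW s0) ?(ltW y0) ?(ltW ys).
rewrite ge0_integralD//; last 2 first.
- by move=> y _; rewrite lee_fin mulr_ge0 ?powR_ge0 ?normal_pdf_ge0.
- by move=> y _; rewrite lee_fin !mulr_ge0 ?powR_ge0 ?invr_ge0 ?(ltW s0).
under eq_integral do rewrite EFinM.
rewrite ge0_integralZr//; last 3 first.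
- by apply/measurable_EFinP; exact: measurable_normal_pdf.
- by move=> y _; rewrite lee_fin normal_pdf_ge0.
- by rewrite lee_fin powR_ge0.
rewrite integral_normal_pdf mul1e mulrDl mul1r EFinD leeD2l//.
rewrite [leLHS](_ : _ = (s^-1)%:E * \int[mu]_(y in D) (`|y - 0| `^ (- theta))%:E)%E.
  apply: le_trans (lee_wpmul2l _ (integral_powR_dist 0 t01 (ltW s0))) _.
    by rewrite lee_fin invr_ge0 ltW.
  have -> : s `^ (1 - theta) = s * s `^ (- theta).
    rewrite powRD; last by rewrite (gt_eqF s0) implybT.
    by rewrite powRr1// ltW.
  rewrite -EFinM lee_fin le_eqVlt; apply/orP; left; apply/eqP; field.
  by rewrite !gt_eqF//=; lra.
rewrite -ge0_integralZl//; last 2 first.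
- apply: measurable_funTS; apply/measurable_EFinP.
  by under eq_fun do rewrite subr0.
- by rewrite lee_fin invr_ge0 ltW.
rewrite [RHS]integral_mkcond; apply: eq_integral => y _.
rewrite patchE indicE; case: ifPn => _; first by rewrite mulr1 EFinM.
by rewrite mulr0.
Qed.

Context {n : nat}.
Local Notation Rn := (n.-tuple (measurableTypeR R)).
Local Notation leb := (@lebesgue_space R n).
Implicit Types (x y z : Rn).

Lemma heat_kernel_semigroup (s t : R) x z : 0 < s -> 0 < t ->
  (\int[leb]_y (heat_kernel s (vsub x y) * heat_kernel t (vsub y z))%:E =
   (heat_kernel (s + t) (vsub x z))%:E)%E.
Proof.
move=> s0 t0; pose m i := (t * tnth x i + s * tnth z i) / (s + t).
have v0 : 0 < s * t / (s + t) by rewrite divr_gt0 ?mulr_gt0 ?addr_gt0.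
transitivity (\int[leb]_y (\prod_(i < n)
  (normal_pdf (tnth x i) (sdev (s + t)) (tnth z i) *
   normal_pdf (m i) (sdev (s * t / (s + t))) (tnth y i)))%:E)%E.
  apply: eq_integral => y _; congr (_%:E).
  rewrite [heat_kernel t _]heat_kernel_symm !heat_kernel_prod// -big_split/=.
  by apply: eq_bigr => i _; rewrite normal_pdfM.
rewrite heat_kernel_prod ?addr_gt0//.
rewrite (integral_lebesgue_space_prod (f := fun i w =>
  normal_pdf (tnth x i) (sdev (s + t)) (tnth z i) *
  normal_pdf (m i) (sdev (s * t / (s + t))) w)).
- rewrite -prodEFin; apply: eq_bigr => i _.
  under eq_integral do rewrite EFinM.
  rewrite ge0_integralZl//.
  + by rewrite integral_normal_pdf mule1.
  + by apply/measurable_EFinP; exact: measurable_normal_pdf.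
  + by move=> w _; rewrite lee_fin normal_pdf_ge0.
  + by rewrite lee_fin normal_pdf_ge0.
- by move=> i; apply: measurable_funM => //; exact: measurable_normal_pdf.
- by move=> i w; rewrite mulr_ge0 ?normal_pdf_ge0.
Qed.

End HeatKernelBounds.

(** * Heat averages of negative powers of |y| *)

Section PowerBound.
Context {R : realType} {n : nat}.
Local Notation Rn := (n.-tuple (measurableTypeR R)).
Local Notation leb := (@lebesgue_space R n).
Implicit Types (x y z : Rn) (t d sigma : R).

#[global] Instance ae_lebesgue_space_filter : Filter (almost_everywhere leb).
Proof. exact: ae_filter_ringOfSetsType. Qed.

#[global] Instance nbhs_ae_lebesgue_space_filter :
  Filter (nbhs (almost_everywhere leb)).
Proof. exact: ae_filter_ringOfSetsType. Qed.

Lemma ae_enorm_gt0 : (0 < n)%N -> \forall x \ae leb, 0 < enorm x.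
Proof.
move=> n0; apply: filterS (ae_tnth_neq0 (Ordinal n0)) => x x0.
by apply: lt_le_trans (enorm_tnth x (Ordinal n0)); rewrite normr_gt0.
Qed.

Lemma measurable_enorm_powR d : measurable_fun setT (fun y => enorm y `^ d).
Proof. exact: (measurableT_comp (measurable_powR _) measurable_enorm). Qed.

Lemma measurable_kernel_power t x d :
  measurable_fun setT (fun y => (heat_kernel t (vsub x y) * enorm y `^ d)%:E).
Proof.
apply/measurable_EFinP; apply: measurable_funM.
  exact: measurable_heat_kernel_vsub.
exact: measurable_enorm_powR.
Qed.

Lemma kernel_power_ge0 t x d y :
  (0 <= (heat_kernel t (vsub x y) * enorm y `^ d)%:E)%E.
Proof. by rewrite lee_fin mulr_ge0 ?heat_kernel_ge0 ?powR_ge0. Qed.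

(* [|y|^-d <= \prod_i |y_i|^(-d/n)] reduces the bound to dimension one. *)
Lemma heat_kernel_power_le d : 0 <= d < n%:R -> exists2 C, 0 < C &
  forall t x, 0 < t ->
  (\int[leb]_y (heat_kernel t (vsub x y) * enorm y `^ (- d))%:E <=
   (C * t `^ (- (d / 2)))%:E)%E.
Proof.
move=> /andP[d0 dn]; have n0 : (0 : R) < n%:R by exact: le_lt_trans dn.
pose theta : R := d / n%:R.
have theta0 : 0 <= theta by rewrite divr_ge0// ltW.
have theta1 : theta < 1 by rewrite ltr_pdivrMr ?mul1r.
have dE : d = theta * n%:R by rewrite divfK// gt_eqF.
pose K : R := 1 + 2 / (1 - theta).
have K0 : 0 < K by rewrite addr_gt0 ?divr_gt0 ?subr_gt0.
(* [K] is the one-dimensional constant, to the power n for n coordinates; the power of 2 comes from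
   the variance 2t. *)
exists (K ^+ n * 2 `^ (- (d / 2))).
  by rewrite mulr_gt0 ?exprn_gt0 ?powR_gt0.
move=> t x t0; have s0 := sdev_gt0 t0.
pose h (i : 'I_n) (w : measurableTypeR R) : R :=
  normal_pdf (tnth x i) (sdev t) w * `|w| `^ (- theta).
have mh i : measurable_fun setT (h i).
  apply: measurable_funM; first exact: measurable_normal_pdf.
  exact: (measurableT_comp (measurable_powR _)).
have h0 i w : 0 <= h i w by rewrite mulr_ge0 ?powR_ge0 ?normal_pdf_ge0.
apply: (@le_trans _ _ (\int[leb]_y (\prod_(i < n) h i (tnth y i))%:E)%E).
  apply: ae_ge0_le_integral => //.
  - by move=> y _; exact: kernel_power_ge0.
  - exact: measurable_kernel_power.
  - by move=> y _; rewrite lee_fin prodr_ge0.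
  - apply/measurable_EFinP; apply: measurable_prod => i _.
    by apply: (measurableT_comp (mh i)); exact: measurable_tnth.
  - have : \forall y \ae leb, forall i, tnth y i != 0 :> R.
      by apply: filter_forall => i; exact: ae_tnth_neq0.
    apply: filterS => y y0 _; rewrite lee_fin heat_kernel_prod// big_split/=.
    apply: ler_wpM2l; first by rewrite prodr_ge0// => i _; exact: normal_pdf_ge0.
    have -> : enorm y `^ (- d) = \prod_(i < n) enorm y `^ (- theta).
      rewrite prodr_const card_ord -powR_mulrn ?powR_ge0// -powRrM.
      by rewrite dE mulNr.
    apply: ler_prod => i _; rewrite powR_ge0/= !powRN.
    have yi : 0 < `|tnth y i| by rewrite normr_gt0.
    have yy := enorm_tnth y i.
    rewrite lef_pV2 ?posrE ?powR_gt0 ?(lt_le_trans yi yy)//.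
    by rewrite ge0_ler_powR ?nnegrE ?(ltW yi) ?enorm_ge0.
rewrite integral_lebesgue_space_prod//.
have -> : K ^+ n * 2 `^ (- (d / 2)) * t `^ (- (d / 2)) =
    \prod_(i < n) (K * sdev t `^ (- theta)).
  rewrite prodr_const card_ord exprMn -mulrA; congr (_ * _).
  rewrite -powRM ?ltW// /sdev -powR12_sqrt ?mulr_ge0 ?ltW//.
  by rewrite -powR_mulrn ?powR_ge0// -!powRrM dE; congr (_ `^ _); ring.
rewrite -prodEFin.
(* Multiplying inequalities requires nonnegativity, so the induction over the product carries
   both. *)
pose P (u v : \bar R) := (0 <= u)%E /\ (u <= v)%E.
suff [] : P (\prod_(i < n) \int[lebesgue_measure]_w (h i w)%:E)%E
            (\prod_(i < n) (K * sdev t `^ (- theta))%:E)%E by [].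
apply: (big_ind2 P) => [|u1 v1 u2 v2 [u10 uv1] [u20 uv2]|i _].
- by split.
- by split; [exact: mule_ge0|exact: lee_pmul].
- split; first by apply: integral_ge0 => w _; rewrite lee_fin.
  by apply: integral_normal_pdf_power => //; rewrite theta0.
Qed.

End PowerBound.

Section WeightedBound.
Context {R : realType} {n : nat}.
Local Notation Rn := (n.-tuple (measurableTypeR R)).
Local Notation leb := (@lebesgue_space R n).
Implicit Types (x y z : Rn) (s t d sigma : R).

(** The constant p^p comes from z/p <= exp(z/p) raised to the power p. *)
Lemma powR_expRN_le (p : R) : 0 <= p ->
  exists2 C, 0 < C & forall z : R, 0 <= z -> z `^ p * expR (- z) <= C.
Proof.
rewrite le_eqVlt => /predU1P[<-|p0].
  exists 1 => // z z0; rewrite powRr0 mul1r -[leRHS]expR0 ler_expR.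
  by rewrite oppr_le0.
exists (p `^ p); first by rewrite powR_gt0.
move=> z z0; rewrite expRN ler_pdivrMr ?expR_gt0//.
have -> : z `^ p = p `^ p * (z / p) `^ p.
  by rewrite -powRM ?divr_ge0 ?(ltW p0)// mulrCA divff ?mulr1// gt_eqF.
have -> : expR z = expR (z / p) `^ p by rewrite -expRM divfK// gt_eqF.
rewrite ler_pM2l ?powR_gt0//.
apply: ge0_ler_powR; rewrite ?nnegrE ?expR_ge0 ?divr_ge0 ?(ltW p0)//.
by rewrite (le_trans _ (expR_ge1Dx _))// lerDr.
Qed.

Lemma enorm_powR x d : enorm x `^ d = (enorm x ^+ 2) `^ (d / 2).
Proof. by rewrite -powR_mulrn ?enorm_ge0// -powRrM mulrC divfK. Qed.

(** Half of the exponent is set aside as an explicit decay factor; the other half is that of the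
    kernel at time 2t, which is still integrable. *)
Lemma heat_kernel_half t z : 0 < t ->
  heat_kernel t z =
  2 `^ (n%:R / 2) * expR (- (enorm z ^+ 2 / (8 * t))) * heat_kernel (2 * t) z.
Proof.
move=> t0; rewrite /heat_kernel mulrACA -expRD.
rewrite (_ : 4 * pi * (2 * t) = 2 * (4 * pi * t)); last by ring.
have p0 : 0 <= 4 * pi * t by rewrite !mulr_ge0 ?pi_ge0 ?ltW.
rewrite [in RHS]powRM// (mulrA (2 `^ _)) -powRD; last by rewrite pnatr_eq0 implybT.
rewrite subrr powRr0 mul1r; congr (_ * expR _); field.
by rewrite gt_eqF.
Qed.

(** If |x|^2 <= t, the bound in t^(-d/2) suffices, since part of the power of t can be traded for
    |x|. If |x|^2 > t, it is enough to reach |x|^-d. Where |y| >= |x|/2 the power is at most 2^d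
    |x|^-d and the kernel has mass 1. Where |y| < |x|/2 one has |x - y|^2 >= |x|^2/4, and the
    Gaussian factor exp(-|x|^2/(32 t)) turns t^(-d/2) into |x|^-d. *)
Lemma heat_kernel_power_interp d sigma : 0 <= sigma -> sigma <= d -> d < n%:R ->
  exists2 C, 0 < C & forall t x, 0 < t -> 0 < enorm x ->
  (\int[leb]_y (heat_kernel t (vsub x y) * enorm y `^ (- d))%:E <=
   (C * (t `^ (- (sigma / 2)) * enorm x `^ (- (d - sigma))))%:E)%E.
Proof.
move=> sigma0 sd dn; have d0 : 0 <= d by exact: le_trans sd.
have [|C0 C00 H0] := @heat_kernel_power_le R n d; first by rewrite d0.
have d20 : 0 <= d / 2 by rewrite divr_ge0.
have [C1 C10 H1] := powR_expRN_le d20.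
(* One summand for each of the regimes |x|^2 <= t, |y| >= |x|/2 and |y| < |x|/2. *)
pose K := C0 + 2 `^ d + 2 `^ (n%:R / 2) * C0 * 32 `^ (d / 2) * C1.
have k1 : 0 < 2 `^ d :> R by rewrite powR_gt0.
have k2 : 0 < 2 `^ (n%:R / 2) * C0 * 32 `^ (d / 2) * C1.
  by rewrite !mulr_gt0 ?powR_gt0.
exists K; first by rewrite !addr_gt0.
move=> t x t0 x0.
have r0 : 0 < enorm x ^+ 2 by rewrite exprn_gt0.
have [rt|rt] := leP (enorm x ^+ 2) t.
  apply: le_trans (H0 t x t0) _; rewrite lee_fin.
  apply: ler_pM; rewrite ?powR_ge0 ?(ltW C00)//.
    by rewrite /K -addrA lerDl ltW// addr_gt0.
  rewrite (_ : - (d / 2) = - (sigma / 2) + - ((d - sigma) / 2)); last by field.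
  rewrite powRD; last by rewrite (gt_eqF t0) implybT.
  rewrite ler_pM2l ?powR_gt0// enorm_powR mulNr !powRN.
  rewrite lef_pV2 ?posrE ?powR_gt0//.
  by rewrite ge0_ler_powR ?nnegrE ?(ltW t0) ?(ltW r0)// divr_ge0// subr_ge0.
pose A := (enorm x / 2) `^ (- d).
pose B := 2 `^ (n%:R / 2) * expR (- (enorm x ^+ 2 / (32 * t))).
have A0 : 0 <= A by exact: powR_ge0.
have B0 : 0 <= B by rewrite mulr_ge0 ?powR_ge0 ?expR_ge0.
have mk (u : R) : measurable_fun setT (fun y => (heat_kernel u (vsub x y))%:E).
  by apply/measurable_EFinP; exact: measurable_heat_kernel_vsub.
apply: (@le_trans _ _ (\int[leb]_y (A%:E * (heat_kernel t (vsub x y))%:E +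
    B%:E * (heat_kernel (2 * t) (vsub x y) * enorm y `^ (- d))%:E))%E).
  apply: ge0_le_integral => //.
  - by move=> y _; exact: kernel_power_ge0.
  - exact: measurable_kernel_power.
  - apply: emeasurable_funD; first by apply: emeasurable_funM.
    by apply: emeasurable_funM => //; exact: measurable_kernel_power.
  - move=> y _; rewrite -!EFinM -EFinD lee_fin.
    have [xy|xy] := leP (enorm x / 2) (enorm y).
      rewrite ler_wpDr ?mulr_ge0 ?heat_kernel_ge0 ?powR_ge0//.
      rewrite [leRHS]mulrC ler_wpM2l ?heat_kernel_ge0// /A !powRN.
      have x20 : 0 < enorm x / 2 by rewrite divr_gt0.
      rewrite lef_pV2 ?posrE ?powR_gt0 ?(lt_le_trans x20 xy)//.
      by rewrite ge0_ler_powR ?nnegrE ?(ltW x20) ?enorm_ge0.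
    rewrite ler_wpDl ?(mulr_ge0 A0 (heat_kernel_ge0 _ _))// mulrA.
    rewrite ler_wpM2r ?powR_ge0// heat_kernel_half// ler_wpM2r ?heat_kernel_ge0//.
    rewrite ler_wpM2l ?powR_ge0// ler_expR lerN2.
    have := enorm2_vsub x y.
    have y2 : enorm y ^+ 2 <= enorm x ^+ 2 / 4.
      have -> : enorm x ^+ 2 / 4 = (enorm x / 2) ^+ 2 by field.
      by rewrite ler_pXn2r ?nnegrE ?enorm_ge0 ?divr_ge0 ?enorm_ge0// ltW.
    move=> Hxy; rewrite (_ : enorm x ^+ 2 / (32 * t) = enorm x ^+ 2 / 4 / (8 * t)).
      by rewrite ler_wpM2r ?invr_ge0 ?mulr_ge0 ?(ltW t0)//; lra.
    by field; rewrite gt_eqF.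
rewrite ge0_integralD//; last 4 first.
- by move=> y _; rewrite -EFinM lee_fin mulr_ge0 ?heat_kernel_ge0.
- by apply: emeasurable_funM.
- by move=> y _; rewrite mule_ge0 ?lee_fin// mulr_ge0 ?heat_kernel_ge0 ?powR_ge0.
- by apply: emeasurable_funM => //; exact: measurable_kernel_power.
rewrite ge0_integralZl//; last by move=> y _; rewrite lee_fin heat_kernel_ge0.
rewrite ge0_integralZl//; last 2 first.
- exact: measurable_kernel_power.
- by move=> y _; exact: kernel_power_ge0.
rewrite integral_heat_kernel// mule1.
have t20 : 0 < 2 * t by rewrite mulr_gt0.
apply: (@le_trans _ _ (A%:E + B%:E * (C0 * (2 * t) `^ (- (d / 2)))%:E)%E).
  by rewrite leeD2l// lee_wpmul2l ?lee_fin//; exact: H0.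
rewrite -EFinM -EFinD lee_fin.
have xd : enorm x `^ (- d) <= t `^ (- (sigma / 2)) * enorm x `^ (- (d - sigma)).
  rewrite (_ : - d = - sigma + - (d - sigma)); last by ring.
  rewrite powRD; last by rewrite (gt_eqF x0) implybT.
  rewrite ler_wpM2r ?powR_ge0// [leLHS]enorm_powR mulNr !powRN.
  rewrite lef_pV2 ?posrE ?powR_gt0//.
  by rewrite ge0_ler_powR ?nnegrE ?(ltW t0) ?(ltW r0) ?divr_ge0// ltW.
apply: (@le_trans _ _ (K * enorm x `^ (- d))); last first.
  by rewrite ler_wpM2l// !addr_ge0 // ltW.
have AE : A = 2 `^ d * enorm x `^ (- d).
  have xE : 0 <= enorm x := ltW x0.
  rewrite /A powRM// mulrC; congr (_ * _).
  by rewrite -powR_inv1// -powRrM mulN1r opprK.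
have BE : B * (C0 * (2 * t) `^ (- (d / 2))) <=
    2 `^ (n%:R / 2) * C0 * 32 `^ (d / 2) * C1 * enorm x `^ (- d).
  rewrite /B; set E := expR _.
  rewrite -!mulrA ler_pM2l ?powR_gt0// mulrCA ler_pM2l//.
  have z0 : 0 <= enorm x ^+ 2 / (32 * t).
    by rewrite divr_ge0 ?(ltW r0)// mulr_ge0// ltW.
  have HE : (enorm x ^+ 2 / (32 * t)) `^ (d / 2) * E <= C1 := H1 _ z0.
  have E0 : 0 <= E by exact: expR_ge0.
  apply: (@le_trans _ _ (E * t `^ (- (d / 2)))).
    rewrite ler_wpM2l// !powRN lef_pV2 ?posrE ?powR_gt0//.
    by rewrite ge0_ler_powR ?nnegrE ?(ltW t0) ?(ltW t20)//; lra.
  have -> : t `^ (- (d / 2)) =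
      32 `^ (d / 2) * (enorm x ^+ 2 / (32 * t)) `^ (d / 2) * enorm x `^ (- d).
    rewrite [enorm x `^ _]enorm_powR mulNr -powRM//.
    rewrite (_ : 32 * (enorm x ^+ 2 / (32 * t)) = t^-1 * enorm x ^+ 2); last first.
      by field; rewrite gt_eqF.
    rewrite powRM ?invr_ge0 ?(ltW t0) ?(ltW r0)// -mulrA -powRD; last first.
      by rewrite (gt_eqF r0) implybT.
    by rewrite subrr powRr0 mulr1 -[t^-1]powR_inv1 ?(ltW t0)// -powRrM mulN1r.
  rewrite [leLHS](_ : _ = 32 `^ (d / 2) *
    ((enorm x ^+ 2 / (32 * t)) `^ (d / 2) * E * enorm x `^ (- d))); last by ring.
  by rewrite ler_pM2l ?powR_gt0// ler_wpM2r ?powR_ge0.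
rewrite AE [leRHS]mulrDl lerD// ler_wpM2r ?powR_ge0//.
by rewrite lerDr ltW.
Qed.

End WeightedBound.

(** * Time differences of the heat kernel *)

Section TimeDifference.
Context {R : realType} {n : nat}.
Local Notation Rn := (n.-tuple (measurableTypeR R)).
Implicit Types (z : Rn) (s t h : R).

(** The graph of the convex function (1 + h)^k lies below its chord over [0, 1]. *)
Lemma onePXn_le h (k : nat) : 0 <= h <= 1 -> (1 + h) ^+ k - 1 <= (2 ^+ k - 1) * h.
Proof.
move=> /andP[h0 h1]; elim: k => [|k IH]; first by rewrite !expr0 subrr mul0r.
have k1 : 1 <= 2 ^+ k :> R by rewrite exprn_ege1// ler1n.
rewrite !exprS; move: k1 IH; set X := (1 + h) ^+ k; set Y := 2 ^+ k => k1 IH.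
have a1 : 0 <= (1 + h) * ((Y - 1) * h - (X - 1)).
  by rewrite mulr_ge0 ?subr_ge0// addr_ge0.
have a2 : 0 <= (Y - 1) * (h * (1 - h)) by rewrite !mulr_ge0 ?subr_ge0.
by nra.
Qed.

(** The increments of the normalisation and of the exponential are estimated separately. The latter
    brings out a factor |z|^2/t, absorbed by part of the Gaussian; hence the kernel at time 2t on
    the right. *)
Lemma heat_kernel_diff s t z : 0 < s -> s <= t -> t <= 2 * s ->
  `|heat_kernel t z - heat_kernel s z| <=
  2 `^ (n%:R / 2) * (1 + 2 ^+ n) * ((t - s) / s) * heat_kernel (2 * t) z.
Proof.
move=> s0 st ts; have t0 : 0 < t by exact: lt_le_trans st.
have [q qE q0] : exists2 q, q = enorm z ^+ 2 & 0 <= q.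
  by exists (enorm z ^+ 2) => //; exact: sqr_ge0.
have [h hE h0] : exists2 h, h = (t - s) / s & 0 <= h.
  by exists ((t - s) / s) => //; rewrite divr_ge0 ?subr_ge0// ltW.
have h1 : h <= 1 by rewrite hE ler_pdivrMr// mul1r; lra.
have h10 : 0 < 1 + h by lra.
have tE : t = s * (1 + h) by rewrite hE; field; rewrite gt_eqF.
pose P (u : R) := (4 * pi * u) `^ (- (n%:R / 2)).
pose E (u : R) := expR (- (q / (4 * u))).
have E0 u : 0 < E u by exact: expR_gt0.
have P0 u : 0 < u -> 0 < P u by move=> u0; rewrite powR_gt0// !mulr_gt0 ?pi_gt0.
have HK u : heat_kernel u z = P u * E u by rewrite /E qE.
have t20 : 0 < 2 * t by rewrite mulr_gt0.
have PE : P t = 2 `^ (n%:R / 2) * P (2 * t).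
  rewrite /P (_ : 4 * pi * (2 * t) = 2 * (4 * pi * t)); last by ring.
  rewrite [in RHS]powRM ?mulr_ge0 ?pi_ge0 ?(ltW t0)// (mulrA (2 `^ _)) -powRD.
    by rewrite subrr powRr0 mul1r.
  by rewrite pnatr_eq0 implybT.
have Et : E s <= E t.
  rewrite ler_expR lerN2 ler_wpM2l// lef_pV2 ?posrE ?mulr_gt0//.
  by rewrite ler_pM2l.
(* One of the two factors absorbs q/(8t) in [qE2]; the other is left for the kernel at time 2t. *)
have E2t : E t = E (2 * t) ^+ 2.
  by rewrite /E -expRM_natl; congr expR; field; rewrite gt_eqF.
have E1 : E (2 * t) <= 1.
  by rewrite -[leRHS]expR0 ler_expR oppr_le0 divr_ge0// ltW// !mulr_gt0.
have qE2 : q / (8 * t) * E (2 * t) <= 1.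
  rewrite /E expRN ler_pdivrMr ?expR_gt0// mul1r.
  rewrite (_ : 4 * (2 * t) = 8 * t); last by ring.
  by rewrite (le_trans _ (expR_ge1Dx _))// lerDr.
have dE : E t - E s <= 2 * h * E (2 * t).
  have -> : E s = E t * expR (- (q / (4 * t) * h)).
    rewrite -expRD; congr expR; rewrite hE; field.
    by rewrite !gt_eqF.
  have := expR_ge1Dx (- (q / (4 * t) * h)).
  set X := expR _ => HX.
  have : E t - E t * X <= E t * (q / (4 * t) * h).
    by have := E0 t; nra.
  move=> /le_trans; apply.
  rewrite E2t (_ : _ * _ = (q / (8 * t) * E (2 * t)) * (2 * h * E (2 * t))); last first.
    by field; rewrite gt_eqF.
  by rewrite ler_piMl// ?mulr_ge0 ?(ltW (E0 _)).
have dP : P s - P t <= (2 ^+ n - 1) * h * P t.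
  have -> : P s = P t * (1 + h) `^ (n%:R / 2).
    rewrite /P tE (mulrA (4 * pi)) [in RHS]powRM ?mulr_ge0 ?pi_ge0 ?(ltW s0) ?addr_ge0//.
    rewrite -[RHS]mulrA -powRD; first by rewrite addNr powRr0 mulr1.
    by rewrite (gt_eqF h10) implybT.
  (* Enlarging the exponent n/2 to the integer n makes the chord bound applicable. *)
  have : (1 + h) `^ (n%:R / 2) <= (1 + h) ^+ n.
    rewrite -powR_mulrn; last by lra.
    apply: ler_powR; first by lra.
    by rewrite ler_pdivrMr// ler_peMr// ler1n.
  have := @onePXn_le h n; rewrite h0 h1 => /(_ isT).
  by have := P0 t t0; nra.
have Pst : P t <= P s.
  rewrite /P !powRN lef_pV2 ?posrE ?powR_gt0 ?mulr_gt0 ?pi_gt0//.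
  by rewrite ge0_ler_powR ?nnegrE ?divr_ge0 ?mulr_ge0 ?pi_ge0 ?(ltW s0) ?(ltW t0)// ler_pM2l ?mulr_gt0 ?pi_gt0.
have Et2 : E t <= E (2 * t).
  by rewrite E2t expr2 ler_piMl// ltW.
rewrite !HK.
have -> : P t * E t - P s * E s = P t * (E t - E s) - (P s - P t) * E s by ring.
rewrite (le_trans (ler_normB _ _))//.
rewrite !ger0_norm ?mulr_ge0 ?subr_ge0 ?(ltW (E0 _)) ?(ltW (P0 _ _))//.
rewrite [leRHS](_ : _ = P t * (1 + 2 ^+ n) * h * E (2 * t)); last first.
  by rewrite PE hE; ring.
have k1 : 1 <= 2 ^+ n :> R by rewrite exprn_ege1// ler1n.
apply: (@le_trans _ _ (P t * (2 * h * E (2 * t)) + (2 ^+ n - 1) * h * P t * E (2 * t))).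
  apply: lerD; first by rewrite ler_pM2l ?P0.
  apply: ler_pM => //; rewrite ?subr_ge0 ?(ltW (E0 _))//.
  exact: le_trans Et2.
by rewrite le_eqVlt; apply/orP; left; apply/eqP; ring.
Qed.

(** With h = (t - s)/s: for h <= 1 the linear bound applies and h <= h^theta; for h > 1 the triangle
    inequality suffices because h^theta >= 1. A small theta weakens the singularity at s = 0, which
    the Duhamel integral must integrate. *)
Lemma heat_kernel_hoelder theta : 0 <= theta <= 1 -> exists2 C, 0 < C &
  forall s t z, 0 < s -> s <= t ->
  `|heat_kernel t z - heat_kernel s z| <= C * ((t - s) / s) `^ theta *
     (heat_kernel t z + heat_kernel s z + heat_kernel (2 * t) z).
Proof.
move=> /andP[theta0 theta1].
pose C : R := 2 `^ (n%:R / 2) * (1 + 2 ^+ n) + 1.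
have C0 : 0 < 2 `^ (n%:R / 2) * (1 + 2 ^+ n) :> R.
  by rewrite mulr_gt0 ?powR_gt0 ?addr_gt0 ?exprn_gt0.
exists C; first by rewrite addr_gt0.
move=> s t z s0 st; set h := (t - s) / s.
have h0 : 0 <= h by rewrite divr_ge0 ?subr_ge0// ltW.
have k1 := heat_kernel_ge0 t z; have k2 := heat_kernel_ge0 s z.
have k3 := heat_kernel_ge0 (2 * t) z.
have hp := powR_ge0 h theta.
have [h1|h1] := leP h 1.
  have ts : t <= 2 * s by move: h1; rewrite ler_pdivrMr// mul1r; lra.
  apply: le_trans (heat_kernel_diff z s0 st ts) _; rewrite -/h.
  have hh : h <= h `^ theta.
    have [h00|h00] := eqVneq h 0; first by rewrite h00 powR_ge0.
    by rewrite ger1_powR// h1 andbT lt_neqAle eq_sym h00.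
  apply: ler_pM => //.
  - by apply: mulr_ge0 => //; exact: ltW.
  - by apply: ler_pM => //; rewrite ?lerDl // ltW.
  - by rewrite ler_wpDl ?addr_ge0.
have hh : 1 <= h `^ theta.
  rewrite -[leLHS](powRr0 h); apply: ler_powR => //; exact: ltW.
rewrite (le_trans (ler_normB _ _))// !ger0_norm//.
have C1 : 1 <= C by rewrite lerDr ltW.
have : 1 <= C * h `^ theta by rewrite -[leLHS]mulr1; apply: ler_pM => //; exact: ltW.
by nra.
Qed.

End TimeDifference.

(** * Weights and the heat semigroup *)

Section Weights.
Context {R : realType} {n : nat}.
Local Notation Rn := (n.-tuple (measurableTypeR R)).
Local Notation leb := (@lebesgue_space R n).
Implicit Types (x y z : Rn) (w : R -> R) (f g : Rn -> R) (eps d sigma kappa : R).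

(* Slowly varying radial majorants: the class of [w] for which the majorant
   [|x|^-d w(|x|)] is mapped by the heat semigroup to a multiple of itself. *)
Definition weight eps w := (forall r, 0 < r -> 0 <= w r) /\
  forall r r', 0 < r -> 0 < r' ->
    w r' <= ((r' / r) `^ eps + (r / r') `^ eps) * w r.

Definition dominated d w f :=
  \forall x \ae leb, `|f x| <= enorm x `^ (- d) * w (enorm x).

(** The two powers are reciprocal, so one of them is at least 1. *)
Lemma weight_cst eps (M : R) : 0 <= M -> weight eps (cst M).
Proof.
move=> M0; split=> // r r' r0 r'0; rewrite ler_peMl//.
have rr : 0 < r' / r by rewrite divr_gt0.
have -> : r / r' = (r' / r)^-1 by rewrite invf_div.
have [r1|/ltW r1] := leP 1 ((r' / r) `^ eps); first by rewrite ler_wpDr ?powR_ge0.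
rewrite ler_wpDl ?powR_ge0// -(powR_inv1 (ltW rr)) -powRrM mulN1r powRN.
by rewrite invf_ge1 ?powR_gt0.
Qed.

Lemma weightZ eps w kappa : 0 <= kappa -> weight eps w ->
  weight eps (fun r => kappa * w r).
Proof.
move=> k0 [w0 ww]; split=> [r r0|r r' r0 r'0]; first by rewrite mulr_ge0 ?w0.
by rewrite mulrCA ler_wpM2l ?ww.
Qed.

Lemma weightD eps w v : weight eps w -> weight eps v ->
  weight eps (fun r => w r + v r).
Proof.
move=> [w0 ww] [v0 vv]; split=> [r r0|r r' r0 r'0].
  by rewrite addr_ge0 ?w0 ?v0.
by rewrite mulrDr lerD ?ww ?vv.
Qed.

(** Slow variation replaces w(|y|) by w(|x|) times the sum of (|y|/|x|)^eps and (|y|/|x|)^-eps. This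
    leaves pure powers with exponents d - eps and d + eps: the first requires sigma <= d - eps, the
    second d + eps < n. *)
Lemma weight_heat eps d sigma : 0 <= eps -> 0 <= sigma ->
  eps <= d - sigma -> d + eps < n%:R -> exists2 C, 0 < C &
  forall w f t x, weight eps w -> measurable_fun setT f -> dominated d w f ->
  0 < t -> 0 < enorm x ->
  (\int[leb]_y (heat_kernel t (vsub x y) * `|f y|)%:E <=
   (C * t `^ (- (sigma / 2)) * (enorm x `^ (- (d - sigma)) * w (enorm x)))%:E)%E.
Proof.
move=> eps0 sigma0 ed den.
have [| |C1 C10 H1] := @heat_kernel_power_interp R n (d - eps) sigma sigma0; [lra..|].
have [| |C2 C20 H2] := @heat_kernel_power_interp R n (d + eps) sigma sigma0; [lra..|].
exists (C1 + C2); first exact: addr_gt0.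
move=> w f t x [w0 ww] mf fw t0 x0.
set r := enorm x in x0 *; have wr := w0 r x0.
pose a1 := w r * r `^ (- eps); pose a2 := w r * r `^ eps.
have a10 : 0 <= a1 by rewrite mulr_ge0 ?powR_ge0.
have a20 : 0 <= a2 by rewrite mulr_ge0 ?powR_ge0.
have n0 : (0 < n)%N by rewrite -(ltr_nat R); lra.
apply: (@le_trans _ _ (\int[leb]_y
  (a1%:E * (heat_kernel t (vsub x y) * enorm y `^ (- (d - eps)))%:E +
   a2%:E * (heat_kernel t (vsub x y) * enorm y `^ (- (d + eps)))%:E))%E).
  apply: ae_ge0_le_integral => //.
  - by move=> y _; rewrite lee_fin mulr_ge0 ?heat_kernel_ge0.
  - apply/measurable_EFinP; apply: measurable_funM.
      exact: measurable_heat_kernel_vsub.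
    exact: measurableT_comp.
  - by move=> y _; apply: adde_ge0; apply: mule_ge0; rewrite ?kernel_power_ge0 ?lee_fin.
  - by apply: emeasurable_funD; apply: emeasurable_funM => //;
      exact: measurable_kernel_power.
  - apply: filterS2 (ae_enorm_gt0 n0) fw => y y0 fy _.
    rewrite -!EFinM -EFinD lee_fin.
    rewrite [leRHS](_ : _ = heat_kernel t (vsub x y) * (enorm y `^ (- d) *
      ((enorm y / r) `^ eps + (r / enorm y) `^ eps) * w r)).
      rewrite ler_wpM2l ?heat_kernel_ge0// (le_trans fy)// -mulrA.
      by rewrite ler_wpM2l ?powR_ge0// ww.
    have e1 : enorm y `^ (- (d - eps)) = enorm y `^ (- d) * enorm y `^ eps.
      by rewrite -powRD ?(gt_eqF y0) ?implybT//; congr (_ `^ _); ring.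
    have e2 : enorm y `^ (- (d + eps)) = enorm y `^ (- d) * enorm y `^ (- eps).
      by rewrite -powRD ?(gt_eqF y0) ?implybT//; congr (_ `^ _); ring.
    have powV (z p : R) : 0 < z -> z^-1 `^ p = z `^ (- p).
      by move=> z0; rewrite -powR_inv1 ?ltW// -powRrM mulN1r.
    rewrite e1 e2 /a1 /a2 !powRM ?invr_ge0 ?(ltW x0) ?(ltW y0)//.
    rewrite (powV r eps x0) (powV (enorm y) eps y0).
    move: (r `^ eps) (r `^ (- eps)) (enorm y `^ eps) (enorm y `^ (- eps)) => p1 p2 p3 p4.
    by ring.
rewrite ge0_integralD//; last 4 first.
- by move=> y _; apply: mule_ge0; rewrite ?kernel_power_ge0 ?lee_fin.
- by apply: emeasurable_funM => //; exact: measurable_kernel_power.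
- by move=> y _; apply: mule_ge0; rewrite ?kernel_power_ge0 ?lee_fin.
- by apply: emeasurable_funM => //; exact: measurable_kernel_power.
have Z (k p : R) : 0 <= k ->
    (\int[leb]_y (k%:E * (heat_kernel t (vsub x y) * enorm y `^ p)%:E) =
     k%:E * \int[leb]_y (heat_kernel t (vsub x y) * enorm y `^ p)%:E)%E.
  move=> k0; apply: ge0_integralZl; [exact: measurableT|exact: measurable_kernel_power|..].
    by move=> y _; exact: kernel_power_ge0.
  by rewrite lee_fin.
rewrite (Z a1 _ a10) (Z a2 _ a20).
apply: (@le_trans _ _ (a1%:E * (C1 * (t `^ (- (sigma / 2)) * r `^ (- (d - eps - sigma))))%:E +
  a2%:E * (C2 * (t `^ (- (sigma / 2)) * r `^ (- (d + eps - sigma))))%:E)%E).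
  by apply: leeD; (apply: lee_wpmul2l; first by rewrite lee_fin); [exact: H1|exact: H2].
rewrite -!EFinM -EFinD lee_fin le_eqVlt; apply/orP; left; apply/eqP.
have e1 : r `^ (- (d - sigma)) = r `^ (- eps) * r `^ (- (d - eps - sigma)).
  by rewrite -powRD ?(gt_eqF x0) ?implybT//; congr (_ `^ _); ring.
have e2 : r `^ (- (d - sigma)) = r `^ eps * r `^ (- (d + eps - sigma)).
  by rewrite -powRD ?(gt_eqF x0) ?implybT//; congr (_ `^ _); ring.
by rewrite /a1 /a2 mulrDl mulrDl {1}e1 e2; ring.
Qed.

End Weights.

(** * The heat operator on dominated functions *)

Section HeatOperator.
Context {R : realType} {n : nat}.
Local Notation Rn := (n.-tuple (measurableTypeR R)).
Local Notation leb := (@lebesgue_space R n).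
Implicit Types (x y z : Rn) (w : R -> R) (f g : Rn -> R) (eps d sigma kappa s t : R).

Lemma heatE t f x : 0 < t ->
  heat t f x = \int[leb]_y (heat_kernel t (vsub x y) * f y).
Proof. by move=> t0; rewrite /heat gt_eqF. Qed.

Lemma heat0 f : heat 0 f = f.
Proof. by apply/funext => x; rewrite /heat eqxx. Qed.

Lemma measurable_kernel_mul t x f : measurable_fun setT f ->
  measurable_fun setT (fun y => (heat_kernel t (vsub x y) * f y)%:E).
Proof.
move=> mf; apply/measurable_EFinP; apply: measurable_funM => //.
exact: measurable_heat_kernel_vsub.
Qed.

Lemma eq_heat t f g x : 0 < t -> measurable_fun setT f -> measurable_fun setT g ->
  (\forall y \ae leb, f y = g y) -> heat t f x = heat t g x.
Proof.
move=> t0 mf mg fg; rewrite !heatE// /Rintegral; congr fine.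
apply: ae_eq_integral => //; [exact: measurable_kernel_mul..|].
by apply: filterS fg => y -> _.
Qed.

Lemma integrable_kernel t x f (B : R) : measurable_fun setT f ->
  (\int[leb]_y (heat_kernel t (vsub x y) * `|f y|)%:E <= B%:E)%E ->
  leb.-integrable setT (fun y => (heat_kernel t (vsub x y) * f y)%:E).
Proof.
move=> mf fB; apply/integrableP; split; first exact: measurable_kernel_mul.
apply: le_lt_trans (ltry B); apply: le_trans fB.
rewrite le_eqVlt; apply/orP; left; apply/eqP; apply: eq_integral => y _ /=.
by rewrite normrM ger0_norm ?heat_kernel_ge0.
Qed.

Lemma heat_le t x f (B : R) : 0 < t -> measurable_fun setT f ->
  (\int[leb]_y (heat_kernel t (vsub x y) * `|f y|)%:E <= B%:E)%E ->
  `|heat t f x| <= B.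
Proof.
move=> t0 mf fB; rewrite heatE//.
have intf := integrable_kernel mf fB.
rewrite -lee_fin EFin_normr_Rintegral//.
apply: le_trans (le_abse_integral _ _ _) _ => //.
  exact: measurable_kernel_mul.
rewrite (le_trans _ fB)// le_eqVlt; apply/orP; left; apply/eqP.
apply: eq_integral => y _ /=.
by rewrite normrM ger0_norm ?heat_kernel_ge0.
Qed.

Lemma heat_bound eps d sigma : 0 <= eps -> 0 <= sigma ->
  eps <= d - sigma -> d + eps < n%:R -> exists2 C, 0 < C &
  forall w f t x, weight eps w -> measurable_fun setT f -> dominated d w f ->
  0 < t -> 0 < enorm x ->
  leb.-integrable setT (fun y => (heat_kernel t (vsub x y) * f y)%:E) /\
  `|heat t f x| <=
   C * t `^ (- (sigma / 2)) * (enorm x `^ (- (d - sigma)) * w (enorm x)).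
Proof.
move=> eps0 sigma0 ed den.
have [C C0 H] := @weight_heat R n eps d sigma eps0 sigma0 ed den.
exists C => // w f t x ww mf fw t0 x0.
have {}H := H w f t x ww mf fw t0 x0.
by split; [exact: integrable_kernel H|exact: heat_le H].
Qed.

(** The three kernels in [heat_kernel_hoelder] live at times t, s and 2t, none earlier than s, so
    all three integrals obey the bound at time s. *)
Lemma heat_hoelder eps d sigma theta : 0 <= eps -> 0 <= sigma ->
  eps <= d - sigma -> d + eps < n%:R -> 0 <= theta <= 1 -> exists2 C, 0 < C &
  forall w f s t x, weight eps w -> measurable_fun setT f -> dominated d w f ->
  0 < s -> s <= t -> 0 < enorm x ->
  `|heat t f x - heat s f x| <= C * ((t - s) / s) `^ theta * s `^ (- (sigma / 2)) *
    (enorm x `^ (- (d - sigma)) * w (enorm x)).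
Proof.
move=> eps0 sigma0 ed den theta01.
have [C C0 H] := @weight_heat R n eps d sigma eps0 sigma0 ed den.
have [K K0 HK] := @heat_kernel_hoelder R n theta theta01.
exists (K * (C + C + C)); first by rewrite mulr_gt0// !addr_gt0.
move=> w f s t x ww mf fw s0 st x0; have t0 := lt_le_trans s0 st.
set B := (enorm x `^ (- (d - sigma)) * w (enorm x)).
have B0 : 0 <= B by rewrite mulr_ge0 ?powR_ge0 ?(proj1 ww).
have HB u : 0 < u -> s <= u ->
    (\int[leb]_y (heat_kernel u (vsub x y) * `|f y|)%:E <=
       (C * s `^ (- (sigma / 2)) * B)%:E)%E.
  move=> u0 su; apply: le_trans (H w f u x ww mf fw u0 x0) _.
  rewrite lee_fin ler_wpM2r// ler_pM2l// !powRN lef_pV2 ?posrE ?powR_gt0//.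
  by rewrite ge0_ler_powR ?nnegrE ?divr_ge0 ?(ltW s0) ?(ltW u0).
have t20 : 0 < 2 * t by rewrite mulr_gt0.
have t2s : s <= 2 * t by lra.
have it := integrable_kernel mf (HB _ t0 st).
have is_ := integrable_kernel mf (HB _ s0 (lexx _)).
have iB : leb.-integrable setT (EFin \o (fun y =>
    heat_kernel t (vsub x y) * f y - heat_kernel s (vsub x y) * f y)).
  exact: (integrableB measurableT it is_).
have mB := measurable_int _ iB.
rewrite !heatE// -RintegralB// -lee_fin EFin_normr_Rintegral//.
apply: le_trans (le_abse_integral _ _ _) _ => //.
set h := ((t - s) / s) `^ theta.
have h0 : 0 <= h by exact: powR_ge0.
have mk u : measurable_fun setT (fun y => (heat_kernel u (vsub x y) * `|f y|)%:E).
  by apply: measurable_kernel_mul; exact: measurableT_comp.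
have k0 u y : (0 <= (heat_kernel u (vsub x y) * `|f y|)%:E)%E.
  by rewrite lee_fin mulr_ge0// heat_kernel_ge0.
apply: (@le_trans _ _ ((K * h)%:E * (\int[leb]_y
   ((heat_kernel t (vsub x y) * `|f y|)%:E + (heat_kernel s (vsub x y) * `|f y|)%:E
   + (heat_kernel (2 * t) (vsub x y) * `|f y|)%:E)))%E).
  rewrite -ge0_integralZl//; last 3 first.
  - by apply: emeasurable_funD => //; apply: emeasurable_funD.
  - by move=> y _; apply: adde_ge0 => //; apply: adde_ge0.
  - by rewrite lee_fin mulr_ge0// ltW.
  apply: ge0_le_integral => //.
  - exact: (measurableT_comp (@abse_measurable R setT)).
  - apply: emeasurable_funM => //; apply: emeasurable_funD => //.
    exact: emeasurable_funD.
  - move=> y _ /=; rewrite -!EFinD -EFinM lee_fin -mulrBl normrM -!mulrDl mulrA.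
    by rewrite ler_wpM2r// HK.
rewrite ge0_integralD//; last 2 first.
- by move=> y _; apply: adde_ge0.
- exact: emeasurable_funD.
rewrite ge0_integralD//.
have -> : (K * (C + C + C) * h * s `^ (- (sigma / 2)) * B)%:E =
   ((K * h)%:E * ((C * s `^ (- (sigma / 2)) * B)%:E + (C * s `^ (- (sigma / 2)) * B)%:E +
     (C * s `^ (- (sigma / 2)) * B)%:E))%E.
  by rewrite -!EFinD -EFinM; congr (_%:E); ring.
apply: lee_wpmul2l; first by rewrite lee_fin mulr_ge0// ltW.
by apply: leeD; [apply: leeD|]; exact: HB.
Qed.

Lemma heatB t f g x : 0 < t ->
  leb.-integrable setT (fun y => (heat_kernel t (vsub x y) * f y)%:E) ->
  leb.-integrable setT (fun y => (heat_kernel t (vsub x y) * g y)%:E) ->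
  heat t (fun y => f y - g y) x = heat t f x - heat t g x.
Proof.
move=> t0 intf intg; rewrite !heatE// -RintegralB//.
by apply: eq_Rintegral => y _; rewrite mulrBr.
Qed.

Lemma heatDZ t f g x (a : R) : 0 < t ->
  leb.-integrable setT (fun y => (heat_kernel t (vsub x y) * f y)%:E) ->
  leb.-integrable setT (fun y => (heat_kernel t (vsub x y) * g y)%:E) ->
  heat t (fun y => f y + a * g y) x = heat t f x + a * heat t g x.
Proof.
move=> t0 intf intg; rewrite !heatE// -RintegralZl// -RintegralD//; last first.
  exact: (integrableZl _ a intg).
by apply: eq_Rintegral => y _; rewrite mulrDr mulrCA.
Qed.

End HeatOperator.

(** * The nonlinearity *)

Section HardyHenon.
Context {R : realType}.
Implicit Types (a b m t beta : R).

Lemma one_subX_le t (k : nat) : 0 <= t <= 1 -> 1 - t ^+ k <= k%:R * (1 - t).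
Proof.
move=> /andP[t0 t1]; elim: k => [|k IH]; first by rewrite expr0 subrr mul0r.
rewrite exprS -natr1; have : 0 <= t ^+ k by rewrite exprn_ge0.
have : t ^+ k <= 1 by rewrite exprn_ile1.
nra.
Qed.

(* Integer powers dominate: [1 - t^(beta+1) <= 1 - t^k <= k (1 - t)] for an
   integer [k >= beta + 1]. *)
Lemma signed_powR_lipschitz beta : 0 < beta -> exists2 L, 1 <= L &
  forall a b m, `|a| <= m -> `|b| <= m ->
  `| `|a| `^ beta * a - `|b| `^ beta * b| <= L * m `^ beta * `|a - b|.
Proof.
move=> beta0; pose k := (Num.truncn (beta + 1)).+1.
have kb : beta + 1 <= k%:R by rewrite ltW// truncnS_gt.
exists k%:R; first by rewrite ler1n.
(* Exchanging a and b and using that the function is odd reduces everything to this case. *)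
have main a b m : 0 <= a -> `|b| <= a -> a <= m ->
    `| `|a| `^ beta * a - `|b| `^ beta * b| <= k%:R * m `^ beta * `|a - b|.
  move=> a0 ba am.
  apply: (@le_trans _ _ (k%:R * a `^ beta * `|a - b|)); last first.
    rewrite ler_wpM2r// ler_wpM2l// ge0_ler_powR ?nnegrE ?(ltW beta0)//.
    exact: le_trans am.
  have [a00|a00] := eqVneq a 0.
    move: ba; rewrite a00 normr_le0 => /eqP ->.
    by rewrite !mulr0 subrr normr0 mulr_ge0// mulr_ge0 ?powR_ge0.
  have ap : 0 < a by rewrite lt_neqAle eq_sym a00.
  rewrite (ger0_norm a0).
  have ab : b <= a by rewrite (le_trans (ler_norm _)).
  rewrite [`|a - b|]ger0_norm ?subr_ge0//.
  have [b0|b0] := leP 0 b.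
    rewrite (ger0_norm b0).
    have p1 x : 0 <= x -> x `^ beta * x = x `^ (beta + 1).
      by move=> x0; rewrite mulrC -[RHS](@mulr_powRB1 _ x (beta + 1)) ?addrK ?addr_gt0.
    rewrite !p1// ger0_norm; last first.
      by rewrite subr_ge0 ge0_ler_powR ?nnegrE ?addr_ge0 ?(ltW beta0).
    have tE : b = a * (b / a) by rewrite mulrCA divff ?mulr1.
    set t := b / a in tE.
    have t0 : 0 <= t by rewrite divr_ge0.
    have t1 : t <= 1 by rewrite ler_pdivrMr// mul1r.
    have H : 1 - t `^ (beta + 1) <= k%:R * (1 - t).
      apply: le_trans (one_subX_le k _); last by rewrite t0.
      rewrite lerD2l lerN2 -powR_mulrn//.
      have [->|t00] := eqVneq t 0; first by rewrite powR0 ?powR_ge0 ?pnatr_eq0.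
      by rewrite ger_powR// lt_neqAle eq_sym t00 t0.
    rewrite tE powRM// -{1}[a `^ (beta + 1)]mulr1 -mulrBr.
    rewrite (_ : k%:R * a `^ beta * (a - a * t) = a `^ (beta + 1) * (k%:R * (1 - t))).
      by rewrite ler_wpM2l ?powR_ge0.
    by rewrite -p1//; ring.
  rewrite (ltr0_norm b0).
  have bp : 0 <= (- b) `^ beta by exact: powR_ge0.
  have bba : (- b) `^ beta <= a `^ beta.
    rewrite ge0_ler_powR ?nnegrE ?(ltW beta0) ?oppr_ge0 ?(ltW b0)//.
    by rewrite -(ltr0_norm b0).
  rewrite ger0_norm; last by rewrite subr_ge0 (@le_trans _ _ 0)// ?mulr_ge0 ?powR_ge0// mulr_ge0_le0// ltW.
  apply: (@le_trans _ _ (a `^ beta * (a - b))).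
    by have := powR_ge0 a beta; nra.
  rewrite ler_wpM2r ?subr_ge0// ler_peMl ?powR_ge0// ler1n.
  by [].
move=> a b m am bm.
wlog ba : a b am bm / `|b| <= `|a|.
  move=> H; have [ba|/ltW ab] := leP `|b| `|a|; first exact: H.
  by rewrite distrC [`|a - b|]distrC; exact: H.
have [a0|a0] := leP 0 a; first by rewrite (ger0_norm a0) in ba am *; rewrite -{1}(ger0_norm a0); exact: main.
have na : 0 <= - a by rewrite oppr_ge0 ltW.
have := @main (- a) (- b) m na; rewrite !normrN -(ltr0_norm a0) => /(_ ba am).
rewrite (ltr0_norm a0) !mulrN -opprD normrN opprK.
by rewrite -[- a + b]opprK opprD opprK normrN.
Qed.

Context {n : nat}.
Local Notation Rn := (n.-tuple (measurableTypeR R)).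
Local Notation leb := (@lebesgue_space R n).
Implicit Types (x y z : Rn) (w : R -> R) (u v f g : Rn -> R) (alpha gamma M : R).

Lemma measurable_hardy_henon gamma beta f : measurable_fun setT f ->
  measurable_fun setT (hardy_henon gamma beta f).
Proof.
move=> mf; apply: measurable_funM => //.
apply: measurable_funM; first exact: measurable_enorm_powR.
apply: (measurableT_comp (measurable_powR _)).
exact: measurableT_comp.
Qed.

Lemma hardy_henon0 gamma beta : hardy_henon gamma beta (cst 0) = cst 0 :> (Rn -> R).
Proof. by apply/funext => x; rewrite /hardy_henon mulr0. Qed.

(** The scalar bound is applied with m = M |x|^-alpha, and the powers of |x| add up to -(alpha +
    alpha beta + gamma). The size of u and v enters only through M^beta, while the difference keeps
    its own weight w: this separation serves both the contraction and uniqueness. *)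
Lemma hardy_henon_lipschitz alpha beta gamma : (0 < n)%N -> 0 < beta ->
  exists2 L, 1 <= L & forall u v w M,
  dominated alpha (cst M) u -> dominated alpha (cst M) v ->
  dominated alpha w (u \- v) -> 0 <= M ->
  dominated (alpha + (alpha * beta + gamma)) (fun r => L * M `^ beta * w r)
    (hardy_henon gamma beta u \- hardy_henon gamma beta v).
Proof.
move=> n0 beta0; have [L L1 HL] := signed_powR_lipschitz beta0.
exists L => // u v w M uM vM uvw M0.
apply: (filterS2 _ _ (ae_enorm_gt0 n0)) (filterI uM (filterI vM uvw)) => x x0.
move=> [/= ux [/= vx uvx]].
rewrite /hardy_henon -!mulrA -mulrBr normrM (ger0_norm (powR_ge0 _ _)).
have H := HL _ _ _ ux vx.
apply: le_trans (ler_wpM2l (powR_ge0 _ _) H) _.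
rewrite powRM ?powR_ge0// -powRrM.
have -> : enorm x `^ (- (alpha + (alpha * beta + gamma))) =
   enorm x `^ (- gamma) * enorm x `^ (- alpha * beta) * enorm x `^ (- alpha).
  rewrite -!powRD ?(gt_eqF x0) ?implybT//; congr (_ `^ _); ring.
rewrite -!mulrA [leRHS](_ : _ = enorm x `^ (- gamma) * (L * (enorm x `^ (- alpha * beta) *
  (M `^ beta * (enorm x `^ (- alpha) * w (enorm x)))))); last by ring.
rewrite ler_pM2l ?powR_gt0// ler_pM2l ?(lt_le_trans _ L1)//.
by rewrite ler_pM2l ?powR_gt0// ler_wpM2l ?powR_ge0.
Qed.

End HardyHenon.

(** * Herz norms *)

Section WeightedSequences.
Context {R : realType}.
Local Open Scope ereal_scope.
Implicit Types (b c : int -> \bar R) (q : \bar R).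

Lemma esum_swap (T1 T2 : choiceType) (a : T1 -> T2 -> \bar R) :
  (forall i j, 0 <= a i j) ->
  \esum_(i in [set: T1]) \esum_(j in [set: T2]) a i j =
  \esum_(j in [set: T2]) \esum_(i in [set: T1]) a i j.
Proof.
move=> a0; rewrite !esum_esum//.
rewrite (@reindex_esum _ _ _ ([set: T2] `*`` (fun=> [set: T1]))
  ([set: T1] `*`` (fun=> [set: T2])) (fun p => (p.2, p.1)))//.
split=> //.
- by move=> [i j] [i' j'] _ _ /= [-> ->].
- by move=> [i j] _; exists (j, i).
Qed.

Lemma esumZl_le (T : choiceType) (D : set T) (a : T -> \bar R) (k : R) :
  (0 <= k)%R -> (forall i, 0 <= a i) ->
  \esum_(i in D) (k%:E * a i) <= k%:E * \esum_(i in D) a i.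
Proof.
move=> k0 a0; apply: ge_ereal_sup => _ [X XD <-].
have [fX _] := XD; rewrite -ge0_mule_fsumr//.
apply: lee_wpmul2l; rewrite ?lee_fin//.
by apply: esum_ge; exists X.
Qed.

Lemma esum_geometric_int (x : R) : (0 <= x < 1)%R ->
  exists2 S : R, (0 < S)%R &
  forall j : int, \esum_(k in [set: int]) (x ^+ `|k - j|%N)%:E <= S%:E.
Proof.
move=> /andP[x0 x1].
have gs : \esum_(k in [set: nat]) (x ^+ k)%:E <= ((1 - x)^-1)%:E.
  rewrite -nneseries_esumT; last by move=> k; rewrite lee_fin exprn_ge0.
  apply: lime_le.
    by apply: is_cvg_nneseries => k _ _; rewrite lee_fin exprn_ge0.
  apply: nearW => m; rewrite sumEFin lee_fin.
  have -> : (\sum_(0 <= i < m) x ^+ i = series (geometric 1 x) m)%R.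
    by rewrite /series/=; apply: eq_bigr => i _; rewrite mul1r.
  rewrite geometric_seriesE ?lt_eqF//= mul1r ler_piMl ?invr_ge0 ?subr_ge0 ?(ltW x1)//.
  by rewrite gerBl exprn_ge0.
exists ((1 - x)^-1 + (1 - x)^-1)%R.
  by rewrite addr_gt0// invr_gt0 subr_gt0.
move=> j; rewrite (@reindex_esum _ _ _ [set: int] [set: int] (fun k => (k + j)%R)); last first.
  split=> //; first by move=> k l _ _ /addIr.
  by move=> k _; exists (k - j)%R => //; rewrite subrK.
under eq_esum do rewrite addrK.
have e0 (k : int) : 0 <= (x ^+ `|k|%N)%:E by rewrite lee_fin exprn_ge0.
rewrite (esumID [set k : int | (0 <= k)%R])// setTI EFinD.
apply: leeD.
  have -> : [set k : int | (0 <= k)%R] = Posz @` setT.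
    apply/seteqP; split=> [[k|k]//= _|_ [k _ <-]//]; first by exists k.
  rewrite esum_image; last by move=> k l _ _ [].
  by [].
have -> : [set: int] `&` ~` [set k : int | (0 <= k)%R] = Negz @` setT.
  apply/seteqP; split=> [[k|k] [_]//= _|_ [k _ <-]//]; first by exists k.
rewrite esum_image; last by move=> k l _ _ [].
apply: le_trans gs; apply: le_esum => k _.
by rewrite lee_fin /= exprS ler_piMl ?exprn_ge0// ltW.
Qed.

(** The branches follow those of [herz_norm], with the supremum as the default. *)
Definition lnorm q b : \bar R :=
  match q with
  | q%:E => (\esum_(k in [set: int]) b k `^ q) `^ q^-1
  | _ => ereal_sup (range b)
  end.

Lemma le_poweR (x y : \bar R) (p : R) : (0 <= p)%R -> 0 <= x -> x <= y -> x `^ p <= y `^ p.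
Proof.
move=> p0 x0 xy; apply: gt0_ler_poweR; rewrite ?in_itv/= ?leey ?andbT//.
exact: le_trans xy.
Qed.

Lemma lnorm_ge0 q b : (forall k, 0 <= b k) -> 0 <= lnorm q b.
Proof.
case: q => [r||] b0 /=; first exact: poweR_ge0.
  by apply: le_trans (b0 0%R) _; apply: ereal_sup_ubound; exists 0%R.
by apply: le_trans (b0 0%R) _; apply: ereal_sup_ubound; exists 0%R.
Qed.

Lemma lnorm_le q b c : 1 <= q -> (forall k, 0 <= b k) -> (forall k, b k <= c k) ->
  lnorm q b <= lnorm q c.
Proof.
case: q => [r||//] q1 b0 bc /=; last first.
  apply: ge_ereal_sup => _ [k _ <-]; apply: le_trans (bc k) _.
  by apply: ereal_sup_ubound; exists k.
have r0 : (0 <= r)%R by rewrite (le_trans ler01)//.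
apply: le_poweR; rewrite ?invr_ge0//.
  by apply: esum_ge0 => k _; exact: poweR_ge0.
by apply: le_esum => k _; exact: le_poweR.
Qed.

Lemma lnormZ q b (a : R) : 1 <= q -> (0 <= a)%R -> (forall k, 0 <= b k) ->
  lnorm q (fun k => a%:E * b k) <= a%:E * lnorm q b.
Proof.
case: q => [r||//] q1 a0 b0 /=; last first.
  apply: ge_ereal_sup => _ [k _ <-]; apply: lee_wpmul2l; rewrite ?lee_fin//.
  by apply: ereal_sup_ubound; exists k.
have r0 : (0 < r)%R by rewrite (lt_le_trans ltr01)//.
have aE : a%:E = (a%:E `^ r) `^ r^-1.
  by rewrite -poweRrM divff ?gt_eqF// poweRe1.
rewrite {2}aE -poweRM ?poweR_ge0//; last by apply: esum_ge0 => k _; exact: poweR_ge0.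
apply: le_poweR; rewrite ?invr_ge0 ?(ltW r0)//.
  by apply: esum_ge0 => k _; exact: poweR_ge0.
under eq_esum do rewrite poweRM//.
apply: esumZl_le; first exact: powR_ge0.
by move=> k; exact: poweR_ge0.
Qed.

Lemma lnorm_ge q b k : 1 <= q -> (forall k, 0 <= b k) -> b k <= lnorm q b.
Proof.
case: q => [r||//] q1 b0 /=; last by apply: ereal_sup_ubound; exists k.
have r0 : (0 < r)%R by rewrite (lt_le_trans ltr01)//.
have -> : b k = (b k `^ r) `^ r^-1 by rewrite -poweRrM divff ?gt_eqF// poweRe1.
apply: le_poweR; rewrite ?invr_ge0 ?(ltW r0) ?poweR_ge0//.
apply: esum_ge; exists [set k]; last by rewrite fsbig_set1.
by split.
Qed.

(** For finite q the constant is 2 * 2: one factor from x + y <= 2 max(x, y) termwise, one from the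
    same bound on the two sums under the power 1/q. A constant is harmless where only finiteness or
    convergence to 0 is at stake. *)
Lemma lnormD q b c : 1 <= q -> (forall k, 0 <= b k) -> (forall k, 0 <= c k) ->
  lnorm q (fun k => b k + c k) <= 4%:E * (lnorm q b + lnorm q c).
Proof.
move=> q1 b0 c0; have nb := lnorm_ge0 q b0; have nc := lnorm_ge0 q c0.
case: q q1 nb nc => [r||//] q1 nb nc /=; last first.
  apply: (@le_trans _ _ (ereal_sup (range b) + ereal_sup (range c))).
    apply: ge_ereal_sup => _ [k _ <-]; apply: leeD;
      by apply: ereal_sup_ubound; exists k.
  rewrite -[leLHS]mul1e; apply: lee_wpmul2r; first exact: adde_ge0.
  by rewrite lee_fin ler1n.
have r1 : (1 <= r)%R by [].
have r0 : (0 < r)%R by rewrite (lt_le_trans ltr01)//.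
have two (x y : \bar R) (p : R) : (0 <= p)%R -> 0 <= x -> 0 <= y ->
    (x + y) `^ p <= (2%:E * maxe x y) `^ p.
  move=> p0 x0 y0; apply: le_poweR => //; first exact: adde_ge0.
  by rewrite mule_natl mule2n; apply: leeD; rewrite le_max lexx ?orbT.
set S1 := \esum_(k in _) b k `^ r; set S2 := \esum_(k in _) c k `^ r.
have S10 : 0 <= S1 by apply: esum_ge0 => k _; exact: poweR_ge0.
have S20 : 0 <= S2 by apply: esum_ge0 => k _; exact: poweR_ge0.
apply: (@le_trans _ _ (((2 `^ r)%:E * (S1 + S2)) `^ r^-1)).
  apply: le_poweR; rewrite ?invr_ge0 ?(ltW r0)//.
    by apply: esum_ge0 => k _; exact: poweR_ge0.
  rewrite /S1 /S2 -esumD; [|by move=> k _; exact: poweR_ge0..].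
  apply: le_trans (esumZl_le _ _ _); [|exact: powR_ge0|]; last first.
    by move=> k; rewrite adde_ge0 ?poweR_ge0.
  apply: le_esum => k _; apply: le_trans (two _ _ _ (ltW r0) (b0 k) (c0 k)) _.
  rewrite poweRM//; last by rewrite le_max b0.
  rewrite poweR_EFin; apply: lee_wpmul2l; first by rewrite lee_fin powR_ge0.
  have [bc|/ltW bc] := leP (b k) (c k).
    by rewrite leeDr ?poweR_ge0.
  by rewrite leeDl ?poweR_ge0.
rewrite poweRM ?lee_fin ?powR_ge0 ?adde_ge0//.
have -> : (2 `^ r)%:E `^ r^-1 = 2%:E :> \bar R.
  by rewrite poweR_EFin -powRrM divff ?gt_eqF// powRr1.
rewrite (_ : 4%:E = 2%:E * 2%:E :> \bar R); last by rewrite -EFinM; congr (_%:E); ring.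
rewrite -muleA; apply: lee_wpmul2l => //.
apply: le_trans (two _ _ _ _ S10 S20) _; first by rewrite invr_ge0 ltW.
rewrite poweRM//; last by rewrite le_max S10.
apply: lee_pmul; rewrite ?poweR_ge0//.
  rewrite poweR_EFin lee_fin -[leRHS](powRr1 (ltW _))//.
  by apply: ler_powR; rewrite ?ler1n// invf_le1.
have [S12|/ltW S12] := leP S1 S2.
  by rewrite leeDr ?poweR_ge0.
by rewrite leeDl ?poweR_ge0.
Qed.

(* The sup-convolution with a geometric kernel: as a sup it needs no Young
   inequality, only the exchange of two sums of nonnegative terms. *)
Lemma lnorm_supconv q (x : R) : 1 <= q -> (0 < x < 1)%R ->
  exists2 C : R, (0 <= C)%R & forall b c, (forall k, 0 <= b k) -> (forall k, 0 <= c k) ->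
  (forall k, c k <= ereal_sup [set (x ^+ `|k - j|%N)%:E * b j | j in [set: int]]) ->
  lnorm q c <= C%:E * lnorm q b.
Proof.
move=> q1 /andP[x0 x1]; case: q q1 => [r||//] q1; last first.
  exists 1%R => // b c b0 c0 cb; rewrite mul1e /=.
  apply: ge_ereal_sup => _ [k _ <-]; apply: le_trans (cb k) _.
  apply: ge_ereal_sup => _ [j _ <-].
  apply: (@le_trans _ _ (b j)); last by apply: ereal_sup_ubound; exists j.
  rewrite -[leRHS]mul1e; apply: lee_wpmul2r => //.
  by rewrite lee_fin exprn_ile1// ltW.
have r1 : (1 <= r)%R by [].
have r0 : (0 < r)%R by rewrite (lt_le_trans ltr01)//.
have xr0 : (0 <= x `^ r)%R by exact: powR_ge0.
have xr1 : (x `^ r < 1)%R by have := gt0_ltr_powR r0 (ltW x0) ler01 x1; rewrite powR1.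
have [|S S0 HS] := @esum_geometric_int (x `^ r)%R; first by rewrite xr0.
exists (S `^ r^-1)%R; first exact: powR_ge0.
move=> b c b0 c0 cb /=.
have Sb0 : 0 <= \esum_(k in [set: int]) b k `^ r.
  by apply: esum_ge0 => k _; exact: poweR_ge0.
rewrite -poweR_EFin -poweRM ?lee_fin ?(ltW S0)//.
apply: le_poweR; rewrite ?invr_ge0 ?(ltW r0)//.
  by apply: esum_ge0 => k _; exact: poweR_ge0.
apply: (@le_trans _ _ (\esum_(k in [set: int]) \esum_(j in [set: int])
    (((x `^ r) ^+ `|k - j|%N)%:E * b j `^ r))).
  apply: le_esum => k _.
  set Q := \esum_(j in _) _.
  have Q0 : 0 <= Q.
    apply: esum_ge0 => j _; apply: mule_ge0; rewrite ?poweR_ge0//.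
    by rewrite lee_fin exprn_ge0.
  (* A supremum is at most the l^r norm of its terms, which is Q^(1/r). *)
  have -> : Q = (Q `^ r^-1) `^ r by rewrite -poweRrM mulVf ?gt_eqF// poweRe1.
  apply: le_poweR; rewrite ?(ltW r0)//; apply: le_trans (cb k) _.
  apply: ge_ereal_sup => _ [j _ <-].
  have xb0 : 0 <= (x ^+ `|k - j|%N)%:E * b j.
    by apply: mule_ge0 => //; rewrite lee_fin exprn_ge0// ltW.
  have -> : (x ^+ `|k - j|%N)%:E * b j =
      (((x ^+ `|k - j|%N)%:E * b j) `^ r) `^ r^-1.
    by rewrite -poweRrM divff ?gt_eqF// poweRe1.
  apply: le_poweR; rewrite ?invr_ge0 ?(ltW r0) ?poweR_ge0//.
  apply: esum_ge; exists [set j]; first by split.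
  rewrite fsbig_set1 poweRM//; last by rewrite lee_fin exprn_ge0// ltW.
  rewrite poweR_EFin -powR_mulrn ?(ltW x0)// -powRrM mulrC powRrM.
  by rewrite powR_mulrn.
rewrite esum_swap; last first.
  move=> k j; apply: mule_ge0; rewrite ?poweR_ge0//.
  by rewrite lee_fin exprn_ge0.
apply: (@le_trans _ _ (\esum_(j in [set: int]) (S%:E * b j `^ r))); last first.
  by apply: esumZl_le => [|j]; [exact: ltW|exact: poweR_ge0].
apply: le_esum => j _.
(* An infinite term makes the right-hand side infinite because S > 0; a finite one factors out of
   the sum as a real. *)
have [->|bj] := eqVneq (b j `^ r) +oo.
  by rewrite gt0_muley ?leey.
have bf : b j `^ r \is a fin_num by rewrite ge0_fin_numE ?poweR_ge0// lt_neqAle bj leey.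
rewrite -(fineK bf) muleC.
under eq_esum do rewrite muleC.
apply: le_trans (esumZl_le _ _ _) _; first by rewrite fine_ge0// poweR_ge0.
  by move=> k; rewrite lee_fin exprn_ge0.
by apply: lee_wpmul2l; rewrite ?lee_fin ?fine_ge0 ?poweR_ge0.
Qed.

End WeightedSequences.

(** * Herz norms read off dyadic rings *)

Section HerzNorm.
Context {R : realType} {n : nat}.
Hypothesis n0 : (0 < n)%N.
Local Notation Rn := (n.-tuple (measurableTypeR R)).
Local Notation leb := (@lebesgue_space R n).
Implicit Types (x y z : Rn) (w : R -> R) (f g : Rn -> R) (alpha eps kappa : R)
  (q : \bar R) (k j : int).

(** The outer radius of ring k, as a real power so that it combines with the exponent alpha. *)
Definition dyadic k : R := 2 `^ k%:~R.

Lemma dyadic_gt0 k : 0 < dyadic k.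
Proof. by rewrite powR_gt0. Qed.
Hint Resolve dyadic_gt0 : core.

Lemma dyadicE k : dyadic k = 2 ^ k.
Proof. by rewrite /dyadic powR_intmul. Qed.

Lemma dyadicB1 k : dyadic (k - 1) = dyadic k / 2.
Proof. by rewrite !dyadicE expfzDr. Qed.

Lemma dyadic_ringP k x : dyadic_ring k x <-> dyadic k / 2 <= enorm x < dyadic k.
Proof.
rewrite -dyadicB1 !dyadicE; split.
  by move=> [/= xk] /negP; rewrite -leNgt => kx; rewrite kx.
by move=> /andP[kx xk]; split=> //=; apply/negP; rewrite -leNgt.
Qed.

Lemma dyadic_ex (r : R) : 0 < r -> exists k, dyadic k / 2 <= r < dyadic k.
Proof.
move=> r0; have l2 : 0 < ln (2 : R) by rewrite ln_gt0// ltr1n.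
have rE : r = 2 `^ (ln r / ln 2).
  by rewrite /powR pnatr_eq0/= divfK ?gt_eqF// lnK.
(* Ring k is indexed by its outer radius, hence one more than the floor of the binary logarithm. *)
exists (Num.floor (ln r / ln 2) + 1).
rewrite -dyadicB1 addrK /dyadic {2 3}rE; apply/andP; split.
  by rewrite ler_powR ?ler1n// floor_le.
rewrite /powR pnatr_eq0/= ltr_expR ltr_pM2r//.
by rewrite floorD1_gt.
Qed.

Lemma Lnorm_le f (D : set Rn) (B : R) : 0 <= B ->
  (\forall x \ae leb, D x -> `|f x| <= B) ->
  ('N[leb]_+oo[EFin \o (f \* \1_D)%R] <= B%:E)%E.
Proof.
move=> B0 fB; rewrite unlock /Lnorm; case: ifP => // _.
apply/ess_supP; apply: filterS fB => x fB; rewrite /= lee_fin indicE.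
have [xD|xD] := boolP (x \in D); first by rewrite mulr1 fB//; exact: set_mem.
by rewrite mulr0 normr0.
Qed.

Lemma ae_le_Lnorm f (D : set Rn) :
  \forall x \ae leb, D x -> (`|f x|%:E <= 'N[leb]_+oo[EFin \o (f \* \1_D)%R])%E.
Proof.
(* On a space of measure zero the norm is 0 by convention, but there every property holds almost
   everywhere. *)
rewrite unlock /Lnorm; case: ifPn => [_|]; last first.
  rewrite -leNgt measure_le0 => /eqP mu0.
  exact: (measure0_ae (mu := leb) _ mu0).
have := @ess_sup_ge _ _ _ leb (abse \o (EFin \o (f \* \1_D)%R)).
apply: filterS => x + Dx; rewrite /= indicE mem_set// mulr1; exact.
Qed.

Let herz_term alpha f k : \bar R :=
  ((2 `^ (k%:~R * alpha))%:E * 'N[leb]_+oo[EFin \o (f \* \1_(dyadic_ring k))%R])%E.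

Lemma herz_term_ge0 alpha f k : (0 <= herz_term alpha f k)%E.
Proof. by apply: mule_ge0; rewrite ?lee_fin ?powR_ge0 ?Lnorm_ge0. Qed.

Lemma herz_normE alpha q f : (1 <= q)%E ->
  herz_norm +oo%E alpha q f = lnorm q (herz_term alpha f).
Proof.
case: q => [r||//] q1 //=; congr (_ `^ _)%E; apply: eq_esum => k _.
by rewrite /herz_term poweRM ?lee_fin ?powR_ge0 ?Lnorm_ge0// poweR_EFin -powRrM.
Qed.

Lemma herz_norm_ge0 alpha q f : (1 <= q)%E -> (0 <= herz_norm +oo%E alpha q f)%E.
Proof. by move=> q1; rewrite herz_normE//; apply: lnorm_ge0 => k; exact: herz_term_ge0. Qed.

Lemma eq_herz_norm alpha q f g : (1 <= q)%E -> (\forall x \ae leb, f x = g x) ->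
  herz_norm +oo%E alpha q f = herz_norm +oo%E alpha q g.
Proof.
move=> q1 fg; rewrite !herz_normE//; congr lnorm; apply/funext => k.
congr (_ * _)%E; rewrite unlock /Lnorm; case: ifP => // _.
by apply: eq_ess_sup; apply: filterS fg => x /= ->.
Qed.

Lemma herz_normD alpha q f g : (1 <= q)%E ->
  (herz_norm +oo%E alpha q (f \+ g)%R <=
   4%:E * (herz_norm +oo%E alpha q f + herz_norm +oo%E alpha q g))%E.
Proof.
move=> q1; rewrite !herz_normE//.
apply: le_trans (lnormD q1 (herz_term_ge0 alpha f) (herz_term_ge0 alpha g)).
apply: lnorm_le => // k; first exact: herz_term_ge0.
rewrite /herz_term -ge0_muleDr ?Lnorm_ge0//.
apply: lee_wpmul2l; first by rewrite lee_fin powR_ge0.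
rewrite unlock /Lnorm; case: ifP => _; last by rewrite adde0.
rewrite (_ : EFin \o _ = (EFin \o (f \* \1_(dyadic_ring k))%R) \+
   (EFin \o (g \* \1_(dyadic_ring k))%R))%E; first exact: ess_sup_absD.
by apply/funext => x /=; rewrite mulrDl EFinD.
Qed.

(** On the ring, r/2^k is at most 1 and its inverse at most 2. *)
Lemma weight_dyadic eps w k (r : R) : 0 <= eps -> weight eps w ->
  dyadic k / 2 <= r < dyadic k -> w r <= (1 + 2 `^ eps) * w (dyadic k).
Proof.
move=> eps0 [w0 ww] /andP[kr rk].
have k20 : 0 < dyadic k / 2 by rewrite divr_gt0.
have r0 : 0 < r by exact: lt_le_trans kr.
apply: le_trans (ww _ _ (dyadic_gt0 k) r0) _; rewrite ler_wpM2r ?w0//.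
apply: lerD.
  rewrite -[leRHS](_ : 1 `^ eps = 1); last by rewrite powR1.
  by rewrite ge0_ler_powR ?nnegrE ?divr_ge0 ?(ltW r0) ?(ltW (dyadic_gt0 k))// ler_pdivrMr// mul1r ltW.
rewrite ge0_ler_powR ?nnegrE ?divr_ge0 ?(ltW r0) ?(ltW (dyadic_gt0 k))//.
by rewrite ler_pdivrMr//; lra.
Qed.

(** Slow variation makes the values at dyadic radii determine w up to a constant factor. *)
Definition wnorm q w : \bar R := lnorm q (fun k => (w (dyadic k))%:E).

(** The factor 2^alpha comes from |x| >= 2^k/2 on ring k, the factor 1 + 2^eps from
    [weight_dyadic]. *)
Lemma herz_norm_le alpha eps q w kappa f : (1 <= q)%E -> 0 <= alpha -> 0 <= eps ->
  0 <= kappa -> weight eps w -> dominated alpha (fun r => kappa * w r) f ->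
  (herz_norm +oo%E alpha q f <=
   (kappa * (2 `^ alpha * (1 + 2 `^ eps)))%:E * wnorm q w)%E.
Proof.
move=> q1 alpha0 eps0 kappa0 ww fw; have [w0 _] := ww.
set C := kappa * _.
have C0 : 0 <= C by rewrite !mulr_ge0 ?powR_ge0 ?addr_ge0 ?powR_ge0.
have wk k : 0 <= w (dyadic k) by rewrite w0.
rewrite herz_normE//; apply: le_trans (lnormZ q1 C0 _); last first.
  by move=> k; rewrite lee_fin.
apply: lnorm_le => // k; first exact: herz_term_ge0.
have dk : 0 < (2 : R) `^ (k%:~R * alpha) by rewrite powR_gt0.
rewrite /herz_term -lee_pdivlMl// -!EFinM.
apply: Lnorm_le; first by rewrite !mulr_ge0 ?invr_ge0 ?(ltW dk).
apply: filterS fw => x fx /dyadic_ringP xk.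
apply: le_trans fx _; have wr := weight_dyadic eps0 ww xk.
have /andP[kx xk'] := xk.
have k20 : 0 < dyadic k / 2 by rewrite divr_gt0.
have x0 : 0 < enorm x by exact: lt_le_trans kx.
have xa : enorm x `^ (- alpha) <= (2 `^ (k%:~R * alpha))^-1 * 2 `^ alpha.
  rewrite powRrM -/(dyadic k) -[2 `^ alpha]invrK -invfM -powRN.
  have -> : (dyadic k `^ alpha * 2 `^ (- alpha)) = (dyadic k / 2) `^ alpha.
    rewrite powRM ?invr_ge0 ?(ltW (dyadic_gt0 k))//.
    by rewrite -[2^-1]powR_inv1// -powRrM mulN1r.
  rewrite powRN lef_pV2 ?posrE ?powR_gt0//.
  by rewrite ge0_ler_powR ?nnegrE ?(ltW k20) ?(ltW x0).
apply: le_trans (ler_pM _ _ xa (ler_wpM2l kappa0 wr)) _.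
- exact: powR_ge0.
- by rewrite mulr_ge0// w0.
- by rewrite le_eqVlt /C; apply/orP; left; apply/eqP; ring.
Qed.

End HerzNorm.

(** * From the Herz norm to a slowly varying weight *)

Section HerzWeights.
Context {R : realType} {n : nat}.
Hypothesis n0 : (0 < n)%N.
Local Notation Rn := (n.-tuple (measurableTypeR R)).
Local Notation leb := (@lebesgue_space R n).
Implicit Types (x y z : Rn) (w : R -> R) (f g : Rn -> R) (alpha eps kappa : R)
  (q : \bar R) (k j : int).
#[local] Hint Extern 0 (is_true (0 < dyadic _)) => exact: dyadic_gt0 : core.

Lemma wnorm_ge0 eps q w : weight eps w -> (0 <= wnorm q w)%E.
Proof. by move=> [w0 _]; apply: lnorm_ge0 => k; rewrite lee_fin w0. Qed.

Lemma wnormD eps q w v : (1 <= q)%E -> weight eps w -> weight eps v ->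
  (wnorm q w < +oo)%E -> (wnorm q v < +oo)%E ->
  (wnorm q (fun r => (w r + v r)%R) < +oo)%E.
Proof.
move=> q1 ww vv wq vq; have [w0 _] := ww; have [v0 _] := vv.
apply: (le_lt_trans (@lnormD _ q (fun k => (w (dyadic k))%:E)
  (fun k => (v (dyadic k))%:E) q1 _ _)); [by move=> k; rewrite lee_fin w0|
  by move=> k; rewrite lee_fin v0|].
by rewrite lte_mul_pinfty// lte_add_pinfty.
Qed.

Lemma weight_bounded eps q w : (1 <= q)%E -> 0 <= eps -> weight eps w ->
  (wnorm q w < +oo)%E -> exists2 M, 0 <= M & forall r, 0 < r -> w r <= M.
Proof.
move=> q1 eps0 ww wq; have N0 := wnorm_ge0 q ww; have [w0 _] := ww.
have Nf : wnorm q w \is a fin_num by rewrite ge0_fin_numE.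
exists ((1 + 2 `^ eps) * fine (wnorm q w)).
  by rewrite mulr_ge0 ?addr_ge0 ?powR_ge0 ?fine_ge0.
move=> r r0; have [k kr] := dyadic_ex r0.
apply: le_trans (weight_dyadic eps0 ww kr) _.
rewrite ler_wpM2l ?addr_ge0 ?powR_ge0// -lee_fin fineK//.
apply: (@lnorm_ge _ q (fun k => (w (dyadic k))%:E)) => // j.
by rewrite lee_fin w0.
Qed.

Lemma dominated_le alpha w v f : (forall r, 0 < r -> w r <= v r) ->
  dominated alpha w f -> dominated alpha v f.
Proof.
move=> wv; apply: filterS2 (ae_enorm_gt0 n0) => x x0 fx.
by apply: le_trans fx _; rewrite ler_wpM2l ?powR_ge0 ?wv.
Qed.

Lemma herz_dominated alpha eps q w f : (1 <= q)%E -> 0 <= alpha -> 0 <= eps ->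
  weight eps w -> (wnorm q w < +oo)%E ->
  measurable_fun setT f -> dominated alpha w f -> herz +oo%E alpha q f.
Proof.
move=> q1 alpha0 eps0 ww wq mf fw; split; last first.
  have fw1 : dominated alpha (fun r => 1 * w r) f.
    by apply: dominated_le fw => r _; rewrite mul1r.
  apply: le_lt_trans (herz_norm_le q1 alpha0 eps0 ler01 ww fw1) _.
  by rewrite lte_mul_pinfty// lee_fin mul1r mulr_ge0 ?addr_ge0 ?powR_ge0.
split=> // a b a0; have [M M0 wM] := weight_bounded q1 eps0 ww wq.
apply: le_lt_trans (@Lnorm_le _ _ _ _ (a `^ (- alpha) * M) _ _) (ltry _).
  by rewrite mulr_ge0 ?powR_ge0.
apply: filterS fw => x fx /= /andP[ax _].
have x0 : 0 < enorm x by exact: lt_le_trans ax.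
apply: le_trans fx _; apply: ler_pM; rewrite ?powR_ge0 ?wM ?(proj1 ww)//.
rewrite !powRN lef_pV2 ?posrE ?powR_gt0//.
by rewrite ge0_ler_powR ?nnegrE ?(ltW a0) ?(ltW x0).
Qed.

(** The a_k are the normalised norms on the rings; one null set serves for all rings because they
    are countably many. *)
Lemma ae_herz_ring alpha q f (A : R) : (1 <= q)%E -> 0 <= A ->
  (herz_norm +oo%E alpha q f <= A%:E)%E ->
  exists2 a : int -> R, (forall k, 0 <= a k <= A) &
    (lnorm q (fun k => (a k)%:E) = herz_norm +oo%E alpha q f) /\
    \forall x \ae leb, forall k, dyadic k / 2 <= enorm x < dyadic k ->
      `|f x| <= dyadic k `^ (- alpha) * a k.
Proof.
move=> q1 A0 fA; rewrite herz_normE// in fA *.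
set b := (X in lnorm q X) in fA *.
have b0 k : (0 <= b k)%E by exact: herz_term_ge0.
have bA k : (b k <= A%:E)%E by apply: le_trans fA; exact: lnorm_ge.
have bf k : b k \is a fin_num.
  by rewrite ge0_fin_numE// (le_lt_trans (bA k))// ltry.
exists (fun k => fine (b k)).
  by move=> k; rewrite fine_ge0//= -lee_fin fineK.
split; first by congr lnorm; apply/funext => k; rewrite fineK.
have ring_le k : \forall x \ae leb, dyadic k / 2 <= enorm x < dyadic k ->
    `|f x| <= dyadic k `^ (- alpha) * fine (b k).
  apply: filterS (ae_le_Lnorm f (dyadic_ring k)) => x fx /dyadic_ringP xk.
  have {fx} := fx xk; rewrite -(@lee_pmul2l _ (2 `^ (k%:~R * alpha))%:E) ?lte_fin ?powR_gt0//.
  rewrite -[X in (_ <= X)%E]/(b k) -(fineK (bf k)) -EFinM lee_fin => H.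
  by rewrite powRN -powRrM mulrC ler_pdivlMr ?powR_gt0// mulrC.
(* Countable intersections are indexed by naturals, so the integers are treated in two halves. *)
have pos : \forall x \ae leb, forall m, dyadic (Posz m) / 2 <= enorm x < dyadic (Posz m) ->
    `|f x| <= dyadic (Posz m) `^ (- alpha) * fine (b (Posz m)).
  by apply/ae_foralln => m; exact: ring_le.
have neg : \forall x \ae leb, forall m, dyadic (Negz m) / 2 <= enorm x < dyadic (Negz m) ->
    `|f x| <= dyadic (Negz m) `^ (- alpha) * fine (b (Negz m)).
  by apply/ae_foralln => m; exact: ring_le.
by apply: filterS2 pos neg => x px nx [m|m]; [exact: px|exact: nx].
Qed.

(** This is the inclusion of l^q in l^oo; it supplies the constant weights on which uniqueness
    rests. *)
Lemma herz_norm_weak alpha q f (A : R) : (1 <= q)%E -> 0 <= A -> 0 <= alpha ->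
  (herz_norm +oo%E alpha q f <= A%:E)%E -> dominated alpha (cst A) f.
Proof.
move=> q1 A0 alpha0 fA; have [a aA [_ fa]] := ae_herz_ring q1 A0 fA.
apply: filterS2 (ae_enorm_gt0 n0) fa => x x0 fx.
have [k kx] := dyadic_ex x0; apply: le_trans (fx k kx) _.
have /andP[a0 akA] := aA k; have /andP[_ xk] := kx.
apply: ler_pM => //; first exact: powR_ge0.
rewrite !powRN lef_pV2 ?posrE ?powR_gt0//.
by rewrite ge0_ler_powR ?nnegrE ?(ltW x0) ?(ltW (dyadic_gt0 k))// ltW.
Qed.

(** This is exp |log r - log s|, a multiplicative distance; [spreadM] is its triangle inequality. *)
Definition spread (r s : R) : R := Num.max (r / s) (s / r).

Lemma spread_gt0 r s : 0 < r -> 0 < s -> 0 < spread r s.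
Proof. by move=> r0 s0; rewrite lt_max divr_gt0. Qed.

Lemma spread_ge1 r s : 0 < r -> 0 < s -> 1 <= spread r s.
Proof.
move=> r0 s0; rewrite le_max ler_pdivlMr// mul1r ler_pdivlMr// mul1r.
exact: le_total.
Qed.

Lemma spreadM r s t : 0 < r -> 0 < s -> 0 < t ->
  spread r s <= spread t r * spread t s.
Proof.
move=> r0 s0 t0; rewrite ge_max; apply/andP; split.
  rewrite (_ : r / s = (r / t) * (t / s)); last by field; rewrite !gt_eqF.
  by apply: ler_pM; rewrite ?divr_ge0 ?(ltW r0) ?(ltW t0) ?(ltW s0)// le_max lexx ?orbT.
rewrite (_ : s / r = (t / r) * (s / t)); last by field; rewrite !gt_eqF.
by apply: ler_pM; rewrite ?divr_ge0 ?(ltW r0) ?(ltW t0) ?(ltW s0)// le_max lexx ?orbT.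
Qed.

Lemma spread_dyadic k j : spread (dyadic k) (dyadic j) = 2 `^ (`|k - j|%N%:R).
Proof.
have E (i l : int) : dyadic i / dyadic l = 2 `^ (i - l)%:~R :> R.
  by rewrite /dyadic -powRN -powRD ?pnatr_eq0 ?implybT// intrD mulrNz.
have mono (i l : int) : i <= l -> dyadic i / dyadic l <= 1 :> R.
  move=> il; rewrite E -[leRHS](powRr0 2) ler_powR ?ler1n//.
  by rewrite lerz0 subr_le0.
rewrite /spread; have [kj|/ltW jk] := leP k j.
  rewrite max_r; last first.
    apply: le_trans (mono _ _ kj) _.
    by rewrite -invf_div invf_ge1 ?mono ?divr_gt0.
  by rewrite E distnC natr_absz ger0_norm ?subr_ge0.
rewrite max_l; last first.
  apply: le_trans (mono _ _ jk) _.
  by rewrite -invf_div invf_ge1 ?mono ?divr_gt0.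
by rewrite E natr_absz ger0_norm ?subr_ge0.
Qed.

(** The supremum over j of a_j spread(r, 2^j)^-eps is the smallest function that is at least a_j at
    each 2^j and varies at most like the power eps of [spread]. At dyadic radii it is a
    sup-convolution with the kernel (2^-eps)^|k - j|, bounded in l^q since eps > 0. *)
Lemma herz_weight alpha eps q : (1 <= q)%E -> 0 <= alpha -> 0 < eps ->
  exists2 C, 0 < C & forall f (A : R), 0 <= A ->
  (herz_norm +oo%E alpha q f <= A%:E)%E ->
  exists w, [/\ weight eps w, dominated alpha w f, (wnorm q w < +oo)%E &
    forall r, 0 < r -> w r <= C * A].
Proof.
move=> q1 alpha0 eps0.
pose h : R := 2 `^ (- eps).
have h01 : 0 < h < 1.
  rewrite powR_gt0//=; have := @gt0_ltr_powR _ eps eps0 1 2.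
  rewrite !nnegrE powR1 ler01 ler0n ltr1n => /(_ isT isT isT) H.
  by rewrite /h powRN invf_lt1// powR_gt0.
have [S S0 HS] := lnorm_supconv q1 h01.
have e2 : 0 < 2 `^ eps :> R by rewrite powR_gt0.
(* A point of ring k is within a factor 2 of 2^k, so the value at 2^k passes to the whole ring at
   the cost of 2^eps. *)
exists (2 `^ eps) => // f A A0 fA.
have [a aA [na fa]] := ae_herz_ring q1 A0 fA.
pose E r : set R := [set a j * spread r (dyadic j) `^ (- eps) | j in setT].
have Eub r : 0 < r -> ubound (E r) A.
  move=> r0 _ [j _ <-]; have /andP[a0 ajA] := aA j.
  rewrite -[leRHS]mulr1; apply: ler_pM; rewrite ?powR_ge0//.
  rewrite powRN invf_le1 ?powR_gt0 ?spread_gt0// -[leLHS](powRr0 (spread r (dyadic j))).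
  by apply: ler_powR; [exact: spread_ge1|exact: ltW].
have Esup r : 0 < r -> has_sup (E r).
  move=> r0; split; last by exists A; exact: Eub.
  by exists (a 0 * spread r (dyadic 0) `^ (- eps)); exists 0.
have Ele r j : 0 < r -> a j * spread r (dyadic j) `^ (- eps) <= sup (E r).
  by move=> r0; apply: sup_upper_bound; [exact: Esup|exists j].
pose w r := sup (E r).
have w0 r : 0 < r -> 0 <= w r.
  move=> r0; apply: le_trans (Ele r 0 r0).
  by have /andP[a0 _] := aA 0; rewrite mulr_ge0 ?powR_ge0.
have ww : weight eps w.
  split=> // r r' r0 r'0; apply: ge_sup.
    by exists (a 0 * spread r' (dyadic 0) `^ (- eps)); exists 0.
  move=> _ [j _ <-]; have /andP[a0 ajA] := aA j.
  apply: (@le_trans _ _ (spread r' r `^ eps * (a j * spread r (dyadic j) `^ (- eps)))).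
    rewrite mulrCA ler_wpM2l// !powRN ler_pdivlMr ?powR_gt0 ?spread_gt0//.
    rewrite mulrC ler_pdivrMr ?powR_gt0 ?spread_gt0//.
    rewrite -powRM ?(ltW (spread_gt0 _ _))// ge0_ler_powR ?nnegrE ?(ltW eps0)//.
    - exact/ltW/spread_gt0.
    - by rewrite mulr_ge0// ltW// spread_gt0.
    - exact: spreadM.
  apply: ler_pM; rewrite ?powR_ge0 ?mulr_ge0 ?powR_ge0 ?Ele//.
  rewrite /spread; have [_|_] := leP (r' / r) (r / r').
    by rewrite ler_wpDl ?powR_ge0.
  by rewrite ler_wpDr ?powR_ge0.
exists (fun r => 2 `^ eps * w r); split.
- exact: weightZ (ltW e2) ww.
- apply: filterS2 (ae_enorm_gt0 n0) fa => x x0 fx.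
  have [k kx] := dyadic_ex x0; have /andP[k1 k2] := kx.
  apply: le_trans (fx k kx) _; have /andP[a0 akA] := aA k.
  apply: ler_pM; rewrite ?powR_ge0//.
    rewrite !powRN lef_pV2 ?posrE ?powR_gt0//.
    by rewrite ge0_ler_powR ?nnegrE ?(ltW x0) ?(ltW (dyadic_gt0 k))// ltW.
  apply: (@le_trans _ _ (2 `^ eps * (a k * spread (enorm x) (dyadic k) `^ (- eps)))).
    rewrite mulrCA ler_peMr// powRN ler_pdivlMr ?powR_gt0 ?spread_gt0// mul1r.
    rewrite ge0_ler_powR ?nnegrE ?(ltW eps0) ?(ltW (spread_gt0 _ _))//.
    rewrite ge_max !ler_pdivrMr//; have := dyadic_gt0 k.
    by move=> dk; apply/andP; split; lra.
  by rewrite ler_wpM2l ?(ltW e2)// Ele.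
- apply: (@le_lt_trans _ _ ((2 `^ eps)%:E * (S%:E * lnorm q (fun k => (a k)%:E)))%E).
    apply: (le_trans (@lnormZ _ q (fun k => (w (dyadic k))%:E) _ q1 (ltW e2) _)); first by move=> k; rewrite lee_fin w0.
    apply: lee_wpmul2l; first by rewrite lee_fin ltW.
    apply: HS => k; [by rewrite lee_fin; case/andP: (aA k)|by rewrite lee_fin w0|].
    set Q := ereal_sup _.
    have HQ j : ((a j * spread (dyadic k) (dyadic j) `^ (- eps))%:E <= Q)%E.
      apply: ereal_sup_ubound; exists j => //.
      rewrite -EFinM; congr (_%:E); rewrite mulrC; congr (_ * _).
      by rewrite spread_dyadic /h -powR_mulrn; [rewrite -(powRrM 2) -(powRrM 2) mulrC|exact: powR_ge0].
    case: Q HQ => [c||] HQ; [|by rewrite leey|by have := HQ 0].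
    rewrite lee_fin; apply: ge_sup.
      by exists (a 0 * spread (dyadic k) (dyadic 0) `^ (- eps)); exists 0.
    by move=> _ [j _ <-]; rewrite -lee_fin.
  rewrite na lte_mul_pinfty ?lee_fin ?(ltW e2)// lte_mul_pinfty ?lee_fin//.
  exact: le_lt_trans fA (ltry _).
- move=> r r0; rewrite ler_wpM2l ?(ltW e2)//; apply: ge_sup; last exact: Eub.
  by exists (a 0 * spread r (dyadic 0) `^ (- eps)); exists 0.
Qed.

End HerzWeights.

(** * The Duhamel integral *)

Section ParametricIntegral.
Context d1 d2 (T1 : measurableType d1) (T2 : measurableType d2) (R : realType).
Variable mu : {sigma_finite_measure set T2 -> \bar R}.

(** [Rintegral] is [fine] of a difference of two integrals of nonnegative functions, each measurable
    in the parameter by Tonelli, finite or not. *)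
Lemma measurable_Rintegral (k : T1 * T2 -> R) : measurable_fun setT k ->
  measurable_fun setT (fun z => \int[mu]_y k (z, y)).
Proof.
move=> mk.
have mK : measurable_fun setT (EFin \o k) by exact/measurable_EFinP.
have E : (fun z => \int[mu]_y k (z, y)) = fine \o
    (fubini_F mu (EFin \o k)^\+ \- fubini_F mu (EFin \o k)^\-)%E.
  apply/funext => z; rewrite /Rintegral integralE /fubini_F /=.
  by congr (fine (_ - _)%E); apply: eq_integral => y _; rewrite ?funeposE ?funenegE.
rewrite E.
apply: (measurableT_comp (@fine_measurable R setT measurableT)).
apply: emeasurable_funB.
- exact: (measurable_fun_fubini_tonelli_F _
    (measurable_funepos mK) (fun z => funepos_ge0 _ z)).
- exact: (measurable_fun_fubini_tonelli_F _
    (measurable_funeneg mK) (fun z => funeneg_ge0 _ z)).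
Qed.

End ParametricIntegral.

Section TimeIntegral.
Context {R : realType}.
Local Notation mu := (@lebesgue_measure R).
Implicit Types (a b t B p : R) (g : R -> R).

(** The interval is enlarged to the symmetric one around t, whence the factor 2. Being open at b, it
    never contains the singular time t. *)
Lemma integrable_time a b t B p g : 0 <= p < 1 -> a <= b -> b <= t -> 0 <= B ->
  measurable_fun `[a, b[ g ->
  (forall s, a <= s < b -> `|g s| <= B * (t - s) `^ (- p)) ->
  mu.-integrable `[a, b[ (EFin \o g) /\
  `| \int[mu]_(s in `[a, b[) g s | <= 2 / (1 - p) * B * (t - a) `^ (1 - p).
Proof.
move=> p01 ab bt B0 mg gB.
have ta : 0 <= t - a by lra.
have md : measurable_fun setT (fun s : R => (`|s - t| `^ (- p))%:E).
  apply/measurable_EFinP; apply: (measurableT_comp (measurable_powR _)).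
  by apply: measurableT_comp => //; exact: measurable_funB.
have H : (\int[mu]_(s in `[a, b[) `|(g s)%:E| <=
    (2 / (1 - p) * B * (t - a) `^ (1 - p))%:E)%E.
  apply: (@le_trans _ _ (\int[mu]_(s in `[(t - (t - a))%R, (t + (t - a))%R])
      (B%:E * (`|s - t| `^ (- p))%:E))%E).
    apply: (@le_trans _ _ (\int[mu]_(s in `[a, b[) (B%:E * (`|s - t| `^ (- p))%:E))%E).
      apply: ge0_le_integral => //.
      - apply: (measurableT_comp (@abse_measurable R setT)).
        exact/measurable_EFinP.
      - apply: emeasurable_funM => //; exact: measurable_funTS.
      - move=> s /=; rewrite in_itv/= => /andP[a1 a2].
        rewrite -EFinM lee_fin distrC [`|t - s|]ger0_norm; last by lra.
        by apply: gB; rewrite a1.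
    apply: ge0_subset_integral => //.
    - by apply: emeasurable_funM => //; exact: measurable_funTS.
    - by move=> s _; rewrite mule_ge0// lee_fin ?powR_ge0.
    - by move=> s /=; rewrite !in_itv/= => /andP[a1 a2]; apply/andP; split; lra.
  rewrite ge0_integralZl//; last exact: measurable_funTS.
  apply: le_trans (lee_wpmul2l _ (integral_powR_dist t p01 ta)) _.
    by rewrite lee_fin.
  by rewrite -EFinM lee_fin le_eqVlt; apply/orP; left; apply/eqP; ring.
have ig : mu.-integrable `[a, b[ (EFin \o g).
  apply/integrableP; split; first exact/measurable_EFinP.
  by apply: le_lt_trans H (ltry _).
split=> //; rewrite -lee_fin EFin_normr_Rintegral//.
apply: le_trans (le_abse_integral _ _ _) H => //.
exact/measurable_EFinP.
Qed.

End TimeIntegral.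

Section Duhamel.
Context {R : realType} {n : nat}.
Local Notation Rn := (n.-tuple (measurableTypeR R)).
Local Notation leb := (@lebesgue_space R n).
Local Notation mu := (@lebesgue_measure R).
Implicit Types (x y z : Rn) (w : R -> R) (f g : Rn -> R) (F G : R -> Rn -> R)
  (a b t s d sigma eps : R).

(* Unlike [heat], this has no special value at time [0], which makes it jointly
   measurable; the two differ on a null set of times. *)
Definition heat_conv t f x : R := \int[leb]_y (heat_kernel t (vsub x y) * f y).

(** The observation time t is separate from the endpoint b, so that the integral can be cut at an
    intermediate time and the past propagated further. *)
Definition duhamel F a b t x : R := \int[mu]_(s in `[a, b[) heat_conv (t - s) (F s) x.

Definition source d w F a b := forall s, a <= s < b ->
  measurable_fun setT (F s) /\ dominated d w (F s).

(** Kept as a hypothesis of its own because it has two sources: joint measurability for constructed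
    solutions, norm continuity for arbitrary members of the class. *)
Definition time_measurable F a b t x :=
  measurable_fun `[a, b[ (fun s => heat_conv (t - s) (F s) x).

Lemma source_sub d w F a b a' b' : a <= a' -> b' <= b ->
  source d w F a b -> source d w F a' b'.
Proof. by move=> aa bb H s /andP[s1 s2]; apply: H; apply/andP; split; lra. Qed.

Lemma time_measurable_sub F a b t x a' b' : a <= a' -> b' <= b ->
  time_measurable F a b t x -> time_measurable F a' b' t x.
Proof.
move=> aa bb; apply: measurable_funS => // s /=; rewrite !in_itv/=.
by move=> /andP[s1 s2]; apply/andP; split; lra.
Qed.

Lemma heat_conv_heat t f x : 0 < t -> heat_conv t f x = heat t f x.
Proof. by move=> t0; rewrite heatE. Qed.

Lemma duhamel_le eps d sigma : 0 <= eps -> 0 <= sigma < 2 -> eps <= d - sigma ->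
  d + eps < n%:R -> exists2 K, 0 < K &
  forall w F a b t x, weight eps w -> source d w F a b -> a <= b -> b <= t ->
  0 < enorm x -> time_measurable F a b t x ->
  mu.-integrable `[a, b[ (EFin \o (fun s => heat_conv (t - s) (F s) x)) /\
  `|duhamel F a b t x| <=
    K * (t - a) `^ (1 - sigma / 2) * (enorm x `^ (- (d - sigma)) * w (enorm x)).
Proof.
move=> eps0 /andP[sigma0 sigma2] ed den.
have [C C0 HC] := @heat_bound R n eps d sigma eps0 sigma0 ed den.
have p01 : 0 <= sigma / 2 < 1 by apply/andP; split; lra.
exists (2 / (1 - sigma / 2) * C).
  by rewrite mulr_gt0// divr_gt0//; case/andP: p01 => *; lra.
move=> w F a b t x ww sF ab bt x0 mF.
set W := _ `^ _ * w _.
have W0 : 0 <= W by rewrite mulr_ge0 ?powR_ge0// (proj1 ww).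
have CW0 : 0 <= C * W by rewrite mulr_ge0// ltW.
have [|ig gB] := integrable_time p01 ab bt CW0 mF.
  move=> s /andP[s1 s2]; have [mFs dFs] : measurable_fun setT (F s) /\ dominated d w (F s).
    by apply: sF; rewrite s1.
  have ts : 0 < t - s by lra.
  rewrite heat_conv_heat//; have [_ H] := HC w (F s) (t - s) x ww mFs dFs ts x0.
  by apply: le_trans H _; rewrite mulrAC.
split=> //; apply: le_trans gB _.
by rewrite le_eqVlt; apply/orP; left; apply/eqP; ring.
Qed.

Lemma duhamel_cat F a b c t x : a <= b -> b <= c ->
  mu.-integrable `[a, c[ (EFin \o (fun s => heat_conv (t - s) (F s) x)) ->
  duhamel F a c t x = duhamel F a b t x + duhamel F b c t x.
Proof.
move=> ab bc ig; have E : `[a, c[%classic = `[a, b[%classic `|` `[b, c[%classic :> set R.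
  apply/seteqP; split => s /=; rewrite !in_itv/=.
    by move=> /andP[s1 s2]; have [bs|sb] := leP b s; [right|left]; apply/andP; split; lra.
  by move=> [] /andP[s1 s2]; apply/andP; split; lra.
rewrite /duhamel E Rintegral_setU//; first by rewrite -E.
by apply/disj_setPS => s /=; rewrite !in_itv/= => -[/andP[s1 s2] /andP[s3 s4]]; lra.
Qed.

(** The increment is the integral over [t, t'[ plus that of the kernel difference over [a, t[. The
    available power 1 - sigma/2 is halved: one half becomes the Hoelder exponent theta, and the
    other keeps theta + sigma/2 < 1, so the singularity at s = t stays integrable. *)
Lemma duhamel_hoelder eps d sigma : 0 <= eps -> 0 <= sigma < 2 -> eps <= d - sigma ->
  d + eps < n%:R -> exists2 K, 0 < K &
  forall w F a t t' x, weight eps w -> source d w F a t' -> a <= t -> t <= t' ->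
  0 < enorm x -> time_measurable F a t t x -> time_measurable F a t' t' x ->
  `|duhamel F a t' t' x - duhamel F a t t x| <=
    K * (t' - t) `^ ((1 - sigma / 2) / 2) * (t' - a) `^ ((1 - sigma / 2) / 2) *
    (enorm x `^ (- (d - sigma)) * w (enorm x)).
Proof.
move=> eps0 sigma02 ed den; have /andP[sigma0 sigma2] := sigma02.
pose theta := (1 - sigma / 2) / 2.
have th0 : 0 < theta by rewrite /theta; lra.
have th1 : 0 <= theta <= 1 by rewrite /theta; apply/andP; split; lra.
have thE : 1 - sigma / 2 = theta + theta by rewrite /theta; field.
have [C C0 HC] := @heat_hoelder R n eps d sigma theta eps0 sigma0 ed den th1.
have [K K0 HK] := duhamel_le eps0 sigma02 ed den.
have p01 : 0 <= theta + sigma / 2 < 1 by rewrite /theta; apply/andP; split; lra.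
have q0 : 0 < 1 - (theta + sigma / 2) by case/andP: p01 => *; lra.
pose K1 := 2 / (1 - (theta + sigma / 2)) * C.
have K10 : 0 < K1 by rewrite mulr_gt0// divr_gt0.
exists (K + K1); first exact: addr_gt0.
move=> w F a t t' x ww sF at_ tt' x0 m1 m2.
set W := _ `^ _ * w _.
have W0 : 0 <= W by rewrite mulr_ge0 ?powR_ge0// (proj1 ww).
have at' := le_trans at_ tt'.
have [i2 _] := HK w F a t' t' x ww sF at' (lexx _) x0 m2.
have sFt : source d w F a t := source_sub (lexx a) tt' sF.
have m3 : time_measurable F a t t' x := time_measurable_sub (lexx a) tt' m2.
have [i1 _] := HK w F a t t x ww sFt at_ (lexx _) x0 m1.
have [i3 _] := HK w F a t t' x ww sFt at_ tt' x0 m3.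
rewrite (duhamel_cat at_ tt' i2) addrAC.
rewrite -/theta; apply: le_trans (ler_normD _ _) _.
rewrite [leRHS](_ : _ = K1 * (t' - t) `^ theta * (t' - a) `^ theta * W +
  K * (t' - t) `^ theta * (t' - a) `^ theta * W); last by ring.
have tha : (t' - t) `^ theta <= (t' - a) `^ theta.
  by rewrite ge0_ler_powR ?nnegrE ?(ltW th0)//; lra.
have thb : (t - a) `^ theta <= (t' - a) `^ theta.
  by rewrite ge0_ler_powR ?nnegrE ?(ltW th0)//; lra.
apply: lerD; last first.
  have [_ H] := HK w F t t' t' x ww (source_sub at_ (lexx _) sF) tt' (lexx _) x0
    (time_measurable_sub at_ (lexx _) m2).
  apply: le_trans H _; rewrite -/W thE.
  have -> : (t' - t) `^ (theta + theta) = (t' - t) `^ theta * (t' - t) `^ theta.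
    by rewrite powRD//; apply/implyP => /eqP; lra.
  by rewrite ler_wpM2r// -!mulrA ler_pM2l// ler_wpM2l ?powR_ge0.
have CW0 : 0 <= C * (t' - t) `^ theta * W.
  by rewrite mulr_ge0// mulr_ge0 ?powR_ge0// ltW.
pose h s := heat_conv (t' - s) (F s) x - heat_conv (t - s) (F s) x.
have mh : measurable_fun `[a, t[ h := measurable_funB m3 m1.
have [|ih hB] := integrable_time p01 at_ (lexx t) CW0 mh.
  move=> s /andP[s1 s2]; have [mFs dFs] : measurable_fun setT (F s) /\ dominated d w (F s).
    by apply: sFt; rewrite s1.
  have ts : 0 < t - s by lra.
  have ts' : 0 < t' - s by lra.
  have tts : t - s <= t' - s by lra.
  rewrite /h !heat_conv_heat//.
  apply: le_trans (HC w (F s) (t - s) (t' - s) x ww mFs dFs ts tts x0) _.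
  rewrite -/W (_ : t' - s - (t - s) = t' - t); last by ring.
  rewrite powRM ?invr_ge0 ?(ltW ts)//; last by lra.
  rewrite -[X in _ * X `^ _]powR_inv1 ?(ltW ts)// -powRrM mulN1r.
  rewrite opprD powRD; last by rewrite (gt_eqF ts) implybT.
  by rewrite le_eqVlt; apply/orP; left; apply/eqP; ring.
have -> : duhamel F a t t' x - duhamel F a t t x = \int[mu]_(s in `[a, t[) h s.
  by rewrite /duhamel RintegralB.
apply: le_trans hB _.
have -> : 1 - (theta + sigma / 2) = theta by rewrite /theta; field.
rewrite (_ : 2 / theta * (C * (t' - t) `^ theta * W) * (t - a) `^ theta =
  2 / theta * C * (t' - t) `^ theta * (t - a) `^ theta * W); last by ring.
have -> : K1 = 2 / theta * C by rewrite /K1 (_ : 1 - (theta + sigma / 2) = theta)// /theta; field.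
rewrite ler_wpM2r// ler_wpM2l// !mulr_ge0 ?powR_ge0 ?invr_ge0 ?(ltW C0) ?(ltW th0)//.
Qed.

Lemma measurable_heat_conv_joint F :
  measurable_fun setT (fun p : measurableTypeR R * Rn => F p.1 p.2) ->
  measurable_fun setT (fun q : (measurableTypeR R * Rn) * measurableTypeR R =>
    heat_conv (q.1.1 - q.2) (F q.2) q.1.2).
Proof.
move=> mF.
pose T := (measurableTypeR R * Rn * measurableTypeR R * Rn)%type.
have m11 : measurable_fun setT (fun q : T => q.1.1.1).
  by apply: measurableT_comp => //; exact: measurableT_comp.
have m12 : measurable_fun setT (fun q : T => q.1.1.2).
  by apply: measurableT_comp => //; exact: measurableT_comp.
have m2 : measurable_fun setT (fun q : T => q.1.2) by exact: measurableT_comp.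
have mv : measurable_fun setT (fun q : T => vsub q.1.1.2 q.2).
  have mp : measurable_fun setT (fun q : T => (q.1.1.2, q.2)).
    exact: measurable_fun_pair.
  exact: (measurableT_comp measurable_vsub mp).
have mt : measurable_fun setT (fun q : T => (q.1.1.1 - q.1.2 : measurableTypeR R)).
  exact: measurable_funB.
have mk : measurable_fun setT (fun q : T =>
    heat_kernel (q.1.1.1 - q.1.2) (vsub q.1.1.2 q.2) * F q.1.2 q.2).
  apply: measurable_funM.
    have mp := measurable_fun_pair mt mv.
    exact: (measurableT_comp measurable_heat_kernel mp).
  have mp : measurable_fun setT (fun q : T => (q.1.2, q.2)).
    exact: measurable_fun_pair.
  exact: (measurableT_comp mF mp).
exact: (measurable_Rintegral leb mk).
Qed.

Lemma joint_time_measurable F a b t x :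
  measurable_fun setT (fun p : measurableTypeR R * Rn => F p.1 p.2) ->
  time_measurable F a b t x.
Proof.
move=> mF; apply: measurable_funTS.
have mp : measurable_fun setT (fun s : measurableTypeR R =>
    (((t : measurableTypeR R), x), s)) by exact: measurable_fun_pair.
exact: (measurableT_comp (measurable_heat_conv_joint mF) mp).
Qed.

Lemma measurable_heat_conv f : measurable_fun setT f ->
  measurable_fun setT (fun p : measurableTypeR R * Rn => heat_conv p.1 f p.2).
Proof.
move=> mf.
have mF : measurable_fun setT (fun p : measurableTypeR R * Rn => (fun _ : R => f) p.1 p.2).
  exact: (measurableT_comp mf).
have mp : measurable_fun setT (fun p : measurableTypeR R * Rn =>
  (p, (0 : measurableTypeR R))) by exact: measurable_fun_pair.
have := measurableT_comp (@measurable_heat_conv_joint (fun=> f) mF) mp.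
by apply: eq_measurable_fun => p _ /=; rewrite subr0.
Qed.

Lemma measurable_duhamel F a b :
  measurable_fun setT (fun p : measurableTypeR R * Rn => F p.1 p.2) ->
  measurable_fun setT (fun p : measurableTypeR R * Rn => duhamel F a b p.1 p.2).
Proof.
move=> mF; pose T := (measurableTypeR R * Rn * measurableTypeR R)%type.
have mk : measurable_fun setT (fun q : T =>
    if (a <= q.2) && (q.2 < b) then heat_conv (q.1.1 - q.2) (F q.2) q.1.2 else 0).
  apply: measurable_fun_ifT => //; last exact: measurable_heat_conv_joint.
  by apply: measurable_and; [exact: measurable_fun_ler|exact: measurable_fun_ltr].
have := measurable_Rintegral mu mk.
apply: eq_measurable_fun => p _ /=; rewrite /duhamel [RHS]Rintegral_mkcond.
apply: eq_Rintegral => s _; rewrite patchE mem_setE/= in_itv/=.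
by case: ifP.
Qed.

(** The upper limit moves with the parameter, so the constraint on s is put into the integrand. *)
Lemma measurable_duhamel_diag F a :
  measurable_fun setT (fun p : measurableTypeR R * Rn => F p.1 p.2) ->
  measurable_fun setT (fun p : measurableTypeR R * Rn => duhamel F a p.1 p.1 p.2).
Proof.
move=> mF; pose T := (measurableTypeR R * Rn * measurableTypeR R)%type.
have m1 : measurable_fun setT (fun q : T => q.1.1) by exact: measurableT_comp.
have mk : measurable_fun setT (fun q : T =>
    if (a <= q.2) && (q.2 < q.1.1) then heat_conv (q.1.1 - q.2) (F q.2) q.1.2 else 0).
  apply: measurable_fun_ifT => //; last exact: measurable_heat_conv_joint.
  by apply: measurable_and; [exact: measurable_fun_ler|exact: measurable_fun_ltr].
have := measurable_Rintegral mu mk.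
apply: eq_measurable_fun => p _ /=; rewrite /duhamel [RHS]Rintegral_mkcond.
apply: eq_Rintegral => s _; rewrite patchE mem_setE/= in_itv/=.
by case: ifP.
Qed.

End Duhamel.

(** * Local existence *)

Section Picard.
Context {R : realType} {n : nat}.
Local Notation Rn := (n.-tuple (measurableTypeR R)).
Local Notation leb := (@lebesgue_space R n).
Local Notation mu := (@lebesgue_measure R).
Context (alpha beta gamma eps : R).
Hypotheses (n0 : (0 < n)%N) (beta0 : 0 < beta) (eps0 : 0 <= eps) (ea : eps <= alpha).
Local Notation sigma := (alpha * beta + gamma).
Local Notation delta := (alpha + sigma).
Hypotheses (sigma02 : 0 <= sigma < 2) (den : delta + eps < n%:R).
Implicit Types (x y z : Rn) (w : R -> R) (f g : Rn -> R) (u v : R -> Rn -> R)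
  (a b t s M : R).

Local Notation hh v := (fun s => hardy_henon gamma beta (v s)).

Let ed : eps <= delta - sigma.
Proof. by rewrite addrK. Qed.

Definition bounded_on M v a b := forall s, a <= s < b ->
  measurable_fun setT (v s) /\ dominated alpha (cst M) (v s).

(** This is the Lipschitz bound against the zero function. *)
Lemma hardy_henon_bound : exists2 L, 1 <= L & forall f w M,
  dominated alpha (cst M) f -> dominated alpha w f -> 0 <= M ->
  dominated delta (fun r => L * M `^ beta * w r) (hardy_henon gamma beta f).
Proof.
have [L L1 HL] := @hardy_henon_lipschitz R n alpha beta gamma n0 beta0.
exists L => // f w M fM fw M0.
have zM : dominated alpha (cst M) (cst 0 : Rn -> R).
  by apply: nearW => x; rewrite normr0 mulr_ge0 ?powR_ge0.
have fw' : dominated alpha w (f \- cst 0).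
  by apply: filterS fw => x; rewrite /= subr0.
have := HL f (cst 0) w M fM zM fw' M0.
by apply: filterS => x; rewrite hardy_henon0 /= subr0.
Qed.

Lemma source_bounded : exists2 L, 0 < L & forall M v a b, 0 <= M ->
  bounded_on M v a b -> source delta (cst (L * M `^ beta * M)) (hh v) a b.
Proof.
have [L L1 HL] := hardy_henon_bound.
exists L => [|M v a b M0 vM s sab]; first exact: lt_le_trans L1.
have [mv dv] := vM s sab; split; first exact: measurable_hardy_henon.
exact: HL.
Qed.

(** Used twice: with a multiple of the weight of the data for the contraction, and with a constant
    weight for uniqueness. *)
Lemma duhamel_lipschitz : exists2 K, 0 < K &
  forall w M u v a t x, weight eps w -> 0 <= M -> a <= t -> 0 < enorm x ->
  bounded_on M u a t -> bounded_on M v a t ->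
  (forall s, a <= s < t -> dominated alpha w (u s \- v s)) ->
  time_measurable (hh u) a t t x -> time_measurable (hh v) a t t x ->
  `|duhamel (hh u) a t t x - duhamel (hh v) a t t x| <=
    K * M `^ beta * (t - a) `^ (1 - sigma / 2) * (enorm x `^ (- alpha) * w (enorm x)).
Proof.
have [L L1 HL] := @hardy_henon_lipschitz R n alpha beta gamma n0 beta0.
have [L' L'0 HL'] := source_bounded.
have [K K0 HK] := @duhamel_le R n eps delta sigma eps0 sigma02 ed den.
have /andP[sigma0 _] := sigma02.
have [C C0 HC] := @heat_bound R n eps delta sigma eps0 sigma0 ed den.
have L0 : 0 < L by exact: lt_le_trans L1.
exists (K * L); first exact: mulr_gt0.
move=> w M u v a t x ww M0 at_ x0 bu bv uvw mu_ mv_.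
have LM0 : 0 <= L' * M `^ beta * M by rewrite !mulr_ge0 ?powR_ge0// ltW.
have su := HL' M u a t M0 bu; have sv := HL' M v a t M0 bv.
(* Constant weights give the integrability of each term alone; w only measures the difference. *)
have wc := @weight_cst R eps _ LM0.
have [iu _] := HK _ _ a t t x wc su at_ (lexx _) x0 mu_.
have [iv _] := HK _ _ a t t x wc sv at_ (lexx _) x0 mv_.
pose G s : Rn -> R := fun y => hh u s y - hh v s y.
have E s : a <= s < t -> heat_conv (t - s) (G s) x =
    heat_conv (t - s) (hh u s) x - heat_conv (t - s) (hh v s) x.
  move=> sat; have /andP[s1 s2] := sat; have ts : 0 < t - s by lra.
  have [mus dus] := su s sat; have [mvs dvs] := sv s sat.
  rewrite !heat_conv_heat//; apply: heatB => //.
    exact: (proj1 (HC _ _ _ x wc mus dus ts x0)).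
  exact: (proj1 (HC _ _ _ x wc mvs dvs ts x0)).
have -> : duhamel (hh u) a t t x - duhamel (hh v) a t t x = duhamel G a t t x.
  rewrite /duhamel -RintegralB//; apply: eq_Rintegral => s.
  by rewrite inE/= in_itv/= => sat; rewrite E.
have LMb0 : 0 <= L * M `^ beta by rewrite mulr_ge0 ?powR_ge0// ltW.
have wG := weightZ LMb0 ww.
have sG : source delta (fun r => L * M `^ beta * w r) G a t.
  move=> s sat; have [mus _] := su s sat; have [mvs _] := sv s sat.
  split; first exact: measurable_funB.
  have [_ dus] := bu s sat; have [_ dvs] := bv s sat.
  exact: (HL (u s) (v s) w M dus dvs (uvw s sat) M0).
have mG : time_measurable G a t t x.
  have := measurable_funB mu_ mv_; apply: eq_measurable_fun => s.
  by rewrite inE/= in_itv/= => sat; rewrite E.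
have [_] := HK _ _ a t t x wG sG at_ (lexx _) x0 mG.
rewrite addrK => /le_trans; apply.
by rewrite le_eqVlt; apply/orP; left; apply/eqP; ring.
Qed.

(** Adding and subtracting the geometric tail h encloses U between a nonincreasing and a
    nondecreasing sequence, which yields the limit and the rate together. *)
Lemma geometric_cvg (U : R^nat) (B : R) : 
  (forall m, `|U m.+1 - U m| <= B * 2^-1 ^+ m) ->
  cvgn U /\ forall m, `|limn U - U m| <= 2 * B * 2^-1 ^+ m.
Proof.
move=> UB; have B0 : 0 <= B by have := UB 0; rewrite expr0 mulr1; exact: le_trans.
pose h (m : nat) : R := 2 * B * 2^-1 ^+ m.
have hS m : h m.+1 = h m - B * 2^-1 ^+ m by rewrite /h exprS; field.
have h0 m : 0 <= h m by rewrite /h !mulr_ge0// exprn_ge0// invr_ge0.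
have hcvg : h @ \oo --> 0.
  have -> : h = geometric (2 * B) 2^-1 by [].
  by apply: cvg_geometric; rewrite ger0_norm ?invr_ge0// invf_lt1// ltr1n.
pose V m := U m + h m; pose W m := U m - h m.
have VS m : V m.+1 <= V m.
  by have := UB m; rewrite ler_norml /V hS => /andP[? ?]; lra.
have WS m : W m <= W m.+1.
  by have := UB m; rewrite ler_norml /W hS => /andP[? ?]; lra.
have Vni : nonincreasing_seq V by apply/nonincreasing_seqP.
have Wnd : nondecreasing_seq W by apply/nondecreasing_seqP.
have WV m k : W m <= V k.
  have [mk|/ltnW km] := leqP m k.
    apply: le_trans (Wnd _ _ mk) _; rewrite /W /V; have := h0 k; lra.
  apply: le_trans (Vni _ _ km); rewrite /W /V; have := h0 m; lra.
have Vc : cvgn V.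
  by apply: nonincreasing_is_cvgn => //; exists (W 0) => _ [k _ <-]; exact: WV.
have UE : U = V \- h by apply/funext => m; rewrite /V /= addrK.
have Ul : U @ \oo --> limn V.
  by rewrite UE -[limn V]subr0; apply: cvgB.
split; first by apply/cvg_ex; exists (limn V).
move=> m; rewrite (cvg_lim _ Ul)// ler_norml; apply/andP; split.
  rewrite lerBrDr addrC -/(h m) -/(W m).
  by apply: limr_ge => //; apply: nearW => k; exact: WV.
rewrite lerBlDr addrC -/(h m) -/(V m).
by apply: limr_le => //; exists m => // k /= mk; exact: Vni.
Qed.

End Picard.

Section LocalExistence.
Context {R : realType} {n : nat}.
Local Notation Rn := (n.-tuple (measurableTypeR R)).
Local Notation leb := (@lebesgue_space R n).
Context (alpha beta gamma eps : R).
Hypotheses (n0 : (0 < n)%N) (beta0 : 0 < beta) (eps0 : 0 <= eps) (ea : eps <= alpha).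
Local Notation sigma := (alpha * beta + gamma).
Local Notation delta := (alpha + sigma).
Hypotheses (sigma02 : 0 <= sigma < 2) (den : delta + eps < n%:R).
Implicit Types (x y z : Rn) (w : R -> R) (f : Rn -> R) (g u v : R -> Rn -> R)
  (a b t s M : R).

Local Notation hh v := (fun s => hardy_henon gamma beta (v s)).

Definition joint v :=
  measurable_fun setT (fun p : measurableTypeR R * Rn => v p.1 p.2).

Lemma joint_slice v t : joint v -> measurable_fun setT (v t).
Proof.
move=> jv; have mp : measurable_fun setT (fun x : Rn => ((t : measurableTypeR R), x)).
  exact: measurable_fun_pair.
exact: (measurableT_comp jv mp).
Qed.

Lemma joint_hardy_henon v : joint v -> joint (hh v).
Proof.
move=> jv; apply: measurable_funM => //; apply: measurable_funM.
  exact: (measurableT_comp (measurable_enorm_powR _)).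
apply: (measurableT_comp (measurable_powR _)).
exact: measurableT_comp.
Qed.

Lemma duhamel_hardy_henon0 a b t x :
  duhamel (hh (fun=> cst 0)) a b t x = 0.
Proof.
rewrite /duhamel (eq_Rintegral _ (g := cst 0)) => [|s _].
  by rewrite Rintegral_cst// mul0r.
rewrite /heat_conv hardy_henon0 (eq_Rintegral _ (g := cst 0)) => [|y _].
  by rewrite Rintegral_cst// mul0r.
by rewrite /= mulr0.
Qed.

Lemma le0_geometric (x B : R) : (forall m, x <= B * 2^-1 ^+ m) -> x <= 0.
Proof.
move=> xB; have hcvg : geometric B 2^-1 @ \oo --> (0 : R).
  by apply: cvg_geometric; rewrite ger0_norm ?invr_ge0// invf_lt1// ltr1n.
rewrite -(cvg_lim _ hcvg)//; apply: limr_ge; first by apply/cvg_ex; exists 0.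
by apply: nearW => m; exact: xB.
Qed.

(* The Picard iterates stay in the order interval [|u| <= 2 |x|^-alpha w(|x|)],
   where the map contracts with ratio 1/2; no norm is needed. *)
Lemma local_existence (A : R) : exists2 c, 0 < c &
  forall t0 tau g w M, 0 <= tau -> weight eps w -> 0 <= M ->
  (forall r, 0 < r -> w r <= M) -> joint g ->
  (forall t, t0 <= t <= t0 + tau -> dominated alpha w (g t)) ->
  c * M `^ beta * tau `^ (1 - sigma / 2) <= 1 ->
  exists u, [/\ joint u,
    forall t, t0 <= t <= t0 + tau -> dominated alpha (fun r => 6 * w r) (u t) &
    forall t x, t0 <= t <= t0 + tau -> u t x =
      if 0 < enorm x then g t x + A * duhamel (hh u) t0 t t x else 0].
Proof.
have [K K0 HK] := duhamel_lipschitz n0 beta0 eps0 ea sigma02 den.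
(* The factor 2 makes the contraction ratio 1/2; 6^beta covers the size of the iterates and of their
   limit, both below 6w; adding 1 keeps c positive when A = 0. *)
pose c := 2 * ((`|A| + 1) * (K * 6 `^ beta)).
have A0 : 0 < `|A| + 1 by have := normr_ge0 A; lra.
have c0 : 0 < c by rewrite /c mulr_gt0// mulr_gt0// mulr_gt0 ?powR_gt0.
exists c => // t0 tau g w M tau0 ww M0 wM jg gw cM.
have w0 r : 0 < r -> 0 <= w r by exact: (proj1 ww).
pose inb t := (t0 <= t <= t0 + tau).
(* Setting the iterates to 0 at the origin and outside the time interval makes them converge
   everywhere, so that the limit is jointly measurable. *)
pose step v t x := if (0 < enorm x) && (t0 <= t <= t0 + tau) then
  g t x + A * duhamel (hh v) t0 t t x else 0.
have jstep v : joint v -> joint (step v).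
  move=> jv; apply: measurable_fun_ifT => //.
  - apply: measurable_and.
      by apply: measurable_fun_ltr => //; exact: (measurableT_comp measurable_enorm).
    by apply: measurable_and; apply: measurable_fun_ler.
  - apply: measurable_funD => //; apply: measurable_funM => //.
    apply: measurable_duhamel_diag; exact: joint_hardy_henon.
have contr u v w' t x : joint u -> joint v ->
    (forall s, inb s -> dominated alpha (cst (6 * M)) (u s)) ->
    (forall s, inb s -> dominated alpha (cst (6 * M)) (v s)) ->
    weight eps w' -> (forall s, inb s -> dominated alpha w' (u s \- v s)) ->
    inb t -> 0 < enorm x ->
    `|A * duhamel (hh u) t0 t t x - A * duhamel (hh v) t0 t t x| <=
      2^-1 * (enorm x `^ (- alpha) * w' (enorm x)).
  move=> ju jv bu bv ww' uvw /andP[t1 t2] x0.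
  have inbs s : t0 <= s < t -> inb s by move=> /andP[s1 s2]; apply/andP; split; lra.
  have M60 : 0 <= 6 * M by rewrite mulr_ge0.
  rewrite -mulrBr normrM.
  have H := HK w' (6 * M) u v t0 t x ww' M60 t1 x0
    (fun s sb => conj (joint_slice s ju) (bu s (inbs s sb)))
    (fun s sb => conj (joint_slice s jv) (bv s (inbs s sb)))
    (fun s sb => uvw s (inbs s sb))
    (@joint_time_measurable R n _ _ _ _ _ (joint_hardy_henon ju))
    (@joint_time_measurable R n _ _ _ _ _ (joint_hardy_henon jv)).
  apply: le_trans (ler_wpM2l (normr_ge0 _) H) _.
  have W0 : 0 <= enorm x `^ (- alpha) * w' (enorm x).
    by rewrite mulr_ge0 ?powR_ge0// (proj1 ww').
  rewrite mulrA ler_wpM2r// powRM//.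
  have tt : (t - t0) `^ (1 - sigma / 2) <= tau `^ (1 - sigma / 2).
    by have /andP[? ?] := sigma02; rewrite ge0_ler_powR ?nnegrE//; lra.
  have h1 : 0 <= M `^ beta := powR_ge0 _ _.
  have h2 : 0 <= (t - t0) `^ (1 - sigma / 2) := powR_ge0 _ _.
  have h3 : 0 <= K * 6 `^ beta by rewrite mulr_ge0 ?powR_ge0// ltW.
  apply: (@le_trans _ _ (2^-1 * (c * M `^ beta * tau `^ (1 - sigma / 2)))); last first.
    by rewrite ler_piMr// invr_ge0.
  rewrite (_ : 2^-1 * _ = (`|A| + 1) * (K * 6 `^ beta * M `^ beta * tau `^ (1 - sigma / 2))); last first.
    by rewrite /c; field.
  apply: ler_pM => //; first by rewrite mulr_ge0// mulrA mulr_ge0.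
    by rewrite lerDl.
  by rewrite mulrA ler_wpM2l// mulr_ge0.
pose ui m := iter m step (fun=> cst 0).
have jui m : joint (ui m).
  elim: m => [|m IH]; last exact: jstep.
  exact: measurable_cst.
have le6 k f : 0 <= k <= 6 -> dominated alpha (fun r => k * w r) f ->
    dominated alpha (cst (6 * M)) f.
  move=> /andP[k0 k6]; apply: dominated_le => // r r0.
  by apply: ler_pM; rewrite ?w0 ?wM.
have k26 : 0 <= (2 : R) <= 6 by rewrite ler_nat andbT.
have ww2 : weight eps (fun r => 2 * w r) by apply: weightZ.
have dui m t : inb t -> dominated alpha (fun r => 2 * w r) (ui m t).
  elim: m t => [|m IH] t tb.
    apply: filterS (ae_enorm_gt0 n0) => x x0; rewrite normr0.
    by rewrite mulr_ge0 ?powR_ge0// mulr_ge0 ?w0.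
  apply: filterS2 (ae_enorm_gt0 n0) (gw t tb) => x x0 gx.
  rewrite /= /step x0/= -/(inb t) tb.
  have := @contr (ui m) (fun=> cst 0) (fun r => 2 * w r) t x (jui m) (jui 0%N)
    (fun s sb => le6 _ _ k26 (IH s sb)) _ ww2 _ tb x0.
  rewrite duhamel_hardy_henon0 mulr0 subr0 => H.
  (* The factor 2 reproduces itself: 2 = 1 + 2/2, the data plus half of the previous bound. *)
  rewrite (_ : _ * (2 * w _) = enorm x `^ (- alpha) * w (enorm x) +
    2^-1 * (enorm x `^ (- alpha) * (2 * w (enorm x)))); last by field.
  apply: le_trans (ler_normD _ _) _; apply: lerD => //; apply: H.
    by move=> s sb; apply: filterS (ae_enorm_gt0 n0) => y y0; rewrite normr0 mulr_ge0 ?powR_ge0// mulr_ge0.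
  by move=> s sb; apply: filterS (IH s sb) => y; rewrite /= subr0.
have half m : 0 <= (2^-1 : R) ^+ m by rewrite exprn_ge0// invr_ge0.
have wm m : weight eps (fun r => 2^-1 ^+ m * (2 * w r)) by apply: weightZ.
have dd m t : inb t ->
    dominated alpha (fun r => 2^-1 ^+ m * (2 * w r)) (ui m.+1 t \- ui m t).
  elim: m t => [|m IH] t tb.
    by apply: filterS (dui 1%N t tb) => x; rewrite /= subr0 expr0 mul1r.
  apply: filterS (ae_enorm_gt0 n0) => x x0.
  rewrite /= {1 3}/step x0/= -/(inb t) tb opprD addrACA subrr add0r.
  have := @contr (ui m.+1) (ui m) _ t x (jui _) (jui _)
    (fun s sb => le6 _ _ k26 (dui _ s sb)) (fun s sb => le6 _ _ k26 (dui _ s sb))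
    (wm m) IH tb x0.
  by move=> /le_trans; apply; rewrite exprS le_eqVlt; apply/orP; left; apply/eqP; ring.
(* The zero iterate is dropped: from the next one on, increments are differences of Duhamel terms,
   bounded at every x off the origin, whereas the first increment contains g, which is bounded only
   almost everywhere. *)
pose U m := ui m.+1.
have UE m t x : U m t x = if (0 < enorm x) && inb t then
   g t x + A * duhamel (hh (ui m)) t0 t t x else 0 by [].
have UU m t x : inb t -> 0 < enorm x ->
    `|U m.+1 t x - U m t x| <= enorm x `^ (- alpha) * w (enorm x) * 2^-1 ^+ m.
  move=> tb x0; rewrite !UE x0 tb/= opprD addrACA subrr add0r.
  have := @contr (ui m.+1) (ui m) _ t x (jui _) (jui _)
    (fun s sb => le6 _ _ k26 (dui _ s sb)) (fun s sb => le6 _ _ k26 (dui _ s sb))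
    (wm m) (dd m) tb x0.
  by move=> /le_trans; apply; rewrite le_eqVlt; apply/orP; left; apply/eqP; field.
pose u t x : R := limn (fun m => U m t x).
have Ucvg t x : (fun m => U m t x) @ \oo --> u t x.
  have [/andP[x0 tb]|xt] := boolP ((0 < enorm x) && inb t).
    by have [] := geometric_cvg (fun m => UU m t x tb x0).
  have E : (fun m => U m t x) = cst 0.
    by apply/funext => m; rewrite UE (negbTE xt).
  by rewrite /u E lim_cst//; exact: cvg_cst.
have uU m t x : inb t -> 0 < enorm x ->
    `|u t x - U m t x| <= 2 * (enorm x `^ (- alpha) * w (enorm x)) * 2^-1 ^+ m.
  by move=> tb x0; have [_] := geometric_cvg (fun m => UU m t x tb x0).
have ju : joint u.
  apply: (measurable_fun_cvg (h := fun m (p : measurableTypeR R * Rn) => U m p.1 p.2)).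
    by move=> m; exact: jui.
  by move=> p _; exact: Ucvg.
have du t : inb t -> dominated alpha (fun r => 6 * w r) (u t).
  move=> tb; apply: filterS2 (ae_enorm_gt0 n0) (dui 1%N t tb) => x x0 Ux.
  have H := uU 0%N t x tb x0; rewrite expr0 mulr1 in H.
  rewrite -[u t x](subrK (U 0%N t x)); apply: le_trans (ler_normD _ _) _.
  have W0 : 0 <= enorm x `^ (- alpha) * w (enorm x) by rewrite mulr_ge0 ?powR_ge0 ?w0.
  apply: le_trans (lerD H Ux) _; rewrite !(mulrCA (enorm x `^ _)).
  by rewrite -mulrDl ler_wpM2r//; lra.
exists u; split => // t x tb_; have tb : inb t := tb_; case: ifPn => [x0|x0]; last first.
  rewrite /u (_ : (fun m => U m t x) = cst 0) ?lim_cst//.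
  by apply/funext => m; rewrite UE (negbTE x0).
apply/eqP; rewrite -subr_eq0 -normr_le0.
set W := enorm x `^ (- alpha) * w (enorm x).
apply: (@le0_geometric _ (2 * W)) => m.
have w4 : weight eps (fun r => 4 * (2^-1 ^+ m.+1 * w r)) by apply: weightZ => //; apply: weightZ.
have duU s : inb s -> dominated alpha (fun r => 4 * (2^-1 ^+ m.+1 * w r)) (u s \- U m s).
  move=> sb; apply: filterS (ae_enorm_gt0 n0) => y y0.
  apply: le_trans (uU m s y sb y0) _.
  by rewrite exprS le_eqVlt; apply/orP; left; apply/eqP; field.
have k66 : 0 <= (6 : R) <= 6 by rewrite lexx andbT.
have H := @contr u (U m) _ t x ju (jui _)
  (fun s sb => le6 _ _ k66 (du s sb)) (fun s sb => le6 _ _ k26 (dui _ s sb)) w4 duU tb x0.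
have H' := uU m.+1 t x tb x0.
rewrite UE x0 tb/= -/(U m) in H'.
rewrite -/W in H H'.
(* The defect of u is compared with the next iterate: both the distance to it and the contracted
   distance to the current one decay geometrically. *)
have -> : u t x - (g t x + A * duhamel (hh u) t0 t t x) =
  (u t x - (g t x + A * duhamel (hh (U m)) t0 t t x)) -
  (A * duhamel (hh u) t0 t t x - A * duhamel (hh (U m)) t0 t t x) by ring.
apply: le_trans (ler_normB _ _) _; apply: le_trans (lerD H' H) _.
by rewrite /W !exprS le_eqVlt; apply/orP; left; apply/eqP; field.
Qed.

End LocalExistence.

(** * Continuity in the Herz space *)

Section HerzContinuity.
Context {R : realType} {n : nat}.
Local Notation Rn := (n.-tuple (measurableTypeR R)).
Local Notation leb := (@lebesgue_space R n).
Context (alpha eps : R) (q : \bar R).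
Hypotheses (n0 : (0 < n)%N) (eps0 : 0 <= eps) (ea : eps <= alpha) (q1 : (1 <= q)%E).
Implicit Types (x y z : Rn) (w : R -> R) (f g : Rn -> R) (u v : R -> Rn -> R)
  (a b t s M theta : R) (D : set R).

Let alpha0 : 0 <= alpha. Proof. exact: le_trans ea. Qed.

Lemma herz_normN f g :
  herz_norm +oo%E alpha q (f \- g) = herz_norm +oo%E alpha q (g \- f).
Proof.
rewrite !herz_normE//; congr lnorm; apply/funext => k; congr (_ * _)%E.
rewrite -[LHS]oppe_Lnorm; apply: eq_Lnorm => x /=.
by rewrite -mulNr opprB.
Qed.

(** The linear part of the modulus accommodates the heat term, the power theta the Duhamel term. *)
Lemma herz_continuous_modulus D v w theta : weight eps w -> (wnorm q w < +oo)%E ->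
  0 < theta -> (forall t, D t -> herz +oo%E alpha q (v t)) ->
  (forall t, D t -> exists2 c, 0 <= c & \forall s \near within D (nbhs t),
     dominated alpha (fun r => c * (`|s - t| + `|s - t| `^ theta) * w r)
       (v s \- v t)) ->
  herz_continuous +oo%E alpha q D v.
Proof.
move=> ww wq theta0 hv mv t Dt; split; first exact: hv.
have [c c0 Hc] := mv t Dt.
have W0 := wnorm_ge0 q ww.
have Wf : wnorm q w \is a fin_num by rewrite ge0_fin_numE.
pose N : R := c * (2 `^ alpha * (1 + 2 `^ eps)) * fine (wnorm q w).
have N0 : 0 <= N.
  by rewrite !mulr_ge0 ?powR_ge0 ?addr_ge0 ?powR_ge0 ?fine_ge0.
have bound : \forall s \near within D (nbhs t),
    (herz_norm +oo%E alpha q (v s \- v t)%R <=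
      (N * (`|s - t| + `|s - t| `^ theta))%:E)%E.
  apply: filterS Hc => s Hs.
  have k0 : 0 <= c * (`|s - t| + `|s - t| `^ theta).
    by rewrite mulr_ge0// addr_ge0 ?powR_ge0.
  apply: le_trans (herz_norm_le q1 alpha0 eps0 k0 ww Hs) _.
  rewrite -(fineK Wf) -EFinM lee_fin le_eqVlt; apply/orP; left; apply/eqP.
  by rewrite /N; ring.
have lim0 : (N * (`|s - t| + `|s - t| `^ theta)) @[s --> within D (nbhs t)] --> (0 : R).
  apply: cvg_within_filter.
  have c1 : `|s - t| @[s --> t] --> (0 : R).
    rewrite -[X in _ --> X](normr0 R) -[X in `|X|](subrr t).
    by apply: cvg_norm; apply: cvgB; [exact: cvg_id|exact: cvg_cst].
  have c2 : `|s - t| `^ theta @[s --> t] --> (0 : R).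
    apply/cvgrPdist_lt => e e0.
    have d0 : 0 < e `^ theta^-1 by rewrite powR_gt0.
    near=> s; rewrite sub0r normrN ger0_norm ?powR_ge0//.
    have st : `|s - t| < e `^ theta^-1.
      by rewrite distrC; near: s; exact: cvgr_dist_lt.
    have := gt0_ltr_powR theta0 _ _ st; rewrite -powRrM mulVf ?gt_eqF// powRr1 ?(ltW e0)//.
    by apply; rewrite nnegrE ?powR_ge0.
  have cN : (fun=> N) @ nbhs t --> N by exact: cvg_cst.
  have := cvgM cN (cvgD c1 c2).
  by rewrite addr0 mulr0; exact.
have lim0E : (N * (`|s - t| + `|s - t| `^ theta))%:E @[s --> within D (nbhs t)] --> 0%E.
  by apply: cvg_EFin => //; exact: nearW.
apply: squeeze_cvge lim0E; last exact: cvg_cst.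
by apply: filterS bound => s ->; rewrite herz_norm_ge0.
Unshelve. all: by end_near. Qed.

Lemma herz_continuousD D u v : (forall t, D t -> herz +oo%E alpha q (u t \+ v t)) ->
  herz_continuous +oo%E alpha q D u -> herz_continuous +oo%E alpha q D v ->
  herz_continuous +oo%E alpha q D (fun t => u t \+ v t).
Proof.
move=> huv cu cv t Dt; split; first exact: huv.
have [_ {}cu] := cu t Dt; have [_ {}cv] := cv t Dt.
pose Du s := herz_norm +oo%E alpha q (u s \- u t).
pose Dv s := herz_norm +oo%E alpha q (v s \- v t).
apply: (@squeeze_cvge _ _ _ _ (cst 0%E) _ (fun s => 4%:E * (Du s + Dv s))%E).
- apply: nearW => s; rewrite herz_norm_ge0//=.
  apply: le_trans (herz_normD alpha _ _ q1).
  rewrite le_eqVlt; apply/orP; left; apply/eqP; congr herz_norm.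
  by apply/funext => x /=; ring.
- exact: cvg_cst.
- have h : (Du s + Dv s)%E @[s --> within D (nbhs t)] --> (0 + 0)%E.
    by apply: cvgeD => //.
  have f4 : 4%:E \is a @fin_num R by [].
  have := cvgeZl f4 h.
  by rewrite adde0 mule0; exact.
Qed.

Lemma herz_continuousN D u v : (forall t, D t -> herz +oo%E alpha q (v t)) ->
  (forall t x, v t x = - u t x) ->
  herz_continuous +oo%E alpha q D u -> herz_continuous +oo%E alpha q D v.
Proof.
move=> hv vu cu t Dt; split; first exact: hv.
have [_ {}cu] := cu t Dt.
suff -> : (fun s => herz_norm +oo%E alpha q (v s \- v t)) =
   fun s => herz_norm +oo%E alpha q (u s \- u t) by [].
apply/funext => s; rewrite [RHS]herz_normN; congr herz_norm.
by apply/funext => x /=; rewrite !vu; ring.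
Qed.

End HerzContinuity.

(** * Exact solutions and their regularity in time *)

Section ExactSolution.
Context {R : realType} {n : nat}.
Local Notation Rn := (n.-tuple (measurableTypeR R)).
Local Notation leb := (@lebesgue_space R n).
Local Notation mu := (@lebesgue_measure R).
Context (alpha beta gamma eps A : R) (q : \bar R).
Hypotheses (n0 : (0 < n)%N) (beta0 : 0 < beta) (eps0 : 0 <= eps) (ea : eps <= alpha).
Local Notation sigma := (alpha * beta + gamma).
Local Notation delta := (alpha + sigma).
Hypotheses (sigma02 : 0 <= sigma < 2) (den : delta + eps < n%:R) (q1 : (1 <= q)%E).
Implicit Types (x y z : Rn) (w : R -> R) (f : Rn -> R) (g u v : R -> Rn -> R)
  (a b t s M T : R).

Local Notation hh v := (fun s => hardy_henon gamma beta (v s)).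

Let alpha0 : 0 <= alpha. Proof. exact: le_trans ea. Qed.
Let aen : alpha + eps < n%:R.
Proof. by have /andP[? _] := sigma02; have := den; rewrite -addrA; lra. Qed.
Let ea0 : eps <= alpha - 0. Proof. by rewrite subr0. Qed.

Lemma joint_heat f : measurable_fun setT f -> joint (fun t => heat t f).
Proof.
move=> mf; apply: measurable_fun_ifT.
- exact: measurable_fun_eqr.
- exact: (measurableT_comp mf).
- exact: measurable_heat_conv.
Qed.

Lemma heat_stable : exists2 C, 1 <= C & forall w f, weight eps w ->
  measurable_fun setT f -> dominated alpha w f ->
  (forall t x, 0 < t -> 0 < enorm x ->
     leb.-integrable setT (fun y => (heat_kernel t (vsub x y) * f y)%:E) /\
     `|heat t f x| <= C * (enorm x `^ (- alpha) * w (enorm x))) /\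
  (forall t, 0 <= t -> dominated alpha (fun r => C * w r) (heat t f)).
Proof.
have [C C0 H] := @heat_bound R n eps alpha 0 eps0 (lexx 0) ea0 aen.
(* A constant of at least 1 covers t = 0, where the heat operator is the identity. *)
exists (C + 1); first by rewrite lerDr ltW.
move=> w f ww mf fw.
have H1 t x : 0 < t -> 0 < enorm x ->
     leb.-integrable setT (fun y => (heat_kernel t (vsub x y) * f y)%:E) /\
     `|heat t f x| <= (C + 1) * (enorm x `^ (- alpha) * w (enorm x)).
  move=> t0 x0; have [I HC] := H w f t x ww mf fw t0 x0; split=> //.
  apply: le_trans HC _; rewrite mul0r oppr0 powRr0 mulr1 addr0.
  by rewrite ler_wpM2r ?lerDl// mulr_ge0 ?powR_ge0// (proj1 ww).
split=> // t; rewrite le_eqVlt => /predU1P[<-|t0].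
  rewrite heat0; apply: dominated_le fw => // r r0.
  by rewrite ler_peMl ?(proj1 ww)// lerDr ltW.
apply: filterS (ae_enorm_gt0 n0) => x x0; rewrite mulrCA.
exact: (proj2 (H1 t x t0 x0)).
Qed.

(** The earlier of the two times is at least t/2, which fixes the denominator of the Hoelder bound
    with exponent 1. *)
Lemma heat_modulus : exists2 C, 0 < C & forall w f s t x, weight eps w ->
  measurable_fun setT f -> dominated alpha w f -> 0 < t -> t / 2 <= s ->
  0 < enorm x ->
  `|heat s f x - heat t f x| <= C / t * `|s - t| * (enorm x `^ (- alpha) * w (enorm x)).
Proof.
have one01 : 0 <= (1 : R) <= 1 by rewrite ler01 lexx.
have [C C0 H] := @heat_hoelder R n eps alpha 0 1 eps0 (lexx 0) ea0 aen one01.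
exists (2 * C); first by rewrite mulr_gt0.
move=> w f s t x ww mf fw t0 ts x0; have s0 : 0 < s by lra.
have W0 : 0 <= enorm x `^ (- alpha) * w (enorm x).
  by rewrite mulr_ge0 ?powR_ge0// (proj1 ww).
have si : s^-1 <= 2 / t by rewrite -[2 / t]invf_div lef_pV2 ?posrE// divr_gt0.
have ti : t^-1 <= 2 / t by rewrite ler_peMl ?invr_ge0 ?ler1n// ltW.
have [st|/ltW st] := leP s t.
  rewrite distrC [`|s - t|]distrC [`|t - s|]ger0_norm ?subr_ge0//.
  apply: le_trans (H w f s t x ww mf fw s0 st x0) _.
  rewrite mul0r oppr0 powRr0 mulr1 addr0 powRr1; last first.
    by rewrite mulr_ge0 ?subr_ge0 ?invr_ge0// ltW.
  rewrite ler_wpM2r// (_ : 2 * C / t * _ = C * ((t - s) * (2 / t))); last by ring.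
  by rewrite ler_pM2l// ler_wpM2l ?subr_ge0.
rewrite [`|s - t|]ger0_norm ?subr_ge0//.
apply: le_trans (H w f t s x ww mf fw t0 st x0) _.
rewrite mul0r oppr0 powRr0 mulr1 addr0 powRr1; last first.
  by rewrite mulr_ge0 ?subr_ge0 ?invr_ge0// ltW.
rewrite ler_wpM2r// (_ : 2 * C / t * _ = C * ((s - t) * (2 / t))); last by ring.
by rewrite ler_pM2l// ler_wpM2l ?subr_ge0.
Qed.

(** A canonical representative: one weight for all times, and the equation at every point off the
    origin instead of almost everywhere, with the value 0 at the origin. This makes solutions easy
    to glue in time. *)
Definition exact_solution f T u := [/\ joint u,
  exists w, [/\ weight eps w, (wnorm q w < +oo)%E &
    forall t, 0 <= t <= T -> dominated alpha w (u t)] &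
  forall t x, 0 <= t <= T -> u t x =
    if 0 < enorm x then heat t f x + A * duhamel (hh u) 0 t t x else 0].

Lemma wnormZ w (k : R) : 0 <= k -> weight eps w -> (wnorm q w < +oo)%E ->
  (wnorm q (fun r => (k * w r)%R) < +oo)%E.
Proof.
move=> k0 ww wq.
apply: (le_lt_trans (@lnormZ _ q (fun j => (w (dyadic j))%:E) k q1 k0 _)).
  by move=> j; rewrite lee_fin; exact: (proj1 ww _ (dyadic_gt0 j)).
by rewrite lte_mul_pinfty.
Qed.

Lemma exact_source f T u : exact_solution f T u ->
  exists w, [/\ weight eps w, (wnorm q w < +oo)%E &
    forall a b, 0 <= a -> b <= T -> source delta w (hh u) a b].
Proof.
move=> [ju [w [ww wq uw]] _]; have [M M0 wM] := weight_bounded q1 eps0 ww wq.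
have [L L1 HL] := @hardy_henon_bound R n alpha beta gamma n0 beta0.
have k0 : 0 <= L * M `^ beta by rewrite mulr_ge0 ?powR_ge0// (le_trans ler01).
exists (fun r => L * M `^ beta * w r); split; [exact: weightZ|exact: wnormZ|].
move=> a b a0 bT s /andP[s1 s2]; split.
  by apply: measurable_hardy_henon; exact: joint_slice.
have sT : 0 <= s <= T by apply/andP; split; lra.
by apply: HL => //; [apply: dominated_le (uw s sT) => //|exact: uw].
Qed.

(* The statement integrates over the closed interval and uses the special value
   of [heat] at time [0]. *)
Lemma Rintegral_duhamel F t x :
  mu.-integrable `[0, t[ (EFin \o (fun s => heat_conv (t - s) (F s) x)) ->
  \int[mu]_(s in `[0, t]) heat (t - s) (F s) x = duhamel F 0 t t x :> R.
Proof.
move=> ic.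
have E : {in `[0, t[%classic, forall s : R, heat (t - s) (F s : Rn -> R) x = heat_conv (t - s) (F s) x}.
  move=> s; rewrite inE/= in_itv/= => /andP[s1 s2].
  by rewrite heat_conv_heat ?subr_gt0.
rewrite -Rintegral_itv_bndo_bndc; first exact: eq_Rintegral.
by apply: eq_integrable ic => // s st; rewrite /= E.
Qed.

Lemma exact_mild f T u : exact_solution f T u -> mild_solution A gamma beta f T u.
Proof.
move=> eu; have [ju _ uE] := eu; have [w [ww wq sw]] := exact_source eu.
have ed : eps <= delta - sigma by rewrite addrK.
have [K K0 HK] := @duhamel_le R n eps delta sigma eps0 sigma02 ed den.
move=> t /[dup] tT /andP[t0 t1]; apply: filterS (ae_enorm_gt0 n0) => x x0.
rewrite uE// x0 Rintegral_duhamel//.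
have mt : time_measurable (hh u) 0 t t x.
  by apply: joint_time_measurable; exact: joint_hardy_henon.
have [H _] := HK w (hh u) 0 t t x ww (sw 0 t (lexx 0) t1) t0 (lexx t) x0 mt.
exact: H.
Qed.

Local Notation theta := ((1 - sigma / 2) / 2).
Let theta0 : 0 < theta. Proof. by have /andP[? ?] := sigma02; lra. Qed.

Lemma exact_duhamel_modulus f T u : 0 <= T -> exact_solution f T u ->
  exists w, [/\ weight eps w, (wnorm q w < +oo)%E &
    forall s t x, 0 <= s <= T -> 0 <= t <= T -> 0 < enorm x ->
      `|duhamel (hh u) 0 s s x - duhamel (hh u) 0 t t x| <=
        `|s - t| `^ theta * (enorm x `^ (- alpha) * w (enorm x))].
Proof.
move=> T0 eu; have [ju _ _] := eu; have [w [ww wq sw]] := exact_source eu.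
have ed : eps <= delta - sigma by rewrite addrK.
have [K K0 HK] := @duhamel_hoelder R n eps delta sigma eps0 sigma02 ed den.
have k0 : 0 <= K * T `^ theta by rewrite mulr_ge0 ?powR_ge0// ltW.
exists (fun r => K * T `^ theta * w r); split; [exact: weightZ|exact: wnormZ|].
have main s t x : 0 <= s -> s <= t -> t <= T -> 0 < enorm x ->
   `|duhamel (hh u) 0 t t x - duhamel (hh u) 0 s s x| <=
        (t - s) `^ theta * (enorm x `^ (- alpha) * (K * T `^ theta * w (enorm x))).
  move=> s0 st tT x0.
  have mt r : time_measurable (hh u) 0 r r x.
    by apply: joint_time_measurable; exact: joint_hardy_henon.
  have := HK w (hh u) 0 s t x ww (sw 0 t (lexx 0) tT) s0 st x0 (mt s) (mt t).
  rewrite addrK subr0 => /le_trans; apply.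
  have W0 : 0 <= enorm x `^ (- alpha) * w (enorm x).
    by rewrite mulr_ge0 ?powR_ge0// (proj1 ww).
  rewrite (_ : _ * (_ * (K * T `^ theta * _)) = K * (t - s) `^ theta * T `^ theta *
    (enorm x `^ (- alpha) * w (enorm x))); last by ring.
  rewrite ler_wpM2r// ler_wpM2l ?mulr_ge0 ?powR_ge0 ?(ltW K0)//.
  by rewrite ge0_ler_powR ?nnegrE ?(ltW theta0)//; lra.
move=> s t x /andP[s0 sT] /andP[t0 tT] x0.
have [st|/ltW st] := leP s t.
  by rewrite distrC [`|s - t|]distrC [`|t - s|]ger0_norm ?subr_ge0//; exact: main.
by rewrite [`|s - t|]ger0_norm ?subr_ge0//; exact: main.
Qed.

End ExactSolution.

(** * Exact solutions belong to the solution class *)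

Section ExactClass.
Context {R : realType} {n : nat}.
Local Notation Rn := (n.-tuple (measurableTypeR R)).
Local Notation leb := (@lebesgue_space R n).
Context (alpha beta gamma eps A : R) (q : \bar R).
Hypotheses (n0 : (0 < n)%N) (beta0 : 0 < beta) (eps0 : 0 < eps) (ea : eps <= alpha).
Local Notation sigma := (alpha * beta + gamma).
Local Notation delta := (alpha + sigma).
Hypotheses (sigma02 : 0 <= sigma < 2) (den : delta + eps < n%:R) (q1 : (1 <= q)%E).
Implicit Types (x y z : Rn) (w : R -> R) (f g : Rn -> R) (u v : R -> Rn -> R)
  (a b t s M T : R).

Local Notation hh v := (fun s => hardy_henon gamma beta (v s)).
Local Notation exact_solution f T u :=
  (@exact_solution R n alpha beta gamma eps A q f T u).
Local Notation herz_cont := (@herz_continuous R n +oo%E alpha q).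

Let eps0' : 0 <= eps := ltW eps0.
Let alpha0 : 0 <= alpha. Proof. exact: le_trans ea. Qed.

Lemma herz_data f : herz +oo%E alpha q f -> measurable_fun setT f /\
  exists w, [/\ weight eps w, (wnorm q w < +oo)%E & dominated alpha w f].
Proof.
move=> [[mf _] fq]; split=> //.
have [C C0 HC] := @herz_weight R n n0 alpha eps q q1 alpha0 eps0.
have ff : herz_norm +oo%E alpha q f \is a fin_num.
  by rewrite ge0_fin_numE// herz_norm_ge0.
have f0 : 0 <= fine (herz_norm +oo%E alpha q f) by rewrite fine_ge0// herz_norm_ge0.
have [|w [ww fw wq _]] := HC f _ f0; first by rewrite fineK.
by exists w.
Qed.

Lemma herzB f g : herz +oo%E alpha q f -> herz +oo%E alpha q g ->
  herz +oo%E alpha q (f \- g).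
Proof.
move=> /herz_data[mf [w [ww wq fw]]] /herz_data[mg [v [vv vq gv]]].
apply: (herz_dominated n0 q1 alpha0 eps0' (weightD ww vv) (wnormD q1 ww vv wq vq)).
  exact: measurable_funB.
apply: filterS2 fw gv => x fx gx.
by apply: le_trans (ler_normB _ _) _; rewrite mulrDr lerD.
Qed.

Lemma heat_herz f t : herz +oo%E alpha q f -> 0 <= t ->
  herz +oo%E alpha q (heat t f).
Proof.
move=> hf t0; have [mf [w [ww wq fw]]] := herz_data hf.
have [C C1 HC] := heat_stable n0 eps0' ea sigma02 den.
have C0 : 0 <= C by exact: le_trans C1.
apply: (herz_dominated n0 q1 alpha0 eps0' (weightZ C0 ww)).
- exact: (wnormZ q1 C0 ww).
- exact: (joint_slice t (joint_heat mf)).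
- exact: (proj2 (HC w f ww mf fw)).
Qed.

Lemma exact_herz f T u t : exact_solution f T u -> 0 <= t <= T ->
  herz +oo%E alpha q (u t).
Proof.
move=> [ju [w [ww wq uw]] _] tT.
by apply: (herz_dominated n0 q1 alpha0 eps0' ww wq); [exact: joint_slice|exact: uw].
Qed.

(** Subtracting the heat flow leaves the Duhamel term, whose modulus of continuity is uniform down
    to time 0. *)
Lemma exact_continuous_duhamel f T u : herz +oo%E alpha q f -> 0 <= T ->
  exact_solution f T u -> herz_cont `[0, T] (fun t => u t \- heat t f).
Proof.
move=> hf T0 eu; have [mf [w0 [ww0 wq0 fw0]]] := herz_data hf.
have [ju [wu [wwu wqu uw]] uE] := eu.
have [w [ww wq mod]] := exact_duhamel_modulus n0 beta0 eps0' ea sigma02 den q1 T0 eu.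
have th0 : 0 < (1 - sigma / 2) / 2 by have /andP[? ?] := sigma02; lra.
apply: (herz_continuous_modulus eps0' ea q1 ww wq th0).
  move=> t /=; rewrite in_itv/= => /[dup] tT /andP[t0 _].
  by apply: herzB; [exact: exact_herz eu tT|exact: heat_herz].
move=> t /=; rewrite in_itv/= => tT; exists `|A| => //.
rewrite near_withinE; near=> s; rewrite /= in_itv/= => sT.
apply: filterS (ae_enorm_gt0 n0) => x x0 /=.
rewrite !uE// x0; set h1 := heat s f x; set h2 := heat t f x.
set d1 := duhamel _ 0 s s x; set d2 := duhamel _ 0 t t x.
rewrite (_ : _ - _ = A * (d1 - d2)); last by ring.
rewrite normrM.
apply: le_trans (ler_wpM2l (normr_ge0 _) (mod s t x sT tT x0)) _.
rewrite [leRHS](_ : _ = `|A| * ((`|s - t| + `|s - t| `^ ((1 - sigma / 2) / 2)) *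
  (enorm x `^ (- alpha) * w (enorm x)))); last by ring.
rewrite ler_wpM2l// ler_wpM2r ?lerDr// mulr_ge0 ?powR_ge0//.
exact: (proj1 ww).
Unshelve. all: by end_near. Qed.

(** The heat term contributes a modulus C/t, which degenerates at 0; hence continuity on ]0, T]
    only. *)
Lemma exact_class f T u : herz +oo%E alpha q f -> 0 <= T ->
  exact_solution f T u -> herz_class +oo%E alpha q T u.
Proof.
move=> hf T0 eu; have [mf [w0 [ww0 wq0 fw0]]] := herz_data hf.
have [ju [wu [wwu wqu uw]] uE] := eu.
split; first by move=> t; exact: exact_herz eu.
  have Wf : wnorm q wu \is a fin_num by rewrite ge0_fin_numE// (wnorm_ge0 q wwu).
  exists (1 * (2 `^ alpha * (1 + 2 `^ eps)) * fine (wnorm q wu)) => t tT.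
  rewrite EFinM fineK//; apply: herz_norm_le => //.
  by apply: dominated_le (uw t tT) => // r _; rewrite mul1r.
have [C C0 HC] := heat_modulus eps0' ea sigma02 den.
have [w [ww wq mod]] := exact_duhamel_modulus n0 beta0 eps0' ea sigma02 den q1 T0 eu.
have th0 : 0 < (1 - sigma / 2) / 2 by have /andP[? ?] := sigma02; lra.
apply: (herz_continuous_modulus eps0' ea q1 (weightD ww0 ww)
  (wnormD q1 ww0 ww wq0 wq) th0).
  move=> t /=; rewrite in_itv/= => /andP[t0 tT].
  by apply: (exact_herz eu); rewrite ltW.
move=> t /=; rewrite in_itv/= => /andP[t0 tT].
have Ct0 : 0 <= C / t by rewrite divr_ge0// ltW.
exists (C / t + `|A|); first by rewrite addr_ge0.
have ht : t / 2 < t by lra.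
rewrite near_withinE; near=> s; rewrite /= in_itv/= => /andP[s0 sT].
have st : t / 2 <= s by rewrite ltW//; near: s; exact: lt_nbhsr.
apply: filterS (ae_enorm_gt0 n0) => x x0 /=.
have sT' : 0 <= s <= T by rewrite ltW.
have tT' : 0 <= t <= T by rewrite ltW.
rewrite !uE// x0 opprD addrACA -mulrBr.
have H1 := HC w0 f s t x ww0 mf fw0 t0 st x0.
have H2 := ler_wpM2l (normr_ge0 A) (mod s t x sT' tT' x0).
apply: le_trans (ler_normD _ _) _; rewrite normrM.
apply: le_trans (lerD H1 H2) _.
have p0 : 0 <= enorm x `^ (- alpha) * w0 (enorm x).
  by rewrite mulr_ge0 ?powR_ge0//; exact: (proj1 ww0).
have p1 : 0 <= enorm x `^ (- alpha) * w (enorm x).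
  by rewrite mulr_ge0 ?powR_ge0//; exact: (proj1 ww).
have h0 : 0 <= `|s - t| `^ ((1 - sigma / 2) / 2) by exact: powR_ge0.
have h1 : 0 <= `|s - t| by [].
have A0 := normr_ge0 A.
rewrite [leRHS](_ : _ = (C / t + `|A|) * (`|s - t| + `|s - t| `^ ((1 - sigma / 2) / 2)) *
  (enorm x `^ (- alpha) * w0 (enorm x)) +
  (C / t + `|A|) * (`|s - t| + `|s - t| `^ ((1 - sigma / 2) / 2)) *
  (enorm x `^ (- alpha) * w (enorm x))); last by ring.
rewrite [X in _ + X <= _]mulrA.
by apply: lerD; rewrite ler_wpM2r//; apply: ler_pM => //; rewrite ?lerDl ?lerDr.
Unshelve. all: by end_near. Qed.

(** The solution and the heat flow differ by a continuous function, so any failure at time 0 is that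
    of the linear equation. *)
Lemma exact_continuity_iff f T u : herz +oo%E alpha q f -> 0 <= T ->
  exact_solution f T u ->
  herz_cont `[0, T] u <-> herz_cont `[0, T] (fun t => heat t f).
Proof.
move=> hf T0 eu; have cd := exact_continuous_duhamel hf T0 eu.
have hu t : `[0, T]%classic t -> herz +oo%E alpha q (u t).
  by rewrite /= in_itv/= => tT; exact: exact_herz eu tT.
have hh t : `[0, T]%classic t -> herz +oo%E alpha q (heat t f).
  by rewrite /= in_itv/= => /andP[t0 _]; exact: heat_herz.
split=> [cu|ch].
- have cN : herz_cont `[0, T] (fun t => heat t f \- u t).
    apply: (herz_continuousN (v := fun t => heat t f \- u t) q1 _ _ cd).
      by move=> t tT; apply: herzB; [exact: hh|exact: hu].
    by move=> t x; rewrite /= opprB.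
  have E : (fun t => (heat t f \- u t) \+ u t) = (fun t => heat t f).
    by apply/funext => t; apply/funext => x /=; rewrite subrK.
  rewrite -E; apply: (herz_continuousD q1) => // t tT.
  rewrite [X in herz _ _ _ X](_ : _ = heat t f); first exact: hh.
  by apply/funext => x /=; rewrite subrK.
- have E : (fun t => (u t \- heat t f) \+ heat t f) = u.
    by apply/funext => t; apply/funext => x /=; rewrite subrK.
  rewrite -E; apply: (herz_continuousD q1) => // t tT.
  rewrite [X in herz _ _ _ X](_ : _ = u t); first exact: hu.
  by apply/funext => x /=; rewrite subrK.
Qed.

End ExactClass.

(** * Uniqueness *)

Section SolutionClass.
Context {R : realType} {n : nat}.
Local Notation Rn := (n.-tuple (measurableTypeR R)).
Local Notation leb := (@lebesgue_space R n).
Local Notation mu := (@lebesgue_measure R).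
Context (alpha beta gamma eps A : R) (q : \bar R).
Hypotheses (n0 : (0 < n)%N) (beta0 : 0 < beta) (eps0 : 0 <= eps) (ea : eps <= alpha).
Local Notation sigma := (alpha * beta + gamma).
Local Notation delta := (alpha + sigma).
Hypotheses (sigma02 : 0 <= sigma < 2) (den : delta + eps < n%:R) (q1 : (1 <= q)%E).
Implicit Types (x y z : Rn) (w : R -> R) (f g : Rn -> R) (u v : R -> Rn -> R)
  (a b t s M T : R).

Local Notation hh v := (fun s => hardy_henon gamma beta (v s)).

Let alpha0 : 0 <= alpha. Proof. exact: le_trans ea. Qed.
Let ed : eps <= delta - sigma. Proof. by rewrite addrK. Qed.

Lemma class_bounded T u : herz_class +oo%E alpha q T u ->
  exists2 M, 0 <= M & forall t, 0 <= t <= T ->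
    measurable_fun setT (u t) /\ dominated alpha (cst M) (u t).
Proof.
move=> [hu [M uM] _]; exists `|M| => // t tT; split; first by have [[]] := hu t tT.
apply: (herz_norm_weak n0 q1) => //; apply: le_trans (uM t tT) _.
by rewrite lee_fin ler_norm.
Qed.

(** Both the kernel and the source move with s. The kernel is regular since t - s stays away from 0,
    and the source depends on [u s] in a Lipschitz way in the weak norm. This is what gives
    measurability in time to a solution not known to be jointly measurable. *)
Lemma class_continuous_conv T u t s x : herz_class +oo%E alpha q T u ->
  0 < s -> s < t -> t <= T -> 0 < enorm x ->
  {for s, continuous (fun s => heat_conv (t - s) (hardy_henon gamma beta (u s)) x : R)}.
Proof.
move=> cu s0 st tT x0; have [M M0 bu] := class_bounded cu.
have [_ _ /(_ s)] := cu; rewrite /= in_itv/= s0 (le_trans (ltW st) tT) => /(_ isT)[_ us].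
have /andP[sigma0 sigma2] := sigma02.
have [L L1 HL] := @hardy_henon_lipschitz R n alpha beta gamma n0 beta0.
have [L' L'1 HL'] := @hardy_henon_bound R n alpha beta gamma n0 beta0.
have [C C0 HC] := @heat_bound R n eps delta sigma eps0 sigma0 ed den.
have one01 : 0 <= (1 : R) <= 1 by rewrite ler01 lexx.
have [C' C'0 HC'] := @heat_hoelder R n eps delta sigma 1 eps0 sigma0 ed den one01.
have L0 : 0 <= L * M `^ beta by rewrite mulr_ge0 ?powR_ge0// (le_trans ler01).
have L'0 : 0 <= L' * M `^ beta by rewrite mulr_ge0 ?powR_ge0// (le_trans ler01).
pose wM := fun r : R => L' * M `^ beta * (cst M : R -> R) r.
have ww : weight eps wM by apply: weightZ => //; exact: weight_cst.
have src r : 0 <= r <= T -> measurable_fun setT (hardy_henon gamma beta (u r)) /\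
    dominated delta wM (hardy_henon gamma beta (u r)).
  move=> rT; have [mr dr] := bu r rT; split; first exact: measurable_hardy_henon.
  exact: HL'.
have sT : 0 <= s <= T by apply/andP; split; lra.
pose r0 := t - s; have r00 : 0 < r0 by rewrite subr_gt0.
have r02 : 0 < r0 / 2 by rewrite divr_gt0.
pose W := enorm x `^ (- alpha).
have W0 : 0 <= W by exact: powR_ge0.
pose P := (r0 / 2) `^ (- (sigma / 2)).
have P0 : 0 <= P by exact: powR_ge0.
have Pr r : r0 / 2 <= r -> r `^ (- (sigma / 2)) <= P.
  move=> rr; have rp := lt_le_trans r02 rr.
  rewrite /P !powRN lef_pV2 ?posrE ?powR_gt0//.
  have sg2 : 0 <= sigma / 2 by rewrite divr_ge0.
  by apply: ge0_ler_powR; rewrite ?nnegrE ?(ltW r02) ?(ltW rp).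
pose K1 := C' * (2 / r0) * P * (W * (L' * M `^ beta * M)).
pose K2 := C * P * (W * (L * M `^ beta)).
have K10 : 0 <= K1.
  apply: mulr_ge0 (mulr_ge0 W0 (mulr_ge0 L'0 M0)); apply: mulr_ge0 P0.
  by apply: mulr_ge0; [exact: ltW|rewrite divr_ge0// ltW].
have K20 : 0 <= K2 by exact: mulr_ge0 (mulr_ge0 (ltW C0) P0) (mulr_ge0 W0 L0).
(* The source is frozen at s and the kernel moves. *)
have B1 s' : r0 / 2 <= t - s' -> `|heat (t - s') (hardy_henon gamma beta (u s)) x -
    heat (t - s) (hardy_henon gamma beta (u s)) x| <= K1 * `|s - s'|.
  have [ms ds] := src s sT.
  have main (p r : R) : r0 / 2 <= p -> p <= r ->
      `|heat r (hardy_henon gamma beta (u s)) x -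
        heat p (hardy_henon gamma beta (u s)) x| <= K1 * (r - p).
    move=> rp pr; have p0 := lt_le_trans r02 rp.
    apply: le_trans (HC' _ _ p r x ww ms ds p0 pr x0) _.
    rewrite powRr1 ?addrK ?divr_ge0 ?subr_ge0 ?(ltW p0)// -/W /wM /=.
    have pi : p^-1 <= 2 / r0 by rewrite -[2 / r0]invf_div lef_pV2 ?posrE.
    rewrite (_ : K1 * (r - p) = C' * ((r - p) * (2 / r0)) * P * (W * (L' * M `^ beta * M))); last by rewrite /K1; ring.
    rewrite ler_wpM2r//; first exact: mulr_ge0 W0 (mulr_ge0 L'0 M0).
    apply: ler_pM; rewrite ?powR_ge0 ?Pr//.
      by rewrite mulr_ge0 ?divr_ge0 ?subr_ge0 ?(ltW C'0) ?(ltW p0).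
    by rewrite ler_pM2l// ler_wpM2l ?subr_ge0.
  move=> rs'; have rs : r0 / 2 <= t - s by rewrite -/r0; lra.
  have [ss|/ltW ss] := leP s' s.
    have := main (t - s) (t - s') rs; rewrite lerD2l lerN2 => /(_ ss).
    rewrite (_ : t - s' - (t - s) = s - s'); last by ring.
    by rewrite [`|s - s'|]ger0_norm ?subr_ge0.
  have := main (t - s') (t - s) rs'; rewrite lerD2l lerN2 => /(_ ss).
  have -> : t - s - (t - s') = s' - s by ring.
  rewrite distrC.
  by rewrite [`|s - s'|]distrC (ger0_norm (_ : 0 <= s' - s)) ?subr_ge0.
(* The kernel is frozen and the source moves. *)
have B2 s' (k : R) : 0 <= k -> 0 <= s' <= T -> r0 / 2 <= t - s' ->
    (herz_norm +oo%E alpha q (u s' \- u s)%R <= k%:E)%E ->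
    `|heat (t - s') (hardy_henon gamma beta (u s')) x -
      heat (t - s') (hardy_henon gamma beta (u s)) x| <= K2 * k.
  move=> k0 s'T rs' hk; have p0 := lt_le_trans r02 rs'.
  have [ms ds] := src s sT; have [ms' ds'] := src s' s'T.
  have [mus dus] := bu s sT; have [mus' dus'] := bu s' s'T.
  rewrite -heatB//; last 2 first.
  - exact: (proj1 (HC _ _ _ x ww ms' ds' p0 x0)).
  - exact: (proj1 (HC _ _ _ x ww ms ds p0 x0)).
  have dk := herz_norm_weak n0 q1 k0 alpha0 hk.
  have dd := HL (u s') (u s) (cst k) M dus' dus dk M0.
  have wk : weight eps (fun r => L * M `^ beta * (cst k : R -> R) r).
    by apply: weightZ => //; exact: weight_cst.
  have md := measurable_funB ms' ms.
  have [_ ] := HC _ _ (t - s') x wk md dd p0 x0.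
  rewrite addrK -/W /= => /le_trans; apply.
  rewrite (_ : K2 * k = C * P * (W * (L * M `^ beta * k))); last by rewrite /K2; ring.
  apply: ler_wpM2r; first exact: mulr_ge0 W0 (mulr_ge0 L0 k0).
  by rewrite ler_pM2l// Pr.
apply/cvgrPdist_lt => e e0.
(* Adding 1 avoids a zero denominator and makes the final inequality strict. *)
pose k := e / (2 * (K2 + 1)).
have k0 : 0 < k by rewrite divr_gt0// mulr_gt0// ltr_wpDl.
pose d := e / (2 * (K1 + 1)).
have d0 : 0 < d by rewrite divr_gt0// mulr_gt0// ltr_wpDl.
have small : \forall s' \near within `]0, T]%classic (nbhs s),
    (herz_norm +oo%E alpha q (u s' \- u s)%R <= k%:E)%E.
  have /fine_cvgP[ff /cvgrPdist_lt/(_ k k0) fk] := us.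
  apply: filterS2 ff fk => s' f1 f2; rewrite -(fineK f1) lee_fin ltW//.
  move: f2; rewrite sub0r normrN /= ger0_norm// fine_ge0// herz_norm_ge0//.
have sd : s < s + r0 / 2 by rewrite ltrDl.
have stt : s < T by exact: lt_le_trans tT.
move: small; rewrite near_withinE => small.
near=> s'.
have s'0 : 0 < s' by near: s'; exact: lt_nbhsr.
have s'd : s' < s + r0 / 2 by near: s'; exact: lt_nbhsl.
have r0E : r0 = t - s by [].
have rs' : r0 / 2 <= t - s' by move: s'd r0E; lra.
have s'T : 0 <= s' <= T by rewrite (ltW s'0); move: rs' r02 tT; lra.
have hk : (herz_norm +oo%E alpha q (u s' \- u s)%R <= k%:E)%E.
  have : `]0, T]%classic s' -> (herz_norm +oo%E alpha q (u s' \- u s)%R <= k%:E)%E.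
    by near: s'; exact: small.
  by apply; rewrite /= in_itv/= s'0; case/andP: s'T.
have ss' : `|s - s'| < d by near: s'; apply: cvgr_dist_lt => //; exact: cvg_id.
have p0 := lt_le_trans r02 rs'.
rewrite !heat_conv_heat//.
have H1 := B1 s' rs'; have H2 := B2 s' k (ltW k0) s'T rs' hk.
set X := heat (t - s) _ x; set Y := heat (t - s') _ x.
set Z := heat (t - s') (hardy_henon gamma beta (u s)) x in H1 H2.
rewrite -/X -/Y in H1 H2.
have -> : X - Y = - (Z - X) - (Y - Z) by ring.
apply: le_lt_trans (ler_normB _ _) _; rewrite normrN.
apply: le_lt_trans (lerD H1 H2) _.
apply: (@le_lt_trans _ _ (K1 * d + K2 * k)).
  by rewrite lerD2r; apply: ler_wpM2l; [exact: K10|exact: ltW].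
have h2 : (K1 + 1) * d = e / 2 by rewrite /d; field; rewrite gt_eqF// ltr_wpDl.
have h3 : (K2 + 1) * k = e / 2 by rewrite /k; field; rewrite gt_eqF// ltr_wpDl.
by rewrite [ltRHS]splitr -{1}h2 -h3; apply: ltrD; rewrite ltr_pM2r// ltrDl.
Unshelve. all: by end_near. Qed.

(** Continuity is known on the open interval only; the single point 0 does not affect
    measurability. *)
Lemma class_time_measurable T u t x : herz_class +oo%E alpha q T u ->
  t <= T -> 0 < enorm x -> time_measurable (hh u) 0 t t x.
Proof.
move=> cu tT x0; rewrite /time_measurable.
apply/measurable_fun_itv_obnd_cbndP; apply: open_continuous_measurable_fun => //.
move=> s; rewrite inE/= in_itv/= => /andP[s0 st].
exact: (class_continuous_conv cu s0 st tT x0).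
Qed.

End SolutionClass.

(** * Uniqueness in the solution class *)

Section Uniqueness.
Context {R : realType} {n : nat}.
Local Notation Rn := (n.-tuple (measurableTypeR R)).
Local Notation leb := (@lebesgue_space R n).
Local Notation mu := (@lebesgue_measure R).
Context (alpha beta gamma eps A : R) (q : \bar R).
Hypotheses (n0 : (0 < n)%N) (beta0 : 0 < beta) (eps0 : 0 <= eps) (ea : eps <= alpha).
Local Notation sigma := (alpha * beta + gamma).
Local Notation delta := (alpha + sigma).
Hypotheses (sigma02 : 0 <= sigma < 2) (den : delta + eps < n%:R) (q1 : (1 <= q)%E).
Implicit Types (x y z : Rn) (w : R -> R) (f g : Rn -> R) (u v : R -> Rn -> R)
  (a b t s M T : R).

Local Notation hh v := (fun s => hardy_henon gamma beta (v s)).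

Let alpha0 : 0 <= alpha. Proof. exact: le_trans ea. Qed.
Let ed : eps <= delta - sigma. Proof. by rewrite addrK. Qed.

Lemma small_time (c p : R) : 0 <= c -> 0 < p -> exists2 tau, 0 < tau & c * tau `^ p <= 1.
Proof.
move=> c0 p0; exists ((c + 1)^-1 `^ p^-1); first by rewrite powR_gt0// invr_gt0; lra.
rewrite -powRrM mulVf ?gt_eqF// powRr1 ?invr_ge0; last by lra.
by rewrite ler_pdivrMr; lra.
Qed.

Lemma herz_solution_duhamel f T u : herz_solution A gamma beta +oo%E alpha q f T u ->
  forall t, 0 <= t <= T ->
    (forall x, 0 < enorm x ->
      mu.-integrable `[0, t[ (EFin \o (fun s => heat_conv (t - s) (hh u s) x))) /\
    \forall x \ae leb, u t x = heat t f x + A * duhamel (hh u) 0 t t x.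
Proof.
move=> [cu mu_] t /[dup] tT /andP[t0 t1].
have [M M0 bu] := class_bounded n0 eps0 ea q1 cu.
have [L L0 HL] := @source_bounded R n alpha beta gamma n0 beta0.
have [K K0 HK] := @duhamel_le R n eps delta sigma eps0 sigma02 ed den.
have ww : weight eps (cst (L * M `^ beta * M)).
  by apply: weight_cst; rewrite !mulr_ge0 ?powR_ge0// ltW.
have bt : bounded_on alpha M u 0 t.
  by move=> s /andP[s0 st]; apply: bu; apply/andP; split; lra.
have I x : 0 < enorm x ->
    mu.-integrable `[0, t[ (EFin \o (fun s => heat_conv (t - s) (hh u s) x)).
  move=> x0; have mt := class_time_measurable n0 beta0 eps0 ea sigma02 den q1 cu t1 x0.
  by have [H _] := HK _ _ 0 t t x ww (HL M u 0 t M0 bt) t0 (lexx t) x0 mt.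
split=> //; apply: filterS2 (ae_enorm_gt0 n0) (mu_ t tT) => x x0 ->.
by rewrite Rintegral_duhamel//; exact: I.
Qed.

Lemma herz_solution_unique f T u v : herz_solution A gamma beta +oo%E alpha q f T u ->
  herz_solution A gamma beta +oo%E alpha q f T v -> ae_equal_on T u v.
Proof.
move=> su sv; have Du := herz_solution_duhamel su; have Dv := herz_solution_duhamel sv.
have [cu _] := su; have [cv _] := sv; have /andP[sigma0 sigma2] := sigma02.
have [Mu Mu0 bu] := class_bounded n0 eps0 ea q1 cu; have [Mv Mv0 bv] := class_bounded n0 eps0 ea q1 cv.
pose M := Mu + Mv; have M0 : 0 <= M by exact: addr_ge0.
have [K K0 HK] := duhamel_lipschitz n0 beta0 eps0 ea sigma02 den.
pose p := 1 - sigma / 2; have p0 : 0 < p by rewrite /p; lra.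
(* On intervals of length eta the equation then at least halves the bound on the difference. *)
pose c := 2 * (`|A| * (K * M `^ beta)).
have c0 : 0 <= c by rewrite !mulr_ge0 ?powR_ge0 ?(ltW K0).
have [eta eta0 ceta] := small_time c0 p0.
have bM t : 0 <= t <= T -> [/\ measurable_fun setT (u t), measurable_fun setT (v t),
    dominated alpha (cst M) (u t) & dominated alpha (cst M) (v t)].
  move=> tT; have [mut dut] := bu t tT; have [mvt dvt] := bv t tT.
  by split=> //; [apply: (dominated_le n0) dut|apply: (dominated_le n0) dvt] => r _ /=;
    rewrite /M ?lerDl ?lerDr.
(* The length eta depends only on bounds valid on all of [0, T], so finitely many intervals reach
   any time. *)
suff claim (k : nat) t : 0 <= t <= T -> t < k%:R * eta -> \forall x \ae leb, u t x = v t x.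
  move=> t tT; apply: (claim (Num.truncn (t / eta)).+1) => //.
  by rewrite -ltr_pdivrMr// truncnS_gt.
elim: k t => [|k IH] t tT; first by rewrite mul0r; case/andP: tT => *; lra.
pose a := k%:R * eta; have a0 : 0 <= a by rewrite mulr_ge0// ltW.
have aE : k.+1%:R * eta = a + eta by rewrite /a -natr1 mulrDl mul1r.
have [ta _|at_ tk] := ltP t a; first exact: IH.
(* The trivial bound 2M is improved by 1/2 at each passage through the equation; s stays free
   because the integral involves all earlier times of the interval. *)
suff bnd (m : nat) s : 0 <= s <= T -> a <= s < a + eta ->
    dominated alpha (cst (2 * M * 2^-1 ^+ m)) (u s \- v s).
  have : \forall x \ae leb, forall m, `|u t x - v t x| <=
      enorm x `^ (- alpha) * (2 * M * 2^-1 ^+ m).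
    by apply/ae_foralln => m; apply: bnd => //; rewrite at_ -aE.
  apply: filterS => x Hx; apply/eqP; rewrite -subr_eq0 -normr_le0.
  apply: (@le0_geometric R _ (enorm x `^ (- alpha) * (2 * M))) => m.
  by rewrite -mulrA.
elim: m s => [|m IHm] s sT /andP[as_ sk].
  have [_ _ du dv] := bM s sT.
  apply: filterS2 du dv => x ux vx; apply: le_trans (ler_normB _ _) _.
  by move: ux vx => /=; rewrite expr0; lra.
have [s0 s1] := andP sT.
have [Iu Eu] := Du s sT; have [Iv Ev] := Dv s sT.
apply: filterS3 (ae_enorm_gt0 n0) Eu Ev => x x0 ux vx; rewrite /= ux vx.
(* The null set where the solutions differ may depend on r, but the heat operator ignores it at each
   r. *)
have E : duhamel (hh u) 0 a s x = duhamel (hh v) 0 a s x.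
  apply: eq_Rintegral => r; rewrite inE/= in_itv/= => /andP[r0 ra].
  have rs : 0 < s - r by rewrite subr_gt0 (lt_le_trans ra).
  have rT : 0 <= r <= T by rewrite r0 (le_trans (ltW ra))// (le_trans as_).
  have [mur mvr _ _] := bM r rT.
  rewrite !heat_conv_heat//; apply: eq_heat => //; [exact: measurable_hardy_henon..|].
  by apply: filterS (IH r rT ra) => y; rewrite /hardy_henon => ->.
rewrite (duhamel_cat a0 as_ (Iu x x0)) (duhamel_cat a0 as_ (Iv x x0)) E.
set D := duhamel _ 0 _ _ _; set Eu' := duhamel _ _ _ _ _; set Ev' := duhamel _ _ _ _ _.
have -> : heat s f x + A * (D + Eu') - (heat s f x + A * (D + Ev')) = A * (Eu' - Ev') by ring.
pose kap := 2 * M * 2^-1 ^+ m.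
have kap0 : 0 <= kap by rewrite !mulr_ge0// exprn_ge0// invr_ge0.
have sub r : a <= r < s -> 0 <= r <= T.
  by move=> /andP[r1 r2]; rewrite (le_trans a0 r1) (le_trans (ltW r2)).
have H : `|Eu' - Ev'| <= K * M `^ beta * (s - a) `^ p * (enorm x `^ (- alpha) * kap).
  apply: (HK (cst kap) M u v a s x _ M0 as_ x0).
  - exact: weight_cst.
  - by move=> r /sub rT; have [] := bM r rT.
  - by move=> r /sub rT; have [] := bM r rT.
  - move=> r rs; apply: IHm; first exact: sub.
    by case/andP: rs => r1 r2; rewrite r1 (lt_trans r2).
  - exact: time_measurable_sub a0 (lexx s) (class_time_measurable n0 beta0 eps0 ea sigma02 den q1 cu s1 x0).
  - exact: time_measurable_sub a0 (lexx s) (class_time_measurable n0 beta0 eps0 ea sigma02 den q1 cv s1 x0).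
have W0 : 0 <= enorm x `^ (- alpha) * kap by rewrite mulr_ge0 ?powR_ge0.
have c1 : c * (s - a) `^ p <= 1.
  apply: le_trans ceta; apply: (ler_wpM2l c0).
  have sa0 : 0 <= s - a by rewrite subr_ge0.
  have sae : s - a <= eta by rewrite lerBlDl ltW.
  exact: (ge0_ler_powR (ltW p0) sa0 (ltW eta0) sae).
rewrite normrM; apply: le_trans (ler_wpM2l (normr_ge0 A) H) _.
have -> : `|A| * (K * M `^ beta * (s - a) `^ p * (enorm x `^ (- alpha) * kap)) =
    c * (s - a) `^ p * (enorm x `^ (- alpha) * kap / 2) by rewrite /c; field.
have -> : enorm x `^ (- alpha) * (2 * M * 2^-1 ^+ m.+1) = enorm x `^ (- alpha) * kap / 2.
  by rewrite /kap exprS; field.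
by apply: ler_piMl c1; exact: divr_ge0 W0 (ler0n _ 2).
Qed.

End Uniqueness.

(** * Continuation *)

Section RintegralFubini.
Context d1 d2 (T1 : measurableType d1) (T2 : measurableType d2) (R : realType).
Variables (m1 : {sigma_finite_measure set T1 -> \bar R})
  (m2 : {sigma_finite_measure set T2 -> \bar R}).

(** The inner integrals take finite values only for almost every section; elsewhere [fine] alters
    them on a null set. *)
Lemma Rintegral_fubini (G : T1 * T2 -> R) : (m1 \x m2)%E.-integrable setT (EFin \o G) ->
  \int[m1]_x \int[m2]_y G (x, y) = \int[m2]_y \int[m1]_x G (x, y).
Proof.
move=> iG; have mG : measurable_fun setT G by apply/measurable_EFinP; case/integrableP: iG.
have mG' : measurable_fun setT (fun p : T2 * T1 => G (p.2, p.1)).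
  have mp : measurable_fun setT (fun p : T2 * T1 => (p.2, p.1)) by exact: measurable_fun_pair.
  exact: (measurableT_comp mG mp).
rewrite /Rintegral; congr fine.
transitivity (\int[m1]_x \int[m2]_y (G (x, y))%:E)%E.
  apply: ae_eq_integral => //.
  - by apply/measurable_EFinP; exact: measurable_Rintegral.
  - exact: measurable_fubini_F iG.
  - apply: filterS (ae_integrable1 iG) => x ix _.
    by rewrite fineK// integrable_fin_num.
rewrite (Fubini iG); apply: ae_eq_integral => //.
- exact: measurable_fubini_G iG.
- by apply/measurable_EFinP; exact: (measurable_Rintegral m1 mG').
- apply: filterS (ae_integrable2 iG) => x ix _.
  by rewrite fineK// integrable_fin_num.
Qed.

End RintegralFubini.

(** * The semigroup law and its action on the Duhamel integral *)

Section Semigroup.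
Context {R : realType} {n : nat}.
Local Notation Rn := (n.-tuple (measurableTypeR R)).
Local Notation leb := (@lebesgue_space R n).
Local Notation mu := (@lebesgue_measure R).
Hypothesis n0 : (0 < n)%N.
Implicit Types (x y z : Rn) (w : R -> R) (f : Rn -> R) (F : R -> Rn -> R)
  (a b t s d sigma eps : R).

Lemma measurable_heat_kernel_vsub2 t :
  measurable_fun setT (fun p : Rn * Rn => heat_kernel t (vsub p.1 p.2)).
Proof.
have mp : measurable_fun setT (fun p : Rn * Rn => ((t : measurableTypeR R), vsub p.1 p.2)).
  by apply: measurable_fun_pair => //; exact: measurable_vsub.
exact: (measurableT_comp measurable_heat_kernel mp).
Qed.

(** Fubini applies because integrating |G| in the middle variable gives the kernel at time s + t
    against |f|, which is integrable by the heat bound. *)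
Lemma heat_semigroup d eps w f s t x : 0 <= eps -> eps <= d -> d + eps < n%:R ->
  weight eps w -> measurable_fun setT f -> dominated d w f ->
  0 < s -> 0 < t -> 0 < enorm x -> heat s (heat t f) x = heat (s + t) f x.
Proof.
move=> eps0 ed den ww mf fw s0 t0 x0.
have ed0 : eps <= d - 0 by rewrite subr0.
have [C C0 HC] := @heat_bound R n eps d 0 eps0 (lexx 0) ed0 den.
have st0 : 0 < s + t by exact: addr_gt0.
pose G (p : Rn * Rn) := heat_kernel s (vsub x p.1) * (heat_kernel t (vsub p.1 p.2) * f p.2).
have mG : measurable_fun setT G.
  apply: measurable_funM; last apply: measurable_funM.
  - exact: (measurableT_comp (measurable_heat_kernel_vsub _ _)).
  - exact: measurable_heat_kernel_vsub2.
  - exact: (measurableT_comp mf).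
have mkk z : measurable_fun setT (fun y =>
    heat_kernel s (vsub x y) * heat_kernel t (vsub y z)).
  apply: measurable_funM; first exact: measurable_heat_kernel_vsub.
  under eq_fun do rewrite heat_kernel_symm.
  exact: measurable_heat_kernel_vsub.
have kk0 y z : 0 <= heat_kernel s (vsub x y) * heat_kernel t (vsub y z).
  by rewrite mulr_ge0 ?heat_kernel_ge0.
have iG : (leb \x leb)%E.-integrable setT (EFin \o G).
  apply/integrable21ltyP; first exact/measurable_EFinP.
  have [/integrableP[_ I] _] := HC w f (s + t) x ww mf fw st0 x0.
  apply: le_lt_trans I; rewrite le_eqVlt; apply/orP; left; apply/eqP.
  apply: eq_integral => z _.
  transitivity (\int[leb]_y (`|f z|%:E * (heat_kernel s (vsub x y) * heat_kernel t (vsub y z))%:E))%E.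
    apply: eq_integral => y _; rewrite -EFinM /= /G /= mulrA normrM (ger0_norm (kk0 y z)).
    by rewrite mulrC.
  rewrite ge0_integralZl//.
  - by rewrite heat_kernel_semigroup// -EFinM abse_EFin normrM (ger0_norm (heat_kernel_ge0 _ _)) mulrC.
  - exact/measurable_EFinP.
  - by move=> y _; rewrite lee_fin.
have mk y : measurable_fun setT (fun z => (heat_kernel t (vsub y z) * f z)%:E) by exact: measurable_kernel_mul.
rewrite heatE//; transitivity (\int[leb]_y \int[leb]_z G (y, z)).
  rewrite /Rintegral; congr fine; apply: ae_eq_integral => //.
  - by apply: measurable_kernel_mul; exact: (joint_slice t (joint_heat mf)).
  - by apply/measurable_EFinP; exact: measurable_Rintegral.
  - apply: filterS (ae_enorm_gt0 n0) => y y0 _; congr (_%:E); rewrite heatE//.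
    by rewrite -RintegralZl//; have [] := HC w f t y ww mf fw t0 y0.
rewrite (Rintegral_fubini iG) heatE//; apply: eq_Rintegral => z _.
transitivity (\int[leb]_y (f z * (heat_kernel s (vsub x y) * heat_kernel t (vsub y z)))).
  by apply: eq_Rintegral => y _; rewrite /G /=; ring.
have S := heat_kernel_semigroup x z s0 t0.
rewrite RintegralZl//; first by rewrite /Rintegral S mulrC.
apply/integrableP; split; first exact/measurable_EFinP.
apply: le_lt_trans (ltry (heat_kernel (s + t) (vsub x z))); rewrite -S.
rewrite le_eqVlt; apply/orP; left; apply/eqP; apply: eq_integral => y _.
by rewrite /= ger0_norm.
Qed.

(** Fubini in time and space, then the semigroup law under the time integral. Two successive heat
    bounds, from exponent d to d - sigma and then at d - sigma without loss, bound the space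
    integral at time s by a multiple of (t - s)^(-sigma/2). *)
Lemma heat_duhamel d sigma eps w F a t r x : 0 <= eps -> 0 <= sigma < 2 ->
  eps <= d - sigma -> d + eps < n%:R -> weight eps w -> joint F ->
  source d w F a t -> a <= t -> 0 < r -> 0 < enorm x ->
  heat r (duhamel F a t t) x = duhamel F a t (t + r) x.
Proof.
move=> eps0 sigma02 ed den ww jF sF at_ r0 x0; have /andP[sigma0 sigma2] := sigma02.
have edd : eps <= d by apply: le_trans ed _; rewrite gerBl.
have ed0 : eps <= d - sigma - 0 by rewrite subr0.
have den' : d - sigma + eps < n%:R by apply: le_lt_trans den; rewrite lerD2r gerBl.
have [C C0 HC] := @heat_bound R n eps d sigma eps0 sigma0 ed den.
have [C' C'0 HC'] := @heat_bound R n eps (d - sigma) 0 eps0 (lexx 0) ed0 den'.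
have [K K0 HK] := @duhamel_le R n eps d sigma eps0 sigma02 ed den.
have p01 : 0 <= sigma / 2 < 1 by apply/andP; split; lra.
(* Extension by 0 lets Fubini run over the whole time line. *)
pose k s y := if a <= s < t then heat_kernel r (vsub x y) * heat_conv (t - s) (F s) y else 0.
pose G (p : measurableTypeR R * Rn) := k p.1 p.2.
have jH : joint (fun s => heat_conv (t - s) (F s)).
  have mp : measurable_fun setT (fun p : measurableTypeR R * Rn =>
      (((t : measurableTypeR R), p.2), p.1)).
    by apply: measurable_fun_pair => //; exact: measurable_fun_pair.
  exact: (measurableT_comp (measurable_heat_conv_joint jF) mp).
have mG : measurable_fun setT G.
  apply: measurable_fun_ifT => //.
    by apply: measurable_and; [apply: measurable_fun_ler|apply: measurable_fun_ltr].
  apply: measurable_funM; last exact: jH.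
  exact: (measurableT_comp (measurable_heat_kernel_vsub r x)).
pose W := enorm x `^ (- (d - sigma)) * w (enorm x).
have W0 : 0 <= W by rewrite mulr_ge0 ?powR_ge0// (proj1 ww).
have slice s : a <= s < t -> leb.-integrable setT (fun y =>
      (heat_kernel r (vsub x y) * heat_conv (t - s) (F s) y)%:E) /\
    \int[leb]_y `|k s y| <= C' * C * W * (t - s) `^ (- (sigma / 2)).
  move=> st; have [mFs dFs] := sF s st; have ts : 0 < t - s.
    by rewrite subr_gt0; case/andP: st.
  pose P := C * (t - s) `^ (- (sigma / 2)).
  have P0 : 0 <= P by rewrite mulr_ge0 ?powR_ge0// ltW.
  have dH : dominated (d - sigma) (fun r => P * w r) (heat_conv (t - s) (F s)).
    apply: filterS (ae_enorm_gt0 n0) => y y0; rewrite heat_conv_heat//.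
    by have [_ H] := HC w (F s) (t - s) y ww mFs dFs ts y0; rewrite mulrCA.
  have mH : measurable_fun setT (heat_conv (t - s) (F s)) by exact: (joint_slice s jH).
  have dN : dominated (d - sigma) (fun r => P * w r) (fun y => `|heat_conv (t - s) (F s) y|).
    by apply: filterS dH => y; rewrite normr_id.
  have mN : measurable_fun setT (fun y => `|heat_conv (t - s) (F s) y|).
    exact: (measurableT_comp (@normr_measurable R setT)).
  split; first by have [] := HC' _ _ r x (weightZ P0 ww) mH dH r0 x0.
  have [_ H] := HC' _ _ r x (weightZ P0 ww) mN dN r0 x0.
  move: H; rewrite mul0r oppr0 powRr0 mulr1 addr0 heatE// => H.
  have -> : C' * C * W * (t - s) `^ (- (sigma / 2)) =
      C' * (enorm x `^ (- (d - sigma)) * (P * w (enorm x))) by rewrite /P /W; ring.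
  apply: le_trans H; apply: le_trans (ler_norm _).
  rewrite le_eqVlt; apply/orP; left; apply/eqP; apply: eq_Rintegral => y _.
  by rewrite /k st normrM (ger0_norm (heat_kernel_ge0 _ _)).
have kI s : leb.-integrable setT (fun y => (k s y)%:E).
  have [st|st] := boolP (a <= s < t).
    by have [H _] := slice s st; apply: eq_integrable H => // y _; rewrite /k st.
  apply: eq_integrable (integrable0 _ _) => // y _.
  by rewrite /k (negbTE st).
have iG : (mu \x leb)%E.-integrable setT (EFin \o G).
  apply/integrable12ltyP; first exact/measurable_EFinP.
  pose h s := \int[leb]_y `|k s y|.
  have mh : measurable_fun setT h.
    by apply: (measurable_Rintegral leb (k := fun p => `|G p|)); exact: measurableT_comp.
  have CW0 : 0 <= C' * C * W by exact: mulr_ge0 (mulr_ge0 (ltW C'0) (ltW C0)) W0.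
  have h0 s : 0 <= h s by apply: Rintegral_ge0.
  have [|/integrableP[_ hI] _] := @integrable_time R a t t _ _ h p01 at_ (lexx t) CW0 (measurable_funTS mh).
    by move=> s st; rewrite ger0_norm//; have [] := slice s st.
  apply: le_lt_trans hI; rewrite [leRHS]integral_mkcond.
  rewrite le_eqVlt; apply/orP; left; apply/eqP; apply: eq_integral => s _.
  rewrite patchE mem_setE/= in_itv/=; case: ifPn => st.
    rewrite ger0_norm// /h /Rintegral fineK//.
    exact: integrable_fin_num (integrable_norm (kI s)).
  rewrite integral0_eq// => y _.
  by rewrite /= /G /k (negbTE st) normr0.
transitivity (\int[leb]_y \int[mu]_s G (s, y)).
  rewrite heatE// /Rintegral; congr fine; apply: ae_eq_integral => //.
  - apply: measurable_kernel_mul.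
    exact: (joint_slice t (measurable_duhamel a t jF)).
  - apply/measurable_EFinP; apply: (measurable_Rintegral mu (k := fun p => G (p.2, p.1))).
    have mp : measurable_fun setT (fun p : Rn * measurableTypeR R => (p.2, p.1)).
      exact: measurable_fun_pair.
    exact: (measurableT_comp mG mp).
  - apply: filterS (ae_enorm_gt0 n0) => y y0 _; congr (_%:E).
    have mt := joint_time_measurable (a := a) (b := t) t y jF.
    have [I _] := HK w F a t t y ww sF at_ (lexx t) y0 mt.
    rewrite /duhamel -RintegralZl// Rintegral_mkcond; apply: eq_Rintegral => s _.
    by rewrite patchE mem_setE/= in_itv.
rewrite -(Rintegral_fubini iG) /duhamel [RHS]Rintegral_mkcond; apply: eq_Rintegral => s _.
rewrite patchE mem_setE/= in_itv/=; case: ifPn => st; last first.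
  rewrite /G /= /k (negbTE st) /Rintegral integral0_eq//.
have [mFs dFs] := sF s st; have ts : 0 < t - s by rewrite subr_gt0; case/andP: st.
rewrite heat_conv_heat; last by rewrite addrAC addr_gt0.
rewrite (_ : t + r - s = r + (t - s)); last by ring.
rewrite -(heat_semigroup eps0 edd den ww mFs dFs r0 ts x0) heatE//.
by apply: eq_Rintegral => y _; rewrite /G /= /k st heat_conv_heat.
Qed.

End Semigroup.

(** * Restarting a solution at a later time *)

Section Continuation.
Context {R : realType} {n : nat}.
Local Notation Rn := (n.-tuple (measurableTypeR R)).
Local Notation leb := (@lebesgue_space R n).
Local Notation mu := (@lebesgue_measure R).
Context (alpha beta gamma eps A : R) (q : \bar R).
Hypotheses (n0 : (0 < n)%N) (beta0 : 0 < beta) (eps0 : 0 < eps) (ea : eps <= alpha).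
Local Notation sigma := (alpha * beta + gamma).
Local Notation delta := (alpha + sigma).
Hypotheses (sigma02 : 0 <= sigma < 2) (den : delta + eps < n%:R) (q1 : (1 <= q)%E).
Implicit Types (x y z : Rn) (w : R -> R) (f g : Rn -> R) (u v : R -> Rn -> R)
  (a b t s M T : R).

Local Notation hh v := (fun s => hardy_henon gamma beta (v s)).
Local Notation exact_solution f T u :=
  (@exact_solution R n alpha beta gamma eps A q f T u).

Let eps0' : 0 <= eps := ltW eps0.
Let alpha0 : 0 <= alpha. Proof. exact: le_trans ea. Qed.
Let ed : eps <= delta - sigma. Proof. by rewrite addrK. Qed.

(* The free term of the restarted equation is [e^{(t - T) Delta} (u T)], so it is
   controlled by the norm of [u T] alone. *)
Lemma exact_free_term f T u t : herz +oo%E alpha q f -> 0 <= T -> exact_solution f T u ->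
  T <= t -> \forall x \ae leb,
    heat t f x + A * duhamel (hh u) 0 T t x = heat (t - T) (u T) x.
Proof.
move=> hf T0 eu Tt; have [mf [w [ww wq fw]]] := herz_data n0 eps0 ea q1 hf.
have [ju _ uE] := eu; have [w' [ww' wq' su]] := exact_source n0 beta0 eps0' q1 eu.
have TT : 0 <= T <= T by rewrite T0 lexx.
apply: filterS (ae_enorm_gt0 n0) => x x0.
move: Tt; rewrite le_eqVlt => /predU1P[<-|Tt]; first by rewrite subrr heat0 uE// x0.
have r0 : 0 < t - T by rewrite subr_gt0.
have /andP[sigma0 sigma2] := sigma02.
have aen : alpha + eps < n%:R by move: den sigma0; rewrite -addrA; lra.
have jF := @joint_hardy_henon R n beta gamma _ ju.
have sF := su 0 T (lexx 0) (lexx T).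
have [C C1 HC] := @heat_stable R n alpha beta gamma eps n0 eps0' ea sigma02 den.
have [K K0 HK] := @duhamel_le R n eps delta sigma eps0' sigma02 ed den.
pose P := K * T `^ (1 - sigma / 2).
have P0 : 0 <= P by rewrite mulr_ge0 ?powR_ge0// ltW.
have dD : dominated alpha (fun r => P * w' r) (duhamel (hh u) 0 T T).
  apply: filterS (ae_enorm_gt0 n0) => y y0; rewrite mulrCA.
  have mt := joint_time_measurable (a := 0) (b := T) T y jF.
  by have [_] := HK _ _ 0 T T y ww' sF T0 (lexx T) y0 mt; rewrite addrK subr0.
have mD : measurable_fun setT (duhamel (hh u) 0 T T).
  exact: (joint_slice T (measurable_duhamel 0 T jF)).
have mH : measurable_fun setT (heat T f) by exact: (joint_slice T (joint_heat mf)).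
have [_ Hf] := HC w f ww mf fw.
have C0 : 0 <= C by exact: le_trans C1.
have [I1 _] := HC _ _ (weightZ C0 ww) mH (Hf T T0).
have [I2 _] := HC _ _ (weightZ P0 ww') mD dD.
have E : heat (t - T) (u T) x =
    heat (t - T) (fun y => heat T f y + A * duhamel (hh u) 0 T T y) x.
  apply: eq_heat => //; first exact: joint_slice.
    by apply: measurable_funD => //; exact: measurable_funM.
  by apply: filterS (ae_enorm_gt0 n0) => y y0; rewrite uE// y0.
rewrite E heatDZ//; [|exact: (proj1 (I1 _ x r0 x0))|exact: (proj1 (I2 _ x r0 x0))].
rewrite (heat_duhamel n0 eps0' sigma02 ed den ww' jF sF T0 r0 x0) subrKC.
congr (_ + _); move: T0; rewrite le_eqVlt => /predU1P[<-|T0].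
  by rewrite subr0 heat0.
rewrite (heat_semigroup n0 eps0' ea aen ww mf fw r0 T0 x0) subrK//.
Qed.

(** The weight of [u T] may be arbitrary: the local existence time depends only on its supremum,
    which [herz_weight] bounds by a multiple of B. *)
Lemma exact_extend (B : R) : 0 <= B -> exists2 tau, 0 < tau &
  forall f T u, herz +oo%E alpha q f -> 0 <= T -> exact_solution f T u ->
  (herz_norm +oo%E alpha q (u T) <= B%:E)%E ->
  exists v, exact_solution f (T + tau) v.
Proof.
move=> B0; have [C1 C10 HW] := @herz_weight R n n0 alpha eps q q1 alpha0 eps0.
have [C2 C21 HS] := @heat_stable R n alpha beta gamma eps n0 eps0' ea sigma02 den.
have C20 : 0 <= C2 by exact: le_trans C21.
have [c c0 HL] := @local_existence R n alpha beta gamma eps n0 beta0 eps0' ea sigma02 den A.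
pose M := C2 * (C1 * B).
have M0 : 0 <= M by exact: mulr_ge0 C20 (mulr_ge0 (ltW C10) B0).
have /andP[sigma0 sigma2] := sigma02.
have p0 : 0 < 1 - sigma / 2 by lra.
have cM0 : 0 <= c * M `^ beta by rewrite mulr_ge0 ?powR_ge0// ltW.
have [tau tau0 ctau] := small_time cM0 p0.
exists tau => // f T u hf T0 eu uB; have [mf _] := herz_data n0 eps0 ea q1 hf.
have [ju [wu [wwu wqu uw]] uE] := eu.
have [w [ww uTw wq wB]] := HW (u T) B B0 uB.
have jF := @joint_hardy_henon R n beta gamma _ ju.
have mT : measurable_fun setT (u T) by exact: joint_slice.
pose g t x := heat t f x + A * duhamel (hh u) 0 T t x.
have jg : joint g.
  apply: measurable_funD; first exact: joint_heat.
  by apply: measurable_funM => //; exact: measurable_duhamel.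
have [_ Hg] := HS w (u T) ww mT uTw.
have wC : weight eps (fun r => C2 * w r) by exact: weightZ.
have gw t : T <= t <= T + tau -> dominated alpha (fun r => C2 * w r) (g t).
  move=> /andP[Tt _]; have tT0 : 0 <= t - T by rewrite subr_ge0.
  apply: filterS2 (exact_free_term hf T0 eu Tt) (Hg _ tT0) => x E.
  by rewrite /g E.
have wM r : 0 < r -> C2 * w r <= M by move=> r0; rewrite ler_wpM2l// wB.
have [v [jv vw vE]] := HL T tau g _ M (ltW tau0) wC M0 wM jg gw ctau.
(* The free term g of v already contains the Duhamel integral of u over [0, T[, so cutting the
   integral of u' at T gives the equation on [0, t]. *)
pose u' t x := if t < T then u t x else v t x.
have ju' : joint u'.
  by apply: measurable_fun_ifT => //; exact: measurable_fun_ltr.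
pose w' r := wu r + 6 * (C2 * w r).
have w60 : weight eps (fun r => 6 * (C2 * w r)) by exact: weightZ.
have ww' : weight eps w' by exact: weightD.
have wq6 : (wnorm q (fun r => (6 * (C2 * w r))%R) < +oo)%E.
  by apply: (wnormZ q1 _ wC) => //; exact: (wnormZ q1 C20 ww wq).
have wq' : (wnorm q w' < +oo)%E by exact: (wnormD q1 wwu w60).
have uw' t : 0 <= t <= T + tau -> dominated alpha w' (u' t).
  move=> /andP[t0 t1]; have [tT|Tt] := ltP t T.
    have -> : u' t = u t by apply/funext => x; rewrite /u' tT.
    apply: (dominated_le n0) (uw t _); last by rewrite t0 ltW.
    by move=> r r0; rewrite lerDl (proj1 w60).
  have -> : u' t = v t by apply/funext => x; rewrite /u' ltNge Tt.
  apply: (dominated_le n0) (vw t _); last by rewrite Tt.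
  by move=> r r0; rewrite lerDr (proj1 wwu).
exists u'; split => //; first by exists w'.
move=> t x /andP[t0 t1].
have du : duhamel (hh u') 0 t t x = duhamel (hh u) 0 t t x \/ T <= t.
  have [tT|] := ltP t T; [left|by right].
  apply: eq_Rintegral => s; rewrite inE/= in_itv/= => /andP[s0 st].
  by congr heat_conv; apply/funext => y; rewrite /hardy_henon /u' (lt_trans st).
have [tT|Tt] := ltP t T.
  case: du; last by rewrite leNgt tT.
  by rewrite /u' tT => ->; apply: uE; rewrite t0 ltW.
have -> : u' t x = v t x by rewrite /u' ltNge Tt.
rewrite vE; last by rewrite Tt.
case: ifPn => [x0|_]; last exact: erefl.
have [M' M'0 wM'] := weight_bounded q1 eps0' ww' wq'.
have [L L0 HSb] := @source_bounded R n alpha beta gamma n0 beta0.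
have bu : bounded_on alpha M' u' 0 t.
  move=> s /andP[s0 st]; split; first exact: joint_slice.
  apply: (dominated_le n0) (uw' s _) => //.
  by rewrite s0 (le_trans (ltW st)).
have wcM : weight eps (cst (L * M' `^ beta * M')).
  by apply: weight_cst; rewrite !mulr_ge0 ?powR_ge0// ltW.
have [K K0 HK] := @duhamel_le R n eps delta sigma eps0' sigma02 ed den.
have mt := joint_time_measurable (a := 0) (b := t) t x
  (@joint_hardy_henon R n beta gamma _ ju').
have [I _] := HK _ _ 0 t t x wcM (HSb M' u' 0 t M'0 bu) t0 (lexx t) x0 mt.
have E1 : duhamel (hh u') 0 T t x = duhamel (hh u) 0 T t x.
  apply: eq_Rintegral => s; rewrite inE/= in_itv/= => /andP[s0 st].
  by congr heat_conv; apply/funext => y; rewrite /hardy_henon /u' st.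
have E2 : duhamel (hh u') T t t x = duhamel (hh v) T t t x.
  apply: eq_Rintegral => s; rewrite inE/= in_itv/= => /andP[s0 st].
  by congr heat_conv; apply/funext => y; rewrite /hardy_henon /u' ltNge s0.
by rewrite (duhamel_cat T0 Tt I) E1 E2 /g mulrDr addrA.
Qed.

End Continuation.

(** * The maximal solution and its blow-up *)

Section MaximalSolution.
Context {R : realType} {n : nat}.
Local Notation Rn := (n.-tuple (measurableTypeR R)).
Local Notation leb := (@lebesgue_space R n).
Local Notation mu := (@lebesgue_measure R).
Context (alpha beta gamma eps A : R) (q : \bar R).
Hypotheses (n0 : (0 < n)%N) (beta0 : 0 < beta) (eps0 : 0 < eps) (ea : eps <= alpha).
Local Notation sigma := (alpha * beta + gamma).
Local Notation delta := (alpha + sigma).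
Hypotheses (sigma02 : 0 <= sigma < 2) (den : delta + eps < n%:R) (q1 : (1 <= q)%E).
Implicit Types (x y z : Rn) (w : R -> R) (f g : Rn -> R) (u v : R -> Rn -> R)
  (a b t s M T : R).

Local Notation hh v := (fun s => hardy_henon gamma beta (v s)).
Local Notation exact_solution f T u :=
  (@exact_solution R n alpha beta gamma eps A q f T u).

Let eps0' : 0 <= eps := ltW eps0.
Let alpha0 : 0 <= alpha. Proof. exact: le_trans ea. Qed.
Lemma exact_sub f T T' u : T' <= T -> exact_solution f T u -> exact_solution f T' u.
Proof.
move=> TT [ju [w [ww wq uw]] uE]; split=> //.
  by exists w; split=> // t /andP[t0 tT]; apply: uw; rewrite t0 (le_trans tT).
by move=> t x /andP[t0 tT]; apply: uE; rewrite t0 (le_trans tT).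
Qed.

Lemma exact_local f : herz +oo%E alpha q f -> exists2 T, 0 < T & exists u, exact_solution f T u.
Proof.
move=> hf; have [mf [w [ww wq fw]]] := herz_data n0 eps0 ea q1 hf.
(* The data itself, set to 0 at the origin, solves the equation on the degenerate interval [0, 0];
   local existence is then a case of continuation. *)
pose u (t : R) x := if 0 < enorm x then f x else 0.
have mu0 : measurable_fun setT (u 0).
  apply: measurable_fun_ifT => //.
  by apply: measurable_fun_ltr => //; exact: measurable_enorm.
have eu : exact_solution f 0 u.
  split; first exact: (measurableT_comp mu0).
    exists w; split=> // t _; apply: filterS2 (ae_enorm_gt0 n0) fw => x x0.
    by rewrite /u x0.
  move=> t x; rewrite -eq_le => /eqP <-; rewrite /u heat0 /duhamel set_itvco0.
  by rewrite Rintegral_set0 mulr0 addr0.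
have hu : herz_norm +oo%E alpha q (u 0) = herz_norm +oo%E alpha q f.
  by apply: eq_herz_norm => //; apply: filterS (ae_enorm_gt0 n0) => x x0; rewrite /u x0.
have [_ ff] := hf; have fn := herz_norm_ge0 alpha f q1.
have [|tau tau0 H] := @exact_extend R n alpha beta gamma eps A q n0 beta0 eps0 ea
    sigma02 den q1 (fine (herz_norm +oo%E alpha q f)).
  exact: fine_ge0.
exists (0 + tau); first by rewrite add0r.
apply: (H f 0 u) => //.
by rewrite hu fineK// ge0_fin_numE.
Qed.

Lemma exact_herz_solution f T u : herz +oo%E alpha q f -> 0 <= T ->
  exact_solution f T u -> herz_solution A gamma beta +oo%E alpha q f T u.
Proof.
move=> hf T0 eu; split; last exact: (exact_mild n0 beta0 eps0' ea sigma02 den q1 eu).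
exact: (exact_class n0 beta0 eps0 ea sigma02 den q1 hf T0 eu).
Qed.

(* Two exact solutions are equal everywhere, not just almost everywhere, because
   the right-hand side of their equation only depends on classes modulo null sets. *)
Lemma exact_eq f T T' u v t : herz +oo%E alpha q f -> exact_solution f T u ->
  exact_solution f T' v -> 0 <= t -> t <= T -> t <= T' -> u t = v t.
Proof.
move=> hf eu ev t0 tT tT'; apply/funext => x.
have eut := exact_sub tT eu; have evt := exact_sub tT' ev.
have uv := herz_solution_unique n0 beta0 eps0' ea sigma02 den q1
  (exact_herz_solution hf t0 eut) (exact_herz_solution hf t0 evt).
have [ju _ uE] := eut; have [jv _ vE] := evt.
have tt : 0 <= t <= t by rewrite t0 lexx.
rewrite (uE _ _ tt) (vE _ _ tt).
suff -> : duhamel (hh u) 0 t t x = duhamel (hh v) 0 t t x by [].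
apply: eq_Rintegral => s; rewrite inE/= in_itv/= => /andP[s0 st].
rewrite !heat_conv_heat ?subr_gt0//; apply: eq_heat; rewrite ?subr_gt0//.
- by apply: measurable_hardy_henon; exact: joint_slice.
- by apply: measurable_hardy_henon; exact: joint_slice.
- have sT : 0 <= s <= t by rewrite s0 ltW.
  by apply: filterS (uv s sT) => y; rewrite /hardy_henon => ->.
Qed.

Lemma eq_herz_solution f T u v : (forall t, 0 <= t <= T -> u t = v t) ->
  herz_solution A gamma beta +oo%E alpha q f T u ->
  herz_solution A gamma beta +oo%E alpha q f T v.
Proof.
move=> uv [[hu [M uM] cu] mu_]; split; last first.
  move=> t tT; have [_ t1] := andP tT; rewrite -(uv t tT).
  have E x : \int[mu]_(s in `[0, t]) heat (t - s) (hardy_henon gamma beta (v s)) x =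
      \int[mu]_(s in `[0, t]) heat (t - s) (hardy_henon gamma beta (u s)) x.
    apply: eq_Rintegral => s; rewrite inE/= in_itv/= => /andP[s0 st].
    by rewrite uv// s0 (le_trans st).
  by apply: filterS (mu_ t tT) => x; rewrite E.
split; first by move=> t tT; rewrite -uv//; exact: hu.
  by exists M => t tT; rewrite -uv//; exact: uM.
move=> t tT; have [hut cut] := cu t tT.
have sub s : `]0, T]%classic s -> u s = v s.
  by rewrite /= in_itv/= => /andP[s0 sT]; apply: uv; rewrite ltW.
rewrite -(sub t tT); split=> //; apply: cvg_trans cut; apply: near_eq_cvg.
near=> s; have sT : `]0, T]%classic s by near: s; exact: withinT.
by rewrite (sub s sT).
Unshelve. all: by end_near. Qed.

Lemma herz_solution_sub f T T' u : T' <= T ->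
  herz_solution A gamma beta +oo%E alpha q f T u ->
  herz_solution A gamma beta +oo%E alpha q f T' u.
Proof.
move=> TT [[hu [M uM] cu] mu_].
have sub t : 0 <= t <= T' -> 0 <= t <= T.
  by move=> /andP[t0 tT]; rewrite t0 (le_trans tT).
split; last by move=> t tT; exact: mu_ (sub _ tT).
split; [by move=> t /sub; exact: hu|by exists M => t /sub; exact: uM|].
have sub' : `]0, T']%classic `<=` `]0, T]%classic.
  by move=> t; rewrite /= !in_itv/= => /andP[-> tT]; exact: le_trans TT.
move=> t tT; have [hut cut] := cu t (sub' t tT); split=> //.
by apply: cvg_trans cut; apply: cvg_app; exact: within_subset.
Qed.

(** Only exact solutions are counted; [herz_solution_lt_max_time] shows that no solution of the
    class lives longer. *)
Definition max_time f : \bar R :=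
  ereal_sup [set T%:E | T in [set T | 0 < T /\ exists u, exact_solution f T u]].

(** A solution is chosen for each t separately; [exact_eq] makes the value independent of the
    choice. *)
Definition max_solution f t : Rn -> R :=
  if pselect (exists u, exact_solution f t u) is left h then projT1 (cid h) t else cst 0.

Lemma max_solutionE f T u t : herz +oo%E alpha q f -> exact_solution f T u ->
  0 <= t <= T -> max_solution f t = u t.
Proof.
move=> hf eu /andP[t0 tT]; rewrite /max_solution; case: pselect => [h|]; last first.
  by case; exists u; exact: exact_sub eu.
by case: (cid h) => v /= ev; exact: (exact_eq hf ev eu).
Qed.

Lemma le_max_time f T u : 0 < T -> exact_solution f T u -> (T%:E <= max_time f)%E.
Proof. by move=> T0 eu; apply: ereal_sup_ubound; exists T => //; split=> //; exists u. Qed.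

Lemma lt_max_time f (y : \bar R) : (y < max_time f)%E ->
  exists T u, [/\ 0 < T, (y < T%:E)%E & exact_solution f T u].
Proof.
by move=> /ereal_sup_gt[_ [T [T0 [u eu]] <-] yT]; exists T, u.
Qed.

Lemma max_time_gt0 f : herz +oo%E alpha q f -> (0 < max_time f)%E.
Proof.
move=> /exact_local[T T0 [u eu]]; apply: lt_le_trans (le_max_time T0 eu).
by rewrite lte_fin.
Qed.

Lemma max_solution_herz f T : herz +oo%E alpha q f -> 0 < T -> (T%:E < max_time f)%E ->
  herz_solution A gamma beta +oo%E alpha q f T (max_solution f).
Proof.
move=> hf T0 /lt_max_time[T' [u [T'0 TT eu]]].
rewrite lte_fin in TT; have eT := exact_sub (ltW TT) eu.
apply: eq_herz_solution (exact_herz_solution hf (ltW T0) eT) => t tT.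
by rewrite (max_solutionE hf eT tT).
Qed.

Lemma max_time_extend f B : herz +oo%E alpha q f -> 0 <= B -> exists2 tau, 0 < tau &
  forall t, 0 < t -> (t%:E < max_time f)%E ->
  (herz_norm +oo%E alpha q (max_solution f t) <= B%:E)%E ->
  ((t + tau)%:E <= max_time f)%E.
Proof.
move=> hf B0; have [tau tau0 H] := @exact_extend R n alpha beta gamma eps A q n0 beta0
  eps0 ea sigma02 den q1 B B0.
exists tau => // t t0 /lt_max_time[T [u [T0 tT eu]]] uB; rewrite lte_fin in tT.
have et := exact_sub (ltW tT) eu.
have tt : 0 <= t <= t by rewrite ltW/=.
rewrite (max_solutionE hf et tt) in uB.
have [v ev] := H f t u hf (ltW t0) et uB.
by apply: le_max_time ev; exact: addr_gt0.
Qed.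

(** A solution reaching the maximal time would, by uniqueness, bound the maximal one up to that
    time, and the continuation step would then lead beyond it. *)
Lemma herz_solution_lt_max_time f T v : herz +oo%E alpha q f -> 0 < T ->
  herz_solution A gamma beta +oo%E alpha q f T v -> (T%:E < max_time f)%E.
Proof.
move=> hf T0 sv; rewrite ltNge; apply/negP => Tm.
have m0 := max_time_gt0 hf.
have mf : max_time f \is a fin_num.
  by rewrite ge0_fin_numE ?(ltW m0)//; apply: le_lt_trans Tm (ltry _).
have [[_ [M vM] _] _] := sv.
have [tau tau0 H] := max_time_extend hf (normr_ge0 M).
have [Tm' mE] : exists Tm' : R, max_time f = Tm'%:E.
  by exists (fine (max_time f)); rewrite fineK.
rewrite mE !lee_fin in Tm; rewrite mE lte_fin in m0.
(* A positive time less than tau before the maximal one. *)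
pose t := Num.max (Tm' - tau / 2) (Tm' / 2).
have tm : t < Tm' by rewrite gt_max; apply/andP; split; lra.
have t0 : 0 < t by rewrite lt_max; apply/orP; right; lra.
have tT : t <= T := le_trans (ltW tm) Tm.
have tt : 0 <= t <= t by rewrite ltW/=.
have tlt : (t%:E < max_time f)%E by rewrite mE lte_fin.
have uv := herz_solution_unique n0 beta0 eps0' ea sigma02 den q1
  (max_solution_herz hf t0 tlt) (herz_solution_sub tT sv) tt.
have := H t t0 tlt; rewrite (eq_herz_norm alpha q1 uv) => /(_ _)/wrap[].
  by apply: le_trans (vM t _) _; [rewrite ltW|rewrite lee_fin ler_norm].
rewrite mE lee_fin => tB; have : Tm' - tau / 2 <= t by rewrite le_max lexx.
by lra.
Qed.

(** The norm exceeds B at every time within tau(B) of the end, not just along a sequence, because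
    the step depends on B alone; hence a true limit. *)
Lemma max_time_blowup f : herz +oo%E alpha q f -> max_time f = +oo%E \/
  exists2 Tm : R, max_time f = Tm%:E &
    herz_norm +oo%E alpha q (max_solution f t) @[t --> Tm^'-] --> +oo%E.
Proof.
move=> hf; have := max_time_gt0 hf; case E : (max_time f) => [Tm| |] //; last by left.
rewrite lte_fin => m0; right; exists Tm => //; apply/cvgeyPge => B.
have [tau tau0 H] := max_time_extend hf (normr_ge0 B).
near=> t.
have tm : t < Tm by near: t; exact: nbhs_left_lt.
have t0 : 0 < t by near: t; exact: nbhs_left_gt.
have tt : Tm - tau < t by near: t; apply: nbhs_left_gt; rewrite ltrBlDr ltrDl.
rewrite leNgt; apply/negP => Bt.
have := H t t0; rewrite E lte_fin lee_fin => /(_ tm)/(_ _)/wrap[].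
  by apply: le_trans (ltW Bt) _; rewrite lee_fin ler_norm.
by lra.
Unshelve. all: by end_near. Qed.

End MaximalSolution.

Theorem theorem3p5 (R : realType) (a : R) (n : nat) (r : \bar R)
    (gamma beta alpha : R) (u0 : n.-tuple (measurableTypeR R) -> R) :
  (1 <= n)%N -> (1 <= r)%E -> gamma < n%:R -> 0 < beta -> 0 < alpha ->
  - gamma / beta <= alpha ->
  alpha < Num.min (Num.min ((2 - gamma) / beta) ((n%:R - gamma) / (beta + 1)))
                  (n%:R / (beta + 1)) ->
  herz +oo%E alpha r u0 ->
  exists (T : R) (u : R -> n.-tuple (measurableTypeR R) -> R),
    [/\ 0 < T,
        [/\ herz_solution a gamma beta +oo%E alpha r u0 T u,
            herz_continuous +oo%E alpha r `[0, T]
              (fun t => u t \- heat t u0),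
            herz_continuous +oo%E alpha r `[0, T] u <->
              herz_continuous +oo%E alpha r `[0, T] (fun t => heat t u0) &
            forall v, herz_solution a gamma beta +oo%E alpha r u0 T v ->
              ae_equal_on T v u] &
        exists (Tmax : \bar R) (U : R -> n.-tuple (measurableTypeR R) -> R),
          [/\ (T%:E < Tmax)%E,
              ae_equal_on T U u,
              forall T' : R, 0 < T' -> (T'%:E < Tmax)%E ->
                herz_solution a gamma beta +oo%E alpha r u0 T' U,
              forall (T' : R) v, 0 < T' ->
                herz_solution a gamma beta +oo%E alpha r u0 T' v ->
                (T'%:E < Tmax)%E /\ ae_equal_on T' v U &
              Tmax = +oo%E \/
              exists2 Tm : R, Tmax = Tm%:E &
                herz_norm +oo%E alpha r (U t) @[t --> Tm^'-] --> +oo%E]].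
Proof.
move=> n0 r1 gn beta0 alpha0; rewrite ler_pdivrMr// !lt_min !ltr_pdivlMr//; last first.
- by rewrite addr_gt0.
- by rewrite addr_gt0.
move=> ga /andP[/andP[g2 gn1] _] hu0.
have sigma02 : 0 <= alpha * beta + gamma < 2 by apply/andP; split; lra.
(* Half of the gap to n keeps the last condition strict; [alpha] is the bound required for stability
   of the heat flow. *)
pose eps := Num.min alpha ((n%:R - (alpha + (alpha * beta + gamma))) / 2).
have eps0 : 0 < eps by rewrite lt_min alpha0/= divr_gt0//; lra.
have ea : eps <= alpha by rewrite ge_min lexx.
have den : alpha + (alpha * beta + gamma) + eps < n%:R.
  have : eps <= (n%:R - (alpha + (alpha * beta + gamma))) / 2 by rewrite ge_min lexx orbT.
  by move: gn1; rewrite mulrDr mulr1; lra.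
have [T1 T10 [u eu1]] := exact_local a n0 beta0 eps0 ea sigma02 den r1 hu0.
(* Halving the existence time makes it strictly smaller than the maximal one. *)
pose T := T1 / 2; have T0 : 0 < T by exact: divr_gt0.
have TT1 : T < T1 by rewrite /T; lra.
have eu := exact_sub (ltW TT1) eu1.
have su := exact_herz_solution n0 beta0 eps0 ea sigma02 den r1 hu0 (ltW T0) eu.
exists T, u; split=> //.
  split=> //.
  - exact: (exact_continuous_duhamel n0 beta0 eps0 ea sigma02 den r1 hu0 (ltW T0) eu).
  - exact: (exact_continuity_iff n0 beta0 eps0 ea sigma02 den r1 hu0 (ltW T0) eu).
  - by move=> v sv; exact: (herz_solution_unique n0 beta0 (ltW eps0) ea sigma02 den r1 sv su).
exists (@max_time R n alpha beta gamma eps a r u0).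
exists (@max_solution R n alpha beta gamma eps a r u0); split.
- by apply: lt_le_trans (le_max_time T10 eu1); rewrite lte_fin.
- move=> t tT; apply: aeW => x.
  by rewrite (max_solutionE n0 beta0 eps0 ea sigma02 den r1 hu0 eu tT).
- by move=> T' T'0 T'm; exact: max_solution_herz.
- move=> T' v T'0 sv.
  have lt_m := herz_solution_lt_max_time n0 beta0 eps0 ea sigma02 den r1 hu0 T'0 sv.
  split=> //; apply: (herz_solution_unique n0 beta0 (ltW eps0) ea sigma02 den r1 sv).
  exact: max_solution_herz.
- exact: max_time_blowup.
Qed.
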